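(* Let $p$ be an odd prime and let $M_p$ be the $\frac{p+1}{2}\times\frac{p+1}{2}$ matrix obtained from $\left[\left(\frac{i-j}{p}\right)\right]_{0\le i,j\le (p-1)/2}$ by replacing all the entries in the first row (the row with $i=0$) by $1$. Then $$\det M_p=\begin{cases}(-1)^{\frac{p-1}{4}} & \text{if } p\equiv 1\pmod 4,\\ (-1)^{(h(-p)-1)/2} & \text{if } p\equiv 3\pmod 4,\end{cases}$$ where $h(-p)$ is the class number of the imaginary quadratic field $\mathbb{Q}(\sqrt{-p})$.
   Context: $\left(\frac{\cdot}{p}\right)$ denotes the Legendre symbol modulo $p$, with $\left(\frac{x}{p}\right)=0$ if $p\mid x$, $1$ if $x$ is a nonzero square modulo $p$, and $-1$ otherwise.
   Formalization: The case p ≡ 3 (mod 4) is stated only for p ≠ 3, since at p = 3 the claim fails: det M_3 = -1, while h(-3) = 1 gives (-1)^0 = 1. *)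

(* Defs.v *)
From HB Require Import structures.
From mathcomp Require Import all_boot all_order all_algebra all_field.
From mathcomp Require Import finmap.
From mathcomp Require Import boolp classical_sets functions cardinality.

Set Implicit Arguments.
Unset Strict Implicit.
Unset Printing Implicit Defensive.

Import Order.TTheory GRing.Theory Num.Theory.

Local Open Scope classical_set_scope.
Local Open Scope ring_scope.

Definition legendre (p : nat) (x : int) : int :=
  if (p %| x)%Z then 0
  else if [exists y : 'I_p, (x == (y : nat)%:Z ^+ 2 %[mod p])%Z] then 1
  else -1.

Definition legendre_mx (p : nat) : 'M[int]_((p.+1)./2) :=
  \matrix_(i, j) legendre p ((i : nat)%:Z - (j : nat)%:Z).

Definition Mp (p : nat) : 'M[int]_((p.+1)./2) :=
  \matrix_(i, j) (if (i : nat) == 0%N then 1 else legendre_mx p i j).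

(* Number fields are given as subsets of the field algC of algebraic numbers. *)
Definition quadratic_field (d : int) : set algC :=
  [set z | exists a b : rat, z = ratr a + ratr b * sqrtC (d%:~R)].

Definition ring_of_integers (K : set algC) : set algC :=
  [set z | K z /\ z \in Aint].

(* Stability under negation follows from -1 being an algebraic integer. *)
Definition fractional_ideal (K I : set algC) : Prop :=
  [/\ I `<=` K,
      (I 0 /\ exists2 x, I x & x != 0),
      (forall x y, I x -> I y -> I (x + y)),
      (forall r x, ring_of_integers K r -> I x -> I (r * x))
    & exists2 d, ring_of_integers K d /\ d != 0 &
        forall x, I x -> ring_of_integers K (d * x)].

(* The coset of I modulo the subgroup of principal fractional ideals:
   the product of I with the principal ideal generated by c is c I. *)
Definition ideal_class (K I : set algC) : set (set algC) :=
  [set J | exists2 c, K c /\ c != 0 & J = [set c * x | x in I]].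

Definition class_group (K : set algC) : set (set (set algC)) :=
  [set ideal_class K I | I in [set I | fractional_ideal K I]].

(* fset_set sends a finite set to its finite support, so this is the order of
   the class group as soon as the latter is finite. *)
Definition class_number (K : set algC) : nat :=
  #|` fset_set (class_group K) |.

(* Main.v *)
(* Write n = (p - 1)/2 and let chi be the Legendre symbol mod p.

   The determinant is 1 or -1 because M_p is invertible modulo every prime q.
   Modulo p, chi(i - j) is (i - j)^n, and the binomial expansion factors M_p
   into Vandermonde matrices, which gives det M_p = (-1)^n n!^n.  Modulo q <> 2, p,
   take a primitive p-th root of unity eta in characteristic q: by the Gauss sum
   evaluation of the cyclic convolution with chi, a vector in the kernel gives
   a polynomial of degree at most p with p + 1 roots among the +-eta^k.
   Modulo 2 the matrix is J - I apart from its first row.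

   If p = 3 mod 4, then n! = (-1)^N mod p, where N is the number of nonresidues
   up to n, and it remains to find the class number h mod 4.  This is done by the
   class number formula p h = sum_(k < p) sum_(i <= k) chi(i), that is
   h = - (1/p) sum k chi(k), proved with finite sums only.  Ideal classes
   correspond to lattices Za + Z(x + w), w = (1 + sqrt(-p))/2, with a | N(x + w), the
   associated binary forms represent m > 0 in 2 sum_(d | m) chi(d) ways in total,
   and we evaluate
     sum over forms Q and over (u, v) of eps(u, v) q^Q(u, v),   q -> 1,
   with eps = (-1)^u + (-1)^v + (-1)^(u + v), which is 3 if u and v are even and
   -1 otherwise.  Completing the square turns the sum over (u, v) into products
   of alternating Gaussian sums, so it tends to 0.  Summed by the value of Q, it
   is 3 h - 2 sum_d chi(d) (z/(1 + z) + 2 z^2/(1 + z^2)) with z = q^d, and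
   Abel summation gives the limit 3 h - 3 h', h' being the mean over a period of
   the partial sums of chi. *)
Require Import Defs.
From HB Require Import structures.
From mathcomp Require Import all_boot all_order all_algebra all_fingroup all_solvable all_field.
From mathcomp Require Import finmap.
From mathcomp Require Import boolp classical_sets functions cardinality.
From mathcomp Require Import zify ring lra.

Set Implicit Arguments.
Unset Strict Implicit.
Unset Printing Implicit Defensive.

Import Order.TTheory GRing.Theory Num.Theory.

Local Open Scope ring_scope.

(** * The Legendre symbol and Gauss sums *)

(** The weights eps remove the main term of order 1/(1 - q) that an unweighted lattice sum has, so
    that the origin, with weight 3, becomes visible once per class. On the divisor side the same
    cancellation is that of the poles at z = 1 in z/(1 - z) - 4 z^4/(1 - z^4). No limit is taken:
    the comparison is made over the rationals with explicit errors. One puts q = x^l, where x = 1 -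
    1/k^2, so that 1/k serves as square root of 1 - x, and l is a common multiple of all 4 a and 4
    c, so that completing the square leaves integer exponents for every form; then |h - h'| is at
    most a constant over k, for all large k. The exclusion of p = 3 enters through the units: they
    have to be 1 and -1 for each ideal to come from exactly two vectors. The residue of h mod 4
    results from evaluating sum k chi(k) twice, once by pairing k with p - k and once by pairing 2 k
    with p - 2 k. Eliminating the half moment gives (2 - chi(2)) h = sum_(k <= n) chi(k) = n - 2 N,
    and chi(2) is known from Gauss's lemma. *)

Section Legendre.
Variable p : nat.
Hypothesis (pp : prime p) (op : odd p).

Lemma odd_halfS : p = (p./2).*2.+1.
Proof. by rewrite -[LHS]odd_double_half op. Qed.

Lemma intr_Fp_eq0 (x : int) : (x%:~R == 0 :> 'F_p) = (p %| x)%Z.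
Proof. by rewrite -(dvdz_pcharf (pchar_Fp pp)). Qed.

Lemma natr_Fp_eq0 (x : nat) : (x%:R == 0 :> 'F_p) = (p %| x)%N.
Proof. by rewrite -(dvdn_pcharf (pchar_Fp pp)). Qed.

Lemma intr_Fp_eq (x y : int) : (x%:~R == y%:~R :> 'F_p) = (x == y %[mod p])%Z.
Proof. by rewrite eqz_mod_dvd -intr_Fp_eq0 rmorphB subr_eq0. Qed.

Lemma Fp_valK (z : 'F_p) : (z : nat)%:R = z.
Proof. exact: natr_Zp. Qed.

Lemma Fp_val_lt (z : 'F_p) : (z < p)%N.
Proof. by rewrite -[X in (_ < X)%N](Fp_cast pp) ltn_ord. Qed.

Lemma Fp_val_nat (k : nat) : (k < p)%N -> (k%:R : 'F_p) = k :> nat.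
Proof. by move=> kp; rewrite val_Fp_nat // modn_small. Qed.

Definition lg (z : 'F_p) : int :=
  if z == 0 then 0 else if [exists y : 'F_p, z == y ^+ 2] then 1 else -1.

Lemma legendreE x : legendre p x = lg x%:~R.
Proof.
rewrite /legendre /lg intr_Fp_eq0; case: ifP => // _.
suff -> : [exists y : 'I_p, (x == (y : nat)%:Z ^+ 2 %[mod p])%Z]
        = [exists y : 'F_p, x%:~R == y ^+ 2 :> 'F_p] by [].
apply/existsP/existsP => -[y].
  by rewrite -intr_Fp_eq rmorphXn /= => yE; exists (y : nat)%:R.
move=> yE; exists (Ordinal (Fp_val_lt y)); rewrite -intr_Fp_eq rmorphXn /=.
by rewrite -pmulrn Fp_valK.
Qed.

Lemma lg0 : lg 0 = 0. Proof. by rewrite /lg eqxx. Qed.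

Lemma lg_cases z : z != 0 -> lg z = 1 \/ lg z = -1.
Proof. by rewrite /lg => /negPf->; case: ifP; [left|right]. Qed.

Lemma lg_sqr z : z != 0 -> lg z * lg z = 1.
Proof. by case/lg_cases => ->. Qed.

Lemma lg_eq0 z : (lg z == 0) = (z == 0).
Proof. by rewrite /lg; case: ifP => //; case: ifP. Qed.

Lemma lg_square y : y != 0 -> lg (y ^+ 2) = 1.
Proof.
move=> y0; rewrite /lg expf_eq0 /= (negPf y0).
by case: existsP => // -[]; exists y.
Qed.

Lemma Fp_fermat (z : 'F_p) : z != 0 -> z ^+ p.-1 = 1.
Proof.
move=> z0; apply: (mulfI z0); rewrite mulr1 -exprS prednK ?prime_gt0 //.
by have := expf_card z; rewrite card_Fp.
Qed.

Lemma Fp_1N1 : (1 : 'F_p) != -1.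
Proof.
rewrite -subr_eq0 opprK (_ : 1 + 1 = 2%:R) // natr_Fp_eq0 gtnNdvd //.
exact: odd_prime_gt2.
Qed.

Lemma Fp_half_eq0 k : (0 < k <= p./2)%N -> (k%:R != 0 :> 'F_p).
Proof.
move=> /andP[k0 kn]; rewrite natr_Fp_eq0 gtnNdvd //.
have := odd_halfS; lia.
Qed.

(* The squares 1^2, ..., n^2 are n distinct roots of X^n - 1, so a root of
   that polynomial is a square. *)
Lemma euler_square (z : 'F_p) : z ^+ p./2 = 1 -> exists y, z = y ^+ 2.
Proof.
move=> zn; pose n := p./2; pose P : {poly 'F_p} := 'X^n - 1.
have n0 : (0 < n)%N by have := odd_prime_gt2 op pp; have := odd_halfS; rewrite /n; lia.
have P0 : P != 0 by rewrite -size_poly_eq0 size_XnsubC.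
have [/existsP[y /eqP->]|nsq] := boolP [exists y : 'F_p, z == y ^+ 2].
  by exists y.
pose rs := z :: [seq (k%:R : 'F_p) ^+ 2 | k <- iota 1 n].
have rsP : all (root P) rs.
  apply/allP => w; rewrite inE => /orP[/eqP->|/mapP[k]].
    by rewrite rootE !hornerE zn subrr.
  rewrite mem_iota => kn ->; rewrite rootE !hornerE -exprM.
  have -> : (2 * n)%N = p.-1 by have := odd_halfS; rewrite /n; lia.
  rewrite Fp_fermat ?subrr // Fp_half_eq0 //; rewrite /n in kn *; lia.
have rsU : uniq rs.
  rewrite /= map_inj_in_uniq ?iota_uniq ?andbT.
    apply/mapP => -[k _ zE]; move/existsP: nsq; apply.
    by exists k%:R; rewrite zE.
  move=> k l; rewrite !mem_iota => kn ln /eqP; rewrite eqf_sqr => /orP[].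
    move=> /eqP/(congr1 (@nat_of_ord _)); rewrite !Fp_val_nat //.
    - have := odd_halfS; rewrite /n in kn ln *; lia.
    - have := odd_halfS; rewrite /n in kn ln *; lia.
  rewrite -subr_eq0 opprK -natrD natr_Fp_eq0 gtnNdvd //; first lia.
  have := odd_halfS; rewrite /n in kn ln *; lia.
have := max_poly_roots P0 rsP rsU.
by rewrite size_XnsubC //= size_map size_iota ltnn.
Qed.

Lemma euler_crit (z : 'F_p) : (lg z)%:~R = z ^+ p./2.
Proof.
have [->|z0] := eqVneq z 0.
  rewrite lg0 expr0n; have := odd_prime_gt2 op pp; have := odd_halfS.
  by case: (p./2) => // -> .
have /orP[/eqP zn|/eqP zn] : (z ^+ p./2 == 1) || (z ^+ p./2 == -1).
  rewrite -eqf_sqr expr1n -exprM muln2.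
  by rewrite (_ : _.*2 = p.-1) ?Fp_fermat //; have := odd_halfS; lia.
  have [y yE] := euler_square zn; rewrite zn yE lg_square //.
  by apply: contraNneq z0 => y0; rewrite yE y0 expr0n.
rewrite zn /lg (negPf z0); case: existsP => // -[y /eqP yE].
have y0 : y != 0 by apply: contraNneq z0 => y0; rewrite yE y0 expr0n.
move: zn; rewrite yE -exprM mul2n (_ : _.*2 = p.-1); last first.
  by have := odd_halfS; lia.
by rewrite Fp_fermat // => /eqP; rewrite (negPf Fp_1N1).
Qed.

(** As p is odd, -1, 0 and 1 stay distinct in ['F_p]; an identity between symbols may therefore be
    checked after reduction, where Euler's criterion turns it into one between powers. *)
Lemma lg_inj_Fp (a b z w : 'F_p) : (lg z * lg w)%:~R = (lg a)%:~R :> 'F_p ->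
  lg z * lg w = lg a.
Proof.
have N1 := Fp_1N1; have N1' : (-1 : 'F_p) != 1 by rewrite eq_sym.
rewrite /lg; do !case: ifP => _; rewrite ?(mulr0,mul0r,mulr1,mul1r,mulrN,opprK) //=;
  move/eqP; rewrite ?mulr0z ?mulr1z ?mulrN1z ?rmorphN /= ?rmorph1
   ?oppr_eq0 ?oner_eq0 ?(negPf N1) ?(negPf N1') // eq_sym ?oppr_eq0 ?oner_eq0 //.
Qed.

Lemma lgM z w : lg (z * w) = lg z * lg w.
Proof.
apply/esym/lg_inj_Fp => //.
by rewrite rmorphM /= !euler_crit exprMn.
Qed.

Lemma lg1 : lg 1 = 1.
Proof. by rewrite -(expr1n _ 2) lg_square ?oner_neq0. Qed.

Lemma lgN1 : lg (-1) = (-1) ^+ p./2.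
Proof.
have N1 := Fp_1N1; have N1' : (-1 : 'F_p) != 1 by rewrite eq_sym.
have := euler_crit (-1); rewrite -signr_odd -[RHS]signr_odd.
rewrite /lg oppr_eq0 oner_eq0; case: ifP => _; case: odd => //= /eqP.
  by rewrite expr1 (negPf N1).
by rewrite expr0 (negPf N1').
Qed.

(** A nonresidue exists, since otherwise X^n - 1 would have p - 1 > n roots; multiplication by it
    permutes ['F_p] and negates the sum. *)
Lemma sum_lg : \sum_(z : 'F_p) lg z = 0.
Proof.
have [z zN] : exists z : 'F_p, lg z = -1.
  have [/existsP[z /eqP ?]|] := boolP [exists z : 'F_p, lg z == -1]; first by exists z.
  rewrite negb_exists => /forallP h; exfalso.
  pose n := p./2; pose P : {poly 'F_p} := 'X^n - 1.
  have n0 : (0 < n)%N by have := odd_prime_gt2 op pp; have := odd_halfS; rewrite /n; lia.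
  have P0 : P != 0 by rewrite -size_poly_eq0 size_XnsubC.
  have := @max_poly_roots _ P (enum (predC1 (0 : 'F_p))) P0.
  rewrite enum_uniq size_XnsubC // -cardE cardC1 card_Fp // => /(_ _ isT).
  have nP : (p.-1 < n.+1)%N = false by have := odd_halfS; rewrite /n; lia.
  rewrite nP => hh; suff: false by [].
  apply: hh; apply/allP => z; rewrite mem_enum !inE => z0.
  rewrite rootE !hornerE -euler_crit; have /negPf := h z.
  by case/lg_cases: z0 => -> // _; rewrite subrr.
have z0 : z != 0 by apply/eqP => z0; move: zN; rewrite z0 lg0.
have : \sum_(w : 'F_p) lg w = - \sum_(w : 'F_p) lg w.
  rewrite [LHS](reindex_inj (mulfI z0)) -sumrN.
  by apply: eq_bigr => w _; rewrite lgM zN mulN1r.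
lia.
Qed.

End Legendre.

Section GaussSum.
Variables (p : nat) (F : fieldType) (eta : F).
Hypothesis (pp : prime p) (op : odd p) (etaP : p.-primitive_root eta).

Lemma prim_exp_Fp (k : nat) : eta ^+ (k%:R : 'F_p) = eta ^+ k.
Proof. by rewrite val_Fp_nat // prim_expr_mod. Qed.

Lemma prim_expD_Fp (a b : 'F_p) : eta ^+ (a + b)%R = eta ^+ a * eta ^+ b.
Proof. by rewrite -{1}(Fp_valK a) -{1}(Fp_valK b) -natrD prim_exp_Fp exprD. Qed.

Lemma prim_expM_Fp (a b : 'F_p) : eta ^+ (a * b)%R = (eta ^+ a) ^+ b.
Proof. by rewrite -{1}(Fp_valK a) -{1}(Fp_valK b) -natrM prim_exp_Fp exprM. Qed.

Lemma prim_exp_Fp_inj (a b : 'F_p) : eta ^+ a = eta ^+ b -> a = b.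
Proof.
move/eqP; rewrite (eq_prim_root_expr etaP) !modn_small ?Fp_val_lt //.
by move/eqP => ab; apply: val_inj.
Qed.

Lemma sum_prim_Fp (b : 'F_p) :
  \sum_(a : 'F_p) eta ^+ (b * a)%R = if b == 0 then p%:R else 0.
Proof.
have [->|b0] := eqVneq b 0.
  under eq_bigr do rewrite mul0r expr0.
  by rewrite sumr_const card_Fp.
have e1 : eta ^+ b != 1.
  by apply: contraNneq b0 => e1; apply/eqP/prim_exp_Fp_inj; rewrite e1 expr0.
(* Shifting [a] by 1 multiplies the sum by [eta ^+ b], which is not 1. *)
apply/eqP; rewrite -(mulIr_eq0 _ (mulIf _ : GRing.rreg (eta ^+ b - 1))) ?subr_eq0 //.
  rewrite mulrBr mulr1 mulr_suml subr_eq0; apply/eqP.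
  rewrite [RHS](reindex_inj (addrI (1 : 'F_p))); apply: eq_bigr => a _.
  by rewrite mulrDr mulr1 prim_expD_Fp mulrC.
Qed.

(** The field is arbitrary on purpose: the sum is used in finite fields of characteristic q, for the
    determinant modulo q and again for reciprocity. *)
Definition gauss : F := \sum_(k : 'F_p) (lg k)%:~R * eta ^+ k.

Lemma gauss_twist (a : 'F_p) :
  \sum_(k : 'F_p) (lg k)%:~R * eta ^+ (a * k)%R = (lg a)%:~R * gauss.
Proof.
have [->|a0] := eqVneq a 0.
  under eq_bigr do rewrite mul0r expr0 mulr1.
  by rewrite lg0 mul0r -rmorph_sum /= sum_lg.
rewrite /gauss [in RHS](reindex_inj (mulfI a0)) mulr_sumr.
apply: eq_bigr => k _; rewrite lgM // mulrA -rmorphM /= mulrA lg_sqr //.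
by rewrite mul1r.
Qed.

Lemma gauss_sqr : gauss ^+ 2 = (lg (-1 : 'F_p))%:~R * p%:R.
Proof.
rewrite expr2 {1}/gauss mulr_suml.
(* One factor is absorbed into a twist by [a], so that summing over [a] first leaves only k = -1. *)
transitivity (\sum_(a : 'F_p) \sum_(k : 'F_p) (lg k)%:~R * eta ^+ ((1 + k) * a)%R).
  apply: eq_bigr => a _; rewrite mulrAC -gauss_twist mulr_suml.
  apply: eq_bigr => k _; rewrite mulrDl mul1r prim_expD_Fp mulrC [(k * a)%R]mulrC.
  by rewrite mulrCA !mulrA.
rewrite exchange_big; under eq_bigr do rewrite -mulr_sumr sum_prim_Fp.
rewrite (bigD1 (-1)) // subrr eqxx /= big1 ?addr0 // => k k1.
by rewrite addrC addr_eq0 (negPf k1) mulr0.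
Qed.

Lemma gauss_neq0 : gauss != 0.
Proof.
rewrite -sqrf_eq0 gauss_sqr mulf_neq0 //.
  have /lg_cases[->|->] : (-1 : 'F_p) != 0 by rewrite oppr_eq0 oner_eq0.
    by rewrite mulr1z oner_eq0.
  by rewrite mulrN1z oppr_eq0 oner_eq0.
exact: prim_root_natf_neq0 etaP.
Qed.

End GaussSum.

(** * The determinant is a unit *)

Section CyclotomicKernel.
Variables (p : nat) (F : fieldType) (eta : F).
Hypothesis (pp : prime p) (op : odd p) (etaP : p.-primitive_root eta).
Hypothesis (F2 : 2%:R != 0 :> F).

Lemma prim_exp_Fp_prim (k : 'F_p) : (eta ^+ k) ^+ p = 1.
Proof. by rewrite exprAC (prim_expr_order etaP) expr1n. Qed.

(** Each k != 0 provides exactly one root and k = 0 provides two, which makes p + 1. They are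
    distinct: p being odd, the p-th powers are 1 for eta^k and -1 for -eta^k, and the characteristic
    is not 2. *)
Lemma poly_eq0_signed_roots (P : {poly F}) (e : int) : e = 1 \/ e = -1 ->
  (size P <= p.+1)%N ->
  (forall k : 'F_p, lg k != - e -> P.[eta ^+ k] = 0) ->
  (forall k : 'F_p, lg k != e -> P.[- eta ^+ k] = 0) -> P = 0.
Proof.
move=> e1 sP r1 r2; apply/eqP; apply/negPn/negP => P0.
pose rs := [seq eta ^+ (k : 'F_p) | k <- enum [pred k : 'F_p | lg k != - e]]
        ++ [seq - eta ^+ (k : 'F_p) | k <- enum [pred k : 'F_p | lg k != e]].
have rsr : all (root P) rs.
  rewrite all_cat; apply/andP; split; apply/allP => x /mapP[k];
    rewrite mem_enum inE => kE ->; apply/eqP.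
    exact: r1.
  exact: r2.
have rsu : uniq rs.
  rewrite cat_uniq; apply/and3P; split.
  - rewrite map_inj_in_uniq ?enum_uniq // => a b _ _.
    exact: prim_exp_Fp_inj.
  - apply/hasPn => x /mapP[k _ ->]; apply/mapP => -[l _] /(congr1 (fun z => z ^+ p)).
    rewrite prim_exp_Fp_prim exprNn -signr_odd op prim_exp_Fp_prim mulr1 expr1.
    move/eqP; rewrite eq_sym -subr_eq0 opprK -mulr2n => h.
    by move: F2; rewrite h.
  - rewrite map_inj_in_uniq ?enum_uniq // => a b _ _ /oppr_inj.
    exact: prim_exp_Fp_inj.
have := max_poly_roots P0 rsr rsu.
rewrite size_cat !size_map -!cardE => /leq_trans/(_ sP).
have -> : (#|[pred k : 'F_p | lg k != - e]| + #|[pred k : 'F_p | lg k != e]|)%N = p.+1.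
  pose A := [pred k : 'F_p | lg k != - e]; pose B := [pred k : 'F_p | lg k != e].
  have AUB : [predU A & B] =i predT.
    by move=> k; rewrite !inE; case: e1 => ->; case: eqVneq => // ->.
  have AIB : [predI A & B] =i pred1 (0 : 'F_p).
    move=> k; rewrite !inE; have [->|k0] := eqVneq k 0.
      by rewrite lg0; case: e1 => ->.
    by case: e1 => ->; case: (lg_cases k0) => ->.
  rewrite -cardUI (eq_card AUB) (eq_card AIB).
  by rewrite card1 addn1 cardE -cardT card_Fp.
by rewrite ltnn.
Qed.

Variable g : nat -> F.
Local Notation n := (p./2).
Hypothesis (g0 : \sum_(j < n.+1) g j = 0).

(** Cyclic convolution of the kernel vector [g] with the Legendre symbol. The rows of the matrix
    give its vanishing at 1, ..., n only; the values at 0 and beyond n are unknown. *)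
Let c (z : 'F_p) := \sum_(j < n.+1) (lg (z - (j : nat)%:R))%:~R * g j.
Hypothesis (gc : forall i, (0 < i <= n)%N -> c i%:R = 0).

(** Arguments of [c] are halved because for even m with 0 < m < p the residue m/2 lies in 1, ..., n,
    where [c] vanishes. The unknown values of m -> c(m/2) then sit at 0 and at odd m, and the even
    places are free to carry [g]. *)
Let h2 : 'F_p := 2%:R^-1.
Let gam : F := (lg (2%:R : 'F_p))%:~R * gauss p eta.
Let gx x := \sum_(j < n.+1) g j * x ^+ j.*2.

Let two_neq0 : 2%:R != 0 :> 'F_p.
Proof. by rewrite natr_Fp_eq0 // gtnNdvd // odd_prime_gt2. Qed.

Let gam_neq0 : gam != 0.
Proof.
rewrite mulf_neq0 ?gauss_neq0 //; have [->|->] := lg_cases two_neq0.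
  by rewrite mulr1z oner_eq0.
by rewrite mulrN1z oppr_eq0 oner_eq0.
Qed.

(** Fourier transform of m -> c(m/2): the convolution becomes a product. The halving turns [g] into
    a polynomial in the square of eta^k and puts the symbol of 2 into [gam]. *)
Let sum_c (k : 'F_p) :
  \sum_(m : 'F_p) c (m * h2) * eta ^+ (m * k)%R = (lg k)%:~R * gam * gx (eta ^+ k).
Proof.
under eq_bigr do rewrite mulr_suml.
rewrite exchange_big mulr_sumr; apply: eq_bigr => j _.
rewrite (reindex_inj (mulfI two_neq0)) (reindex_inj (addIr ((j : nat)%:R : 'F_p))).
transitivity (g j * (eta ^+ k) ^+ j.*2 * \sum_(w : 'F_p) (lg w)%:~R * eta ^+ (2%:R * k * w)%R).
  rewrite mulr_sumr; apply: eq_bigr => w _.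
  have -> : 2%:R * (w + (j : nat)%:R) * h2 = w + (j : nat)%:R.
    by rewrite mulrAC mulfV // mul1r.
  have -> : 2%:R * (w + (j : nat)%:R) * k = 2%:R * k * w + k * (j.*2)%:R.
    by rewrite -muln2 natrM; ring.
  rewrite prim_expD_Fp // prim_expM_Fp //.
  have -> : eta ^+ (k * (j.*2)%:R)%R = (eta ^+ k) ^+ j.*2.
    by rewrite -{1}(Fp_valK k) -natrM prim_exp_Fp // exprM.
  by rewrite -!prim_expM_Fp // addrK; ring.
rewrite gauss_twist // lgM // rmorphM /= /gam.
by ring.
Qed.

(** Coefficients chosen so that the polynomial takes the value (lg k - e) gam gx(eta^k) at eta^k. It
    vanishes where lg k = e, and also at k = 0 because the entries of [g] sum to 0. *)
Let a (e : int) (m : nat) : F :=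
  c (m%:R * h2) - e%:~R * gam * (if odd m then 0 else g m./2).

Let A (e : int) : {poly F} := \poly_(m < p) a e m.

Let c_even (m : nat) : (0 < m < p)%N -> ~~ odd m -> c (m%:R * h2) = 0.
Proof.
move=> mp om; rewrite -(even_halfK om) -muln2 natrM mulfK // gc //.
have := odd_halfS op; have := even_halfK om; lia.
Qed.

Let sum_even (x : F) :
  \sum_(m < p) (if odd m then 0 else g m./2) * x ^+ m = gx x.
Proof.
rewrite /gx -(big_mkord xpredT (fun m => (if odd m then 0 else g m./2) * x ^+ m)).
rewrite -(big_mkord xpredT (fun j => g j * x ^+ j.*2)) {1}(odd_halfS op).
elim: (p./2) => [|k IH]; first by rewrite !big_nat1 /= .
rewrite doubleS big_nat_recr // big_nat_recr // IH [in RHS]big_nat_recr //=.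
by rewrite odd_double /= mul0r addr0 ?doubleK ?uphalf_double ?doubleS.
Qed.

Let A_eval e k : (A e).[eta ^+ (k : 'F_p)] = ((lg k)%:~R - e%:~R) * gam * gx (eta ^+ k).
Proof.
rewrite horner_poly /a.
under eq_bigr do rewrite mulrBl -[X in _ - X]mulrA.
rewrite sumrB -mulr_sumr sum_even !mulrBl -sum_c; congr (_ - _).
rewrite -(big_mkord xpredT (fun m => c (m%:R * h2) * (eta ^+ k) ^+ m)).
rewrite -{1}(card_Fp pp) card_ord big_mkord; apply: eq_bigr => m _.
by rewrite Fp_valK [(m * k)%R]mulrC prim_expM_Fp.
Qed.

Let A_root e (k : 'F_p) : e = 1 \/ e = -1 -> lg k != - e -> (A e).[eta ^+ k] = 0.
Proof.
move=> e1 ke; rewrite A_eval; have [->|k0] := eqVneq k 0.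
  rewrite expr0 [gx _](_ : _ = 0) ?mulr0 // -[RHS]g0.
  by apply: eq_bigr => j _; rewrite expr1n mulr1.
have -> : lg k = e by case: e1 ke => ->; case: (lg_cases k0) => ->.
by rewrite subrr !mul0r.
Qed.

(** For m > 0 the even coefficients of [A e] are odd in e and the odd ones do not depend on e.
    Changing the signs of x and e together therefore negates everything except the contribution c(0)
    to the constant term. *)
Let A_opp e x : (A e).[- x] = c 0 *+ 2 - (A (- e)).[x].
Proof.
apply/eqP; rewrite eq_sym subr_eq; apply/eqP; rewrite !horner_poly -big_split /=.
rewrite (bigD1 (Ordinal (prime_gt0 pp))) //= big1 ?addr0 => [|m m0].
  by rewrite /a /= mul0r !expr0 !mulr1 rmorphN /=; ring.
have m1 : (0 < m < p)%N.
  by rewrite ltn_ord andbT lt0n; apply: contraNneq m0 => m0; apply/eqP/val_inj.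
rewrite exprNn -signr_odd /a; case: ifP => om; first by rewrite expr1; ring.
by rewrite c_even ?om // rmorphN /=; ring.
Qed.

Let A_rootN e (k : 'F_p) : e = 1 \/ e = -1 -> lg k != e ->
  (A e).[- eta ^+ k] = c 0 *+ 2.
Proof.
move=> e1 ke; rewrite A_opp A_root ?subr0 ?opprK //.
by case: e1 => ->; [right|left]; rewrite ?opprK.
Qed.

Local Notation s := ((lg (-1 : 'F_p))%:~R : F).

Let Arev e : {poly F} := \sum_(m < p) (a e m * s ^+ m) *: 'X^(p - m).

Let Arev_eval e x : x != 0 -> (Arev e).[x] = x ^+ p * (A e).[s / x].
Proof.
move=> x0; rewrite horner_sum horner_poly mulr_sumr; apply: eq_bigr => m _.
rewrite hornerZ hornerXn expfB // exprMn exprVn.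
by ring.
Qed.

(** Reversal sends eta^k to s eta^(-k) with s = lg(-1), and the symbol of -k is s lg k. In all four
    cases of s and of the sign of the point, the values 0 or 2 c(0) of [A e] cancel in [W], which
    thus has p + 1 roots and degree at most p. As [A e] has degree below p, the coefficient of X^p
    in [W] is [a e 0]. *)
Let a0_eq0 e : e = 1 \/ e = -1 -> a e 0 = 0.
Proof.
move=> e1; pose W := A e + Arev e - ((1 - s) * c 0)%:P.
have x0 (k : 'F_p) : eta ^+ k != 0.
  rewrite expf_neq0 //; apply/eqP => eta0; have := prim_expr_order etaP.
  by move/eqP; rewrite eta0 expr0n gtn_eqF ?prime_gt0 // eq_sym oner_eq0.
have xV (k : 'F_p) : (eta ^+ k)^-1 = eta ^+ (- k)%R.
  by apply: (mulfI (x0 k)); rewrite mulfV // -prim_expD_Fp // subrr expr0.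
have sE : lg (-1 : 'F_p) = 1 \/ lg (-1 : 'F_p) = -1.
  by apply: lg_cases; rewrite oppr_eq0 oner_eq0.
have lgN (k : 'F_p) : lg (- k) = lg (-1 : 'F_p) * lg k by rewrite -lgM // mulN1r.
have W0 : W = 0.
  apply: (poly_eq0_signed_roots e1).
  - apply: leq_trans (size_polyD _ _) _; rewrite size_polyN geq_max; apply/andP; split.
      apply: leq_trans (size_polyD _ _) _; rewrite geq_max; apply/andP; split.
        exact/leqW/size_poly.
      apply: (leq_trans (size_sum _ _ _)); apply/bigmax_leqP => m _.
      by apply: leq_trans (size_scale_leq _ _) _; rewrite size_polyXn ltnS leq_subr.
    by apply: leq_trans (size_polyC_leq1 _) _.
  - move=> k ke; rewrite !hornerE Arev_eval // prim_exp_Fp_prim mul1r A_root //.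
    case: sE (lgN k) => -> lgNk.
      by rewrite mulr1z div1r xV A_root ?lgNk ?mul1r // subrr mul0r !addr0 subrr.
    rewrite mulrN1z mulN1r xV A_rootN //; first by rewrite opprK; ring.
    by rewrite lgNk mulN1r; apply: contraNneq ke => <-; rewrite opprK.
  - move=> k ke; rewrite !hornerE Arev_eval ?oppr_eq0 // exprNn prim_exp_Fp_prim.
    rewrite -signr_odd op expr1 mulr1 A_rootN // invrN mulrN.
    case: sE (lgN k) => -> lgNk.
      by rewrite mulr1z mul1r xV A_rootN ?lgNk ?mul1r //; ring.
    rewrite mulrN1z !mulN1r opprK xV A_root //; first by ring.
    by rewrite lgNk mulN1r; apply: contraNneq ke => /oppr_inj/eqP.
have := congr1 (fun P : {poly F} => P`_p) W0.
rewrite coef0 coefB coefD coef_poly coefC coef_sum ltnn add0r gtn_eqF ?prime_gt0 // subr0.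
rewrite (bigD1 (Ordinal (prime_gt0 pp))) //= big1 ?addr0 => [|m m0].
  by rewrite coefZ coefXn subn0 eqxx expr0 !mulr1.
rewrite coefZ coefXn; case: eqP => [pm|]; last by rewrite mulr0.
case/negP: m0; apply/eqP/val_inj => /=; have := ltn_ord m; lia.
Qed.

Theorem cyclotomic_kernel j : (j < n.+1)%N -> g j = 0.
Proof.
have h1 : (1 : int) = 1 \/ (1 : int) = -1 by left.
have hN : (-1 : int) = 1 \/ (-1 : int) = -1 by right.
have c0 : c 0 = 0.
  have e1 := a0_eq0 h1; have e2 := a0_eq0 hN.
  (* Adding the cases e = 1 and e = -1 eliminates the term in [g 0]. *)
  have : c 0 *+ 2 = a 1 0 + a (-1) 0 by rewrite /a /= mul0r rmorphN /=; ring.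
  by rewrite e1 e2 addr0 => /eqP; rewrite -mulr_natr mulf_eq0 (negPf F2) orbF => /eqP.
(* Once c(0) = 0, the values at the points -eta^k are zero as well, so that [A 1] has p + 1
   roots. *)
have A0 : A 1 = 0.
  apply: (poly_eq0_signed_roots h1); first exact/leqW/size_poly.
    by move=> k ke; rewrite A_root.
  by move=> k ke; rewrite A_rootN // c0 mul0rn.
move=> jn; have jp : (j.*2 < p)%N by have := odd_halfS op; lia.
have := congr1 (fun P : {poly F} => P`_j.*2) A0.
rewrite coef0 coef_poly jp /a odd_double doubleK mul1r.
have -> : c (j.*2%:R * h2) = 0.
  have [->|j0] := posnP j; first by rewrite mul0r.
  by rewrite c_even ?odd_double // jp double_gt0 j0.
by rewrite sub0r => /eqP; rewrite oppr_eq0 mulf_eq0 (negPf gam_neq0) => /eqP.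
Qed.

End CyclotomicKernel.

(** By Fermat, p divides the order q^(p - 1) - 1 of the unit group of the field with q^(p - 1)
    elements; Cauchy's theorem gives an element of order p. *)
Lemma exists_prim_root (p q : nat) : prime p -> prime q -> p != q ->
  exists (F : finFieldType) (eta : F), q \in [pchar F] /\ p.-primitive_root eta.
Proof.
move=> pp pq npq; have p1 : (0 < p.-1)%N by rewrite -subn1 subn_gt0 prime_gt1.
have [F Fq cF] := pPrimePowerField pq p1.
have pU : (p %| #|[set: {unit F}]|)%N.
  rewrite card_finField_unit cF -subn1 -eqn_mod_dvd ?expn_gt0 ?prime_gt0 //.
  rewrite -(totient_prime pp); apply/eqP/Euler_exp_totient.
  by rewrite coprime_sym prime_coprime // dvdn_prime2.
have [x _ ox] := Cauchy pp pU.
exists F, (val x); split => //.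
have xp : val x ^+ p = 1 by rewrite -FinRing.val_unitX -ox expg_order.
have [m mP] := prim_order_exists (prime_gt0 pp) xp.
rewrite dvdn_divisors ?prime_gt0 // => mp.
have : (m == 1%N) || (m == p).
  by move: mp; rewrite -dvdn_divisors ?prime_gt0 //; case/primeP: pp => _; apply.
case/orP => /eqP mE; last by rewrite -mE.
have := prim_expr_order mP; rewrite mE expr1 => /(@val_inj _ _ _ x 1%g) x1.
by move: ox pp; rewrite x1 order1 => <-.
Qed.

Section DetUnit.
Variable p : nat.
Hypothesis (pp : prime p) (op : odd p).
Local Notation n := (p./2).

Lemma uphalf_odd_prime : (p.+1)./2 = n.+1.
Proof. by rewrite {1}(odd_halfS op) -doubleS doubleK. Qed.

Lemma MpE i j : Mp p i j =
  if (i : nat) == 0%N then 1 else lg ((i : nat)%:R - (j : nat)%:R : 'F_p).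
Proof. by rewrite !mxE legendreE // rmorphB. Qed.

Lemma lg_neq_diff i j : (i < n.+1)%N -> (j < n.+1)%N -> i != j ->
  (i%:R - j%:R != 0 :> 'F_p).
Proof.
move=> i1 j1 ij; rewrite subr_eq0; apply: contraNneq ij.
move=> /(congr1 (@nat_of_ord _)); rewrite !Fp_val_nat //; first by move->.
  by have := odd_halfS op; lia.
by have := odd_halfS op; lia.
Qed.

Lemma det_Mp_neq0 (F : fieldType) (eta : F) : p.-primitive_root eta ->
  \det (map_mx intr (Mp p) : 'M[F]_((p.+1)./2)) != 0.
Proof.
move=> etaP; rewrite -det_tr; apply/det0P => -[v v0 vM].
(* The kernel vector becomes a function on natural numbers, because the size [(p.+1)./2] is only
   provably equal to [n.+1]; outside the range it is 0. *)
pose g (j : nat) : F := oapp (v 0) 0 (insub j).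
have gE (j : 'I_((p.+1)./2)) : g j = v 0 j by rewrite /g valK.
have rowM (i : nat) : (i < n.+1)%N ->
    \sum_(j < n.+1) (if i == 0 then 1 else lg (i%:R - (j : nat)%:R : 'F_p))%:~R * g j = 0.
  rewrite -uphalf_odd_prime => ilt; have /rowP/(_ (Ordinal ilt)) := vM.
  rewrite !mxE => {2}<-; apply: eq_bigr => j _.
  by rewrite gE mulrC 2!mxE MpE.
have sg : \sum_(j < n.+1) g j = 0.
  by rewrite -[RHS](rowM 0%N) //; apply: eq_bigr => j _; rewrite mulr1z mul1r.
suff gz : forall j, (j < n.+1)%N -> g j = 0.
  case/eqP: v0; apply/rowP => j; rewrite mxE -gE gz //.
  by rewrite -uphalf_odd_prime.
have rowS i : (0 < i <= n)%N ->
    \sum_(j < n.+1) (lg (i%:R - (j : nat)%:R : 'F_p))%:~R * g j = 0.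
  by case: i => // i iN; rewrite -[RHS](rowM i.+1).
have [F2|F2] := eqVneq (2%:R : F) 0; last exact: (cyclotomic_kernel pp op etaP F2 sg rowS).
have N1 : (-1 : F) = 1.
  by apply/eqP; rewrite eq_sym -subr_eq0 opprK -mulr2n F2.
(* In characteristic 2 the symbols are 1 off the diagonal and 0 on it, so row i differs from the row
   of ones by the single term [g i]. *)
have gz1 i : (0 < i <= n)%N -> g i = 0.
  move=> iN; have iN1 : (i < n.+1)%N by case/andP: iN.
  have := rowS i iN; rewrite -[RHS]sg (bigD1 (Ordinal iN1)) //=.
  rewrite [RHS](bigD1 (Ordinal iN1)) //= subrr lg0 mul0r add0r => h.
  apply: (addIr (\sum_(j < n.+1 | j != Ordinal iN1) g j)); rewrite -h add0r.
  apply: eq_bigr => j ji.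
  have /lg_cases[->|->] : (i%:R - (j : nat)%:R : 'F_p) != 0.
  - by apply: lg_neq_diff => //; apply: contraNneq ji => ij; apply/eqP/val_inj; rewrite /= ij.
  - by rewrite mulr1z mul1r.
  - by rewrite mulrN1z N1 mul1r.
case=> [|j] jn; last exact: gz1.
have := sg; rewrite big_ord_recl big1 ?addr0 // => j _.
by rewrite gz1 //= /bump add1n ltn_ord.
Qed.

Lemma det_Mp_unit : ~~ (p %| \det (Mp p))%Z -> \det (Mp p) = 1 \/ \det (Mp p) = -1.
Proof.
move=> pD; suff : `|\det (Mp p)|%N = 1%N by lia.
have D0 : (0 < `|\det (Mp p)|)%N.
  by rewrite absz_gt0; apply: contraNneq pD => ->; rewrite dvdz0.
apply/eqP/negPn/negP => D1.
have D2 : (1 < `|\det (Mp p)|)%N by lia.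
pose q := pdiv `|\det (Mp p)|; have pq : prime q by apply: pdiv_prime.
have qD : (q %| \det (Mp p))%Z by rewrite dvdzE absz_nat pdiv_dvd.
have npq : p != q.
  by apply/eqP => pE; case/negP: pD; apply: dvdz_trans qD; rewrite -pE dvdzz.
have [F [eta [Fq etaP]]] := exists_prim_root pp pq npq.
have := det_Mp_neq0 etaP; rewrite det_map_mx.
by rewrite -(dvdz_pcharf Fq) qD.
Qed.

End DetUnit.

(** * The sign of the determinant *)

Lemma prod_lt_pairs (K : comNzRingType) n (f : nat -> nat -> K) :
  \prod_(i < n) \prod_(j < n | (i < j)%N) f i j = \prod_(j < n) \prod_(i < j) f i j.
Proof.
rewrite (exchange_big_dep xpredT) //=; apply: eq_bigr => j _.
by rewrite (big_ord_widen n (fun i => f i j) (ltnW (ltn_ord j))).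
Qed.

(** Each index belongs to n - 1 pairs. This is how the factors i^(n - 1) are spread over a
    Vandermonde product in the 1/i. *)
Lemma prod_lt_pairs_mul (K : comNzRingType) n (x : nat -> K) :
  \prod_(j < n) \prod_(i < j) (x i * x j) = \prod_(j < n) x j ^+ n.-1.
Proof.
elim: n => [|n IH]; first by rewrite !big_ord0.
rewrite big_ord_recr [RHS]big_ord_recr IH /= big_split /= mulrA -big_split /=.
rewrite prodr_const card_ord; congr (_ * _); case: n {IH} => [|n].
  by rewrite !big_ord0.
by apply: eq_bigr => j _; rewrite -exprSr.
Qed.

Lemma prod_subn_fact (K : comNzRingType) j : \prod_(i < j) (j%:R - i%:R : K) = (j`!)%:R.
Proof.
rewrite fact_prod natr_prod big_add1 /= big_mkord (reindex_inj rev_ord_inj) /=.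
by apply: eq_bigr => i _; rewrite -natrB ?leq_subr // subKn.
Qed.

Section DetPowerDifferences.
Variables (K : fieldType) (n : nat).
Hypothesis K0 : forall k, (0 < k <= n)%N -> k%:R != 0 :> K.

Lemma det_power_diff_ones :
  \det (\matrix_(i < n.+1, j < n.+1)
     (if (i : nat) == 0%N then 1 else ((i : nat)%:R - (j : nat)%:R) ^+ n) : 'M[K]_n.+1)
  = (-1) ^+ n * (n`!)%:R ^+ n.
Proof.
(* Rows i > 0 hold the binomial coefficients of (i - j)^n as a polynomial in j; row 0 selects the
   power j^0 and so produces the ones. *)
pose L : 'M[K]_n.+1 := \matrix_(i, k) (if (i : nat) == 0%N then ((k : nat) == 0%N)%:R
   else (-1) ^+ k * (i : nat)%:R ^+ (n - k) *+ 'C(n, k)).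
pose R := Vandermonde n.+1 (\row_(j < n.+1) ((j : nat)%:R : K)).
rewrite [X in \det X](_ : _ = L *m R); last first.
  apply/matrixP => i j; rewrite !mxE; case: eqP => i0.
    rewrite big_ord_recl !mxE i0 /= mul1r expr0 big1 ?addr0 // => k _.
    by rewrite !mxE i0 /= mul0r.
  rewrite exprBn; apply: eq_bigr => k _; rewrite !mxE; move/eqP/negPf: i0 => ->.
  by rewrite mulrnAl mulrAC.
rewrite det_mulmx /R det_Vandermonde.
have -> : \prod_(i < n.+1) \prod_(j < n.+1 | (i < j)%N)
   ((\row_(k < n.+1) ((k : nat)%:R : K)) 0 j - (\row_(k < n.+1) ((k : nat)%:R : K)) 0 i)
   = \prod_(j < n) ((j.+1)`!)%:R.
  under eq_bigr do under eq_bigr do rewrite !mxE.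
  rewrite (prod_lt_pairs n.+1 (fun i j => j%:R - i%:R)) big_ord_recl big_ord0 mul1r.
  by apply: eq_bigr => j _; rewrite prod_subn_fact.
have -> : \det L = \prod_(k < n) ((-1) *+ 'C(n, k.+1) * (k`!)%:R).
  rewrite (expand_det_row _ ord0) big_ord_recl big1 => [|k _]; last first.
    by rewrite mxE /= mul0r.
  rewrite mxE /= mul1r addr0 /cofactor expr0 mul1r.
  (* In the remaining block, with i and k from 1 to n, i^(n - k) = i^(n - 1) (1/i)^(k - 1): a
     transposed Vandermonde matrix in the 1/i between two diagonal matrices. *)
  pose N1 : 'rV[K]_n := \row_i (i.+1)%:R ^+ n.-1.
  pose N2 : 'rV[K]_n := \row_i (i.+1)%:R^-1.
  pose N3 : 'rV[K]_n := \row_(k < n) ((-1) ^+ k.+1 *+ 'C(n, k.+1)).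
  rewrite [X in \det X](_ : _ = diag_mx N1 *m (Vandermonde n N2)^T *m diag_mx N3); last first.
    apply/matrixP => i k; rewrite mul_mx_diag mul_diag_mx !mxE /=.
    rewrite /bump !add1n -mulrnAl mulrC; congr (_ * _).
    have i0 : (i.+1)%:R != 0 :> K by rewrite K0 //= ltn_ord.
    apply: (mulIf (expf_neq0 k i0)); rewrite -mulrA -exprMn mulVf // expr1n mulr1 -exprD.
    by congr (_ ^+ _); have := ltn_ord k; lia.
  rewrite !det_mulmx !det_diag det_tr det_Vandermonde.
  under eq_bigr do rewrite mxE.
  under [X in _ * X * _]eq_bigr do under eq_bigr do rewrite !mxE.
  under [X in _ * _ * X]eq_bigr do rewrite mxE.
  rewrite (prod_lt_pairs n (fun i j => (j.+1)%:R^-1 - (i.+1)%:R^-1)).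
  (* Spread over the pairs, the powers clear the denominators: i j (1/j - 1/i) = i - j. *)
  rewrite -(prod_lt_pairs_mul n (fun i => (i.+1)%:R)) -big_split -big_split /=.
  apply: eq_bigr => k _; rewrite -big_split /=.
  transitivity ((\prod_(i < k) - (k%:R - (i : nat)%:R)) * ((-1) ^+ k.+1 *+ 'C(n, k.+1)) : K).
    congr (_ * _); apply: eq_bigr => i _; rewrite opprB.
    have i0 : (i.+1)%:R != 0 :> K by rewrite K0 //=; have := ltn_ord i; have := ltn_ord k; lia.
    have k0 : (k.+1)%:R != 0 :> K by rewrite K0 //= ltn_ord.
    rewrite mulrBr mulfK // [X in _ - X]mulrAC mulfV // mul1r -natr1 -[(k.+1)%:R]natr1.
    by ring.
  have -> : \prod_(i < k) - (k%:R - (i : nat)%:R : K) = (-1) ^+ k * (k`!)%:R.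
    by rewrite prodrN card_ord prod_subn_fact.
  have -> : (-1 : K) ^+ k.+1 *+ 'C(n, k.+1) = - ((-1) ^+ k * 'C(n, k.+1)%:R).
    by rewrite exprS mulN1r mulNrn mulr_natr.
  have s2 : ((-1 : K) ^+ k) * (-1) ^+ k = 1 by rewrite -expr2 sqrr_sign.
  by rewrite mulrN mulrACA s2 mul1r mulNrn mulNr mulrC.
(* Reversing the product of the k! brings C(n, k + 1), (k + 1)! and (n - k - 1)! together, so that
   every factor is -n!. *)
rewrite big_split mulrAC [X in _ * X](reindex_inj rev_ord_inj) -!big_split /=.
rewrite (eq_bigr (fun=> -1 * (n`!)%:R)) => [|k _].
  by rewrite prodr_const card_ord exprMn.
rewrite mulNrn mulN1r !mulNr -!natrM; congr (- _%:R).
by rewrite -mulnA bin_fact.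
Qed.

End DetPowerDifferences.

Lemma det_Mp_Fp (p : nat) : prime p -> odd p ->
  (\det (Mp p))%:~R = (-1) ^+ p./2 * ((p./2)`!)%:R ^+ p./2 :> 'F_p.
Proof.
move=> pp op; rewrite -det_map_mx -det_power_diff_ones; last first.
  by move=> k kn; apply: Fp_half_eq0.
(* The size is generalised because [(p.+1)./2] and [(p./2).+1] are different as indices of the
   matrix type. *)
suff gen N : N = (p./2).+1 ->
  \det (\matrix_(i < N, j < N)
     (if (i : nat) == 0%N then 1 else ((i : nat)%:R - (j : nat)%:R) ^+ p./2) : 'M['F_p]_N)
  = \det (\matrix_(i < (p./2).+1, j < (p./2).+1)
     (if (i : nat) == 0%N then 1 else ((i : nat)%:R - (j : nat)%:R) ^+ p./2) : 'M['F_p]_((p./2).+1)).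
  rewrite -(gen ((p.+1)./2)) ?uphalf_odd_prime //; congr (\det _).
  apply/matrixP => i j; rewrite !mxE; case: eqP => // _; rewrite legendreE //.
  by rewrite -[LHS]/((lg _)%:~R) euler_crit // rmorphB.
by move=> ->.
Qed.

Section DetValue.
Variable p : nat.
Hypothesis (pp : prime p) (op : odd p).
Local Notation n := (p./2).

(** Wilson's theorem, the factors of (p - 1)! above n being -n, ..., -1 modulo p. *)
Lemma half_fact_sqr : ((n`!)%:R : 'F_p) ^+ 2 = (-1) ^+ n.+1.
Proof.
have pE := odd_halfS op.
have n1 : ((p.-1)`! = n`! * \prod_(i < n) (n.+1 + i))%N.
  rewrite !fact_prod (@big_cat_nat _ _ _ n.+1) //=; last by lia.
  congr (_ * _)%N; rewrite -{1}[n.+1]add0n big_addn big_mkord.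
  have -> : (p.-1.+1 - n.+1 = n)%N by lia.
  by apply: eq_bigr => i _; rewrite addnC.
have W : (((p.-1)`!)%:R : 'F_p) = -1.
  apply/eqP; rewrite -subr_eq0 opprK natr1 natr_Fp_eq0 //.
  by rewrite -Wilson ?prime_gt1.
move: W; rewrite n1 natrM natr_prod.
rewrite (reindex_inj rev_ord_inj) /= (eq_bigr (fun i : 'I_n => - (i.+1)%:R)).
  rewrite prodrN card_ord -natr_prod mulrC -mulrA => W.
  rewrite expr2 -{1}[n`!]/(n`!) {2}fact_prod big_add1 big_mkord mulrC.
  by rewrite -[LHS]mul1r -{1}(sqrr_sign _ n) expr2 -mulrA W exprS mulrC.
move=> i _; apply/eqP; rewrite -subr_eq0 opprK -natrD natr_Fp_eq0 //.
by rewrite (_ : _ + _ = p)%N //; have := ltn_ord i; lia.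
Qed.

Lemma sign_Fp_inj (x y : int) : x = 1 \/ x = -1 -> y = 1 \/ y = -1 ->
  x%:~R = y%:~R :> 'F_p -> x = y.
Proof.
have N1 := Fp_1N1 pp op; move=> [->|->] [->|->] // /eqP.
  by rewrite mulr1z mulrN1z (negPf N1).
by rewrite mulr1z mulrN1z eq_sym (negPf N1).
Qed.

Lemma half_fact_neq0 : (n`!)%:R != 0 :> 'F_p.
Proof.
by rewrite -sqrf_eq0 half_fact_sqr signr_eq0.
Qed.

Lemma det_Mp_sign : \det (Mp p) = 1 \/ \det (Mp p) = -1.
Proof.
apply: det_Mp_unit => //; rewrite -intr_Fp_eq0 // det_Mp_Fp //.
by rewrite mulf_neq0 ?expf_neq0 ?half_fact_neq0 // oppr_eq0 oner_eq0.
Qed.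

Lemma det_Mp_1mod4 : p = 1 %[mod 4] -> \det (Mp p) = (-1) ^+ ((p - 1) %/ 4).
Proof.
move=> p1; apply: (sign_Fp_inj det_Mp_sign).
  by rewrite -signr_odd; case: odd; [right|left].
have pE := odd_halfS op; have on : ~~ odd n by lia.
have -> : ((p - 1) %/ 4 = n./2)%N by lia.
(* Here n is even, (n!)^2 = -1, and n!^n is the power n/2 of it. *)
rewrite det_Mp_Fp // -signr_odd (negPf on) mul1r -{2}(even_halfK on) -mul2n exprM.
by rewrite half_fact_sqr -signr_odd /= on expr1 rmorphXn.
Qed.

Lemma det_Mp_3mod4 : p = 3 %[mod 4] ->
  \det (Mp p) = - \prod_(1 <= k < n.+1) lg (k%:R : 'F_p).
Proof.
move=> p3; have pE := odd_halfS op; have on : odd n by lia.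
have lgf : \prod_(1 <= k < n.+1) lg (k%:R : 'F_p) = lg ((n`!)%:R : 'F_p).
  rewrite fact_prod natr_prod; elim/big_ind2: _ => //; first by rewrite lg1.
  by move=> x1 x2 y1 y2 -> ->; rewrite lgM.
have f2 : ((n`!)%:R : 'F_p) ^+ 2 = 1 by rewrite half_fact_sqr -signr_odd /= on.
apply: (sign_Fp_inj det_Mp_sign).
  by rewrite lgf; have [->|->] := lg_cases half_fact_neq0; [right|left]; rewrite ?opprK.
(* Here n is odd, the residue is -(n!)^n, and Euler's criterion reads (n!)^n as the symbol of n!. *)
rewrite rmorphN /= lgf det_Mp_Fp // -signr_odd on expr1 mulN1r euler_crit //.
Qed.

End DetValue.

(** * Ideals of given norm *)

(* The norm of x + w, where w = (1 + sqrt(-p)) / 2 and p = 3 mod 4. *)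
Definition qnorm (p x : nat) : nat := (x ^ 2 + x + p.+1 %/ 4)%N.

Lemma fact_even_odd t :
  (t.*2.+1)`! = ((\prod_(k < t) k.+1.*2) * \prod_(i < t.+1) i.*2.+1)%N.
Proof.
elim: t => [|t IH]; first by rewrite big_ord0 big_ord_recl big_ord0.
rewrite doubleS 2!factS IH [in RHS]big_ord_recr [X in _ = (_ * X)%N]big_ord_recr /=.
by rewrite mulnA [RHS]mulnACA [RHS]mulnC; congr (_ * _)%N; rewrite mulnC.
Qed.

Section Reciprocity.
Variable p : nat.
Hypothesis (pp : prime p) (p3 : p = 3 %[mod 4]).
Local Notation n := (p./2).
Local Notation c0 := (p.+1 %/ 4)%N.

Lemma odd_3mod4 : odd p. Proof. by move: p3; clear; lia. Qed.
Let op := odd_3mod4.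

Lemma qnorm4 x : (4 * qnorm p x = (x.*2.+1) ^ 2 + p)%N.
Proof. by move: p3; clear; rewrite /qnorm; nia. Qed.

Lemma lgN_3mod4 (z : 'F_p) : lg (- z) = - lg z.
Proof.
rewrite -mulN1r lgM // lgN1 // -signr_odd.
have -> : odd n by have := odd_halfS op; lia.
by rewrite expr1 mulN1r.
Qed.

(** Gauss's lemma: with n = 2 t + 1, the factors of 2^n n! = 2 4 ... (2 n) that exceed n are t + 1
    in number, and they are the negatives modulo p of the odd numbers up to n. *)
Lemma lg2_3mod4 : lg (2%:R : 'F_p) = (-1) ^+ c0.
Proof.
have pE := odd_halfS op; pose t := n./2.
have nE : n = t.*2.+1 by rewrite /t; lia.
have c0E : c0 = t.+1 by lia.
apply: (sign_Fp_inj pp op).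
- by apply: lg_cases; rewrite natr_Fp_eq0 // gtnNdvd // odd_prime_gt2.
- by rewrite -signr_odd; case: odd; [right|left].
rewrite euler_crit // rmorphXn /= rmorphN1.
apply: (mulIf (half_fact_neq0 pp op)).
have -> : (2%:R : 'F_p) ^+ n * (n`!)%:R = \prod_(0 <= k < n) (k.+1.*2)%:R.
  rewrite fact_prod big_add1 !big_mkord natr_prod -{1}[n]card_ord -prodr_const -big_split.
  by apply: eq_bigr => k _ /=; rewrite -natrM mul2n.
have fE := fact_even_odd t; rewrite -nE in fE; rewrite c0E fE natrM.
have nE' : n = (t + t.+1)%N by lia.
rewrite nE' big_mkord big_split_ord /= !natr_prod mulrCA; congr (_ * _).
rewrite (reindex_inj rev_ord_inj) /= -[X in (-1) ^+ X]card_ord -prodrN.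
apply: eq_bigr => i _; apply/eqP; rewrite -subr_eq0 opprK -natrD natr_Fp_eq0 //.
by rewrite (_ : (_ + _)%N = p) //; have := ltn_ord i; lia.
Qed.

Lemma qnorm_root2 : (exists x, 2 %| qnorm p x)%N <-> lg (2%:R : 'F_p) = 1.
Proof.
rewrite lg2_3mod4 -signr_odd; case oc: (odd c0); split => //.
  by case=> x; rewrite dvdn2 /qnorm !oddD oc oddX /=; case: odd.
by exists 0%N; rewrite dvdn2 /qnorm !oddD oc.
Qed.

(** Reciprocity by a Gauss sum G in characteristic q: G^2 = -p, and Frobenius gives G^q = chi(q) G.
    Hence chi(q) = 1 exactly when G lies in the prime field, that is when -p is a square modulo q;
    and 4 N(x + w) = (2 x + 1)^2 + p. *)
Lemma qnorm_root_odd q : prime q -> odd q -> q != p ->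
  (exists x, q %| qnorm p x)%N <-> lg (q%:R : 'F_p) = 1.
Proof.
move=> pq oq qp; have pnq : p != q by rewrite eq_sym.
have [F [eta [Fq etaP]]] := exists_prim_root pp pq pnq.
pose G := gauss p eta.
have G0 : G != 0 by apply: gauss_neq0.
have G2 : G ^+ 2 = - p%:R.
  by rewrite gauss_sqr // lgN_3mod4 lg1 // mulrN1z mulN1r.
have F2 : 2%:R != 0 :> F.
  by rewrite -(dvdn_pcharf Fq) gtnNdvd // odd_prime_gt2.
have GqE : G ^+ q = (lg (q%:R : 'F_p))%:~R * G.
  rewrite -[G ^+ q]/(pFrobenius_aut Fq G) /G /gauss rmorph_sum /=.
  rewrite -gauss_twist //; apply: eq_bigr => k _.
  rewrite rmorphM rmorph_int -[X in _ * X = _]/((eta ^+ k) ^+ q) -exprM; congr (_ * _).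
  by rewrite -[in RHS](Fp_valK k) -natrM prim_exp_Fp // mulnC.
have fixnat (k : nat) : (k%:R : F) ^+ q = k%:R.
  by rewrite -(pFrobenius_autE Fq) rmorph_nat.
have qp0 : (q%:R : 'F_p) != 0.
  by rewrite natr_Fp_eq0 // dvdn_prime2.
split => [[x qx]|q1].
  have : G ^+ 2 == (x.*2.+1)%:R ^+ 2.
    rewrite G2 -subr_eq0 -opprD oppr_eq0 -natrX -natrD addnC -qnorm4.
    by rewrite -(dvdn_pcharf Fq) dvdn_mull.
  have GG : G ^+ q = G -> lg (q%:R : 'F_p) = 1.
    rewrite GqE; have [->|->] // := lg_cases qp0.
    rewrite mulrN1z mulN1r => /eqP; rewrite eq_sym -subr_eq0 opprK -mulr2n.
    by rewrite -mulr_natr mulf_eq0 (negPf G0) (negPf F2).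
  rewrite eqf_sqr => /orP[] /eqP GE; apply: GG; rewrite GE ?fixnat //.
  by rewrite exprNn -signr_odd oq fixnat expr1 mulN1r.
have Gfix : G ^+ q = G by rewrite GqE q1 mulr1z mul1r.
pose P : {poly F} := 'X^q - 'X.
have sP : size P = q.+1.
  by rewrite size_polyDl size_polyXn ?size_polyN ?size_polyX // ltnS prime_gt1.
have P0 : P != 0 by rewrite -size_poly_eq0 sP.
(* The prime field already exhausts the q roots of X^q - X, and G is such a root. *)
have [t tq GE] : exists2 t, (t < q)%N & G = t%:R.
  have [/mapP[t]|Gn] := boolP (G \in [seq (k%:R : F) | k <- iota 0 q]).
    by rewrite mem_iota => tq ->; exists t.
  have := @max_poly_roots _ P (G :: [seq (k%:R : F) | k <- iota 0 q]) P0.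
  rewrite sP /= size_map size_iota ltnn Gn /= => h; suff : false by [].
  apply: h.
    apply/andP; split; first by rewrite rootE !hornerE Gfix subrr.
    by apply/allP => x /mapP[k _ ->]; rewrite rootE !hornerE fixnat subrr.
  rewrite map_inj_in_uniq ?iota_uniq // => a b; rewrite !mem_iota /= !add0n => aq bq.
  wlog ab : a b aq bq / (a <= b)%N.
    by move=> h; case: (leqP a b) => [|/ltnW] ab e; [|symmetry]; apply: h.
  move/eqP; rewrite eq_sym -subr_eq0 -natrB // -(dvdn_pcharf Fq) => d.
  by have [|/dvdn_leq/(_ d)] := posnP (b - a)%N; move: aq bq ab; clear; lia.
have [x qx] : exists x, (q %| (x.*2.+1) ^ 2 + p)%N.
  have tE : (q %| t ^ 2 + p)%N.
    by rewrite (dvdn_pcharf Fq) natrD natrX -GE G2 addNr.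
  case ot : (odd t).
    by exists t./2; rewrite -{1}[t]odd_double_half ot in tE.
  (* Adding the odd number q to an even root t makes it odd, as the shape 2 x + 1 requires. *)
  exists (t + q)./2; have -> : (t + q)./2.*2.+1 = (t + q)%N by move: oq ot; clear; lia.
  have -> : ((t + q) ^ 2 + p = (t ^ 2 + p) + q * (2 * t + q))%N by clear; lia.
  by rewrite dvdn_add // dvdn_mulr.
exists x; rewrite -(@Gauss_dvdr _ 4) ?qnorm4 //.
by rewrite (_ : 4 = 2 ^ 2)%N // coprimeXr // coprime_sym prime_coprime // dvdn2 oq.
Qed.

Lemma qnorm_root q : prime q -> q != p ->
  (exists x, q %| qnorm p x)%N <-> lg (q%:R : 'F_p) = 1.
Proof.
move=> pq qp; case oq: (odd q); first exact: qnorm_root_odd.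
have q2 : q = 2%N by apply/eqP; case: (even_prime pq) oq => [->|->].
by rewrite q2; apply: qnorm_root2.
Qed.

End Reciprocity.

Lemma dvdz_small (N : nat) (z : int) : (N %| z)%Z -> (`|z| < N)%N -> z = 0.
Proof.
rewrite dvdzE absz_nat => Nz zN; apply/eqP; rewrite -absz_eq0.
by case: posnP => // z0; move: (dvdn_leq z0 Nz); rewrite leqNgt zN.
Qed.

Lemma dvdz_sub (d a b : int) : (d %| a)%Z -> (d %| b)%Z -> (d %| a - b)%Z.
Proof. exact: rpredB. Qed.

Lemma dvdz_add (d a b : int) : (d %| a)%Z -> (d %| b)%Z -> (d %| a + b)%Z.
Proof. exact: rpredD. Qed.

(** * Dirichlet convolution of multiplicative functions *)

Section Dirichlet.
Implicit Types (f g : nat -> int) (m n d e k : nat).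

Definition dirichlet f g m : int := \sum_(d <- divisors m) f d * g (m %/ d)%N.

Definition multiplicative_fun f := f 1%N = 1 /\
  forall m n, (0 < m)%N -> (0 < n)%N -> coprime m n -> f (m * n)%N = f m * f n.

Lemma divisors_coprime_mul m n : (0 < m)%N -> (0 < n)%N -> coprime m n ->
  perm_eq (divisors (m * n)) [seq (d * e)%N | d <- divisors m, e <- divisors n].
Proof.
move=> m0 n0 cmn; have mn0 : (0 < m * n)%N by rewrite muln_gt0 m0.
have gcdE d e : (d %| m)%N -> (e %| n)%N -> gcdn m (d * e) = d.
  move=> dm en; rewrite Gauss_gcdl; first exact/gcdn_idPr.
  by apply: coprime_dvdr cmn.
have gcdE' d e : (d %| m)%N -> (e %| n)%N -> gcdn n (d * e) = e.
  move=> dm en; rewrite Gauss_gcdr; first exact/gcdn_idPr.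
  by rewrite coprime_sym; apply: coprime_dvdl cmn.
apply: uniq_perm; first exact: divisors_uniq.
  apply: allpairs_uniq; try exact: divisors_uniq.
  move=> [d e] [d' e'] /allpairsP[[a b] /= [da eb [-> ->]]].
  move=> /allpairsP[[a' b'] /= [da' eb' [-> ->]]] /= E.
  rewrite -!dvdn_divisors // in da eb da' eb'.
  have aE : a = a' by rewrite -(gcdE a b da eb) E gcdE.
  have bE : b = b' by rewrite -(gcdE' a b da eb) E gcdE'.
  by rewrite aE bE.
move=> k; rewrite -dvdn_divisors //; apply/idP/allpairsP => [kmn|]; last first.
  by move=> [[d e] /= [dm en ->]]; rewrite -!dvdn_divisors // in dm en; apply: dvdn_mul.
exists (gcdn k m, gcdn k n); rewrite -!dvdn_divisors // !dvdn_gcdr; split=> //=.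
apply/eqP; rewrite eqn_dvd; apply/andP; split; last first.
  rewrite Gauss_dvd ?dvdn_gcdl //.
  exact: coprime_dvdl (dvdn_gcdr _ _) (coprime_dvdr (dvdn_gcdr _ _) cmn).
rewrite muln_gcdr dvdn_gcd dvdn_mull //= muln_gcdl dvdn_gcd kmn andbT.
by rewrite dvdn_mulr.
Qed.

Lemma dirichlet_mul f g : multiplicative_fun f -> multiplicative_fun g ->
  multiplicative_fun (dirichlet f g).
Proof.
move=> [f1 fM] [g1 gM]; split; first by rewrite /dirichlet big_seq1 f1 g1.
move=> m n m0 n0 cmn; rewrite /dirichlet (perm_big _ (divisors_coprime_mul m0 n0 cmn)).
rewrite big_allpairs_dep /= mulr_suml big_seq [RHS]big_seq; apply: eq_bigr => d.
rewrite -dvdn_divisors // => dm; rewrite mulr_sumr big_seq [RHS]big_seq.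
apply: eq_bigr => e; rewrite -dvdn_divisors // => en.
have [d0 e0] := (dvdn_gt0 m0 dm, dvdn_gt0 n0 en).
have cde : coprime d e := coprime_dvdl dm (coprime_dvdr en cmn).
have cde' : coprime (m %/ d) (n %/ e).
  by apply: (@coprime_dvdl _ m); [|apply: (@coprime_dvdr _ n)]; rewrite ?dvdn_div.
have -> : ((m * n) %/ (d * e) = (m %/ d) * (n %/ e))%N by rewrite divnMA -divn_mulAC // -muln_divA.
have md0 : (0 < m %/ d)%N by rewrite divn_gt0 // dvdn_leq.
have ne0 : (0 < n %/ e)%N by rewrite divn_gt0 // dvdn_leq.
rewrite (fM _ _ d0 e0 cde) (gM _ _ md0 ne0 cde').
by rewrite mulrACA.
Qed.

Lemma dirichlet_pfactor f g q j : prime q ->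
  dirichlet f g (q ^ j) = \sum_(i < j.+1) f (q ^ i)%N * g (q ^ (j - i))%N.
Proof.
move=> pq; have q0 := prime_gt0 pq; rewrite /dirichlet.
rewrite (perm_big [seq (q ^ i)%N | i <- iota 0 j.+1]).
  rewrite big_map -[iota _ _]/(index_iota 0 j.+1) big_mkord; apply: eq_bigr => i _.
  by rewrite expnB // -ltnS.
apply: uniq_perm; first exact: divisors_uniq.
  by rewrite map_inj_uniq ?iota_uniq // => a b /eqP; rewrite eqn_exp2l ?prime_gt1 // => /eqP.
move=> k; rewrite -dvdn_divisors ?expn_gt0 ?q0 //.
apply/(dvdn_pfactor _ _ pq)/mapP => [[i ij ->]|[i ij ->]].
  by exists i; rewrite ?mem_iota.
by exists i => //; rewrite mem_iota in ij.
Qed.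

Lemma eq_multiplicative f g : multiplicative_fun f -> multiplicative_fun g ->
  (forall q j, prime q -> f (q ^ j)%N = g (q ^ j)%N) ->
  forall m, (0 < m)%N -> f m = g m.
Proof.
move=> [f1 fM] [g1 gM] fg m; have [k] := ubnP m; elim: k m => // k IH m mk m0.
have [->|m1] := eqVneq m 1%N; first by rewrite f1 g1.
have pq : prime (pdiv m) by apply: pdiv_prime; lia.
have [m' cm' mE] := pfactor_coprime pq m0.
have lg1 : (0 < logn (pdiv m) m)%N by rewrite logn_gt0 mem_primes pq m0 pdiv_dvd.
have m'0 : (0 < m')%N by move: m0; rewrite mE muln_gt0 => /andP[].
have qe : (1 < pdiv m ^ logn (pdiv m) m)%N.
  by rewrite -{1}(expn0 (pdiv m)) ltn_exp2l // prime_gt1.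
have m'm : (m' < m)%N by rewrite [X in (_ < X)%N]mE -[X in (X < _)%N]muln1 ltn_pmul2l.
have cq : coprime m' (pdiv m ^ logn (pdiv m) m) by rewrite coprimeXr // coprime_sym.
rewrite mE (fM _ _ m'0 (ltnW qe) cq) (gM _ _ m'0 (ltnW qe) cq) fg // IH //.
exact: leq_trans m'm (ltnSE mk).
Qed.

End Dirichlet.

(** * Roots of the norm polynomial modulo a, that is primitive ideals of norm a *)

Definition qroots p a : nat := #|[set x : 'I_a | (a %| qnorm p x)%N]|.

Section IdealCount.
Variable p : nat.
Hypothesis (pp : prime p) (p3 : p = 3 %[mod 4]).
Let op := odd_3mod4 p3.
Local Notation f := (qnorm p).

Lemma qnorm_mod a x : (f (x %% a) = f x %[mod a])%N.
Proof.
rewrite /qnorm -modnDml -(modnDm (_ ^ 2)) modnXm modn_mod modnDm.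
by rewrite modnDml.
Qed.

Lemma dvdn_qnorm_mod a x : (a %| f (x %% a))%N = (a %| f x)%N.
Proof. by rewrite /dvdn qnorm_mod. Qed.

Lemma qroots_coprime a b : (0 < a)%N -> (0 < b)%N -> coprime a b ->
  qroots p (a * b) = (qroots p a * qroots p b)%N.
Proof.
move=> a0 b0 cab; rewrite /qroots -cardsX.
have ab0 : (0 < a * b)%N by rewrite muln_gt0 a0.
pose h (x : 'I_(a * b)) := (Ordinal (ltn_pmod x a0), Ordinal (ltn_pmod x b0)).
have hI : injective h.
  move=> x y [/eqP xa /eqP xb]; apply: val_inj => /=.
  have : (x == y %[mod a * b])%N by rewrite chinese_remainder // xa.
  by rewrite !modn_small // => /eqP.
rewrite -(card_imset _ hI); congr #|pred_of_set _|; apply/setP => -[y z].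
rewrite !inE /=; apply/imsetP/andP => [[x]|[ya zb]].
  rewrite inE => xab [-> ->] /=; rewrite !dvdn_qnorm_mod.
  by apply/andP; rewrite -Gauss_dvd.
pose w := chinese a b y z.
have wa : (w %% a)%N = y by rewrite chinese_modl // modn_small.
have wb : (w %% b)%N = z by rewrite chinese_modr // modn_small.
exists (Ordinal (ltn_pmod w ab0)); rewrite ?inE /=.
  by rewrite dvdn_qnorm_mod Gauss_dvd // -dvdn_qnorm_mod wa ya -dvdn_qnorm_mod wb.
congr pair; apply: val_inj => /=.
  by rewrite modn_dvdm ?dvdn_mulr.
by rewrite modn_dvdm ?dvdn_mull.
Qed.

Lemma qroots1 : qroots p 1 = 1%N.
Proof.
rewrite /qroots (_ : [set _ | _] = [set: 'I_1]%SET) ?cardsT ?card_ord //.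
by apply/setP => x; rewrite !inE dvd1n.
Qed.

Lemma prime_dvd_qdisc q x : prime q -> (q %| f x)%N -> (q %| x.*2.+1)%N -> q = p.
Proof.
move=> pq qf qx; apply/eqP; rewrite -dvdn_prime2 //.
have : (q %| (x.*2.+1) ^ 2 + p)%N by rewrite -qnorm4 // dvdn_mull.
by rewrite dvdn_addr // dvdn_mulr.
Qed.

(** As 4 N(x + w) = (2 x + 1)^2 + p, the condition is p | 2 x + 1, and the only solution below p is
    (p - 1)/2. *)
Lemma qroots_p : qroots p p = 1%N.
Proof.
have pE := odd_halfS op; have np : (p./2 < p)%N by lia.
have cp4 : coprime p 4 by rewrite (_ : 4 = 2 ^ 2)%N // coprimeXr // prime_coprime // gtnNdvd // odd_prime_gt2.
rewrite -(cards1 (Ordinal np)); congr #|pred_of_set _|; apply/setP => x; rewrite !inE.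
rewrite -(Gauss_dvdr _ cp4) qnorm4 // dvdn_addl // Euclid_dvdX // andbT.
apply/idP/eqP => [px|->]; last by rewrite /= -pE.
apply: val_inj => /=; have := ltn_ord x; case/dvdnP: px => k; case: k => [|[|k]]; nia.
Qed.

(** If p^2 divided (2 x + 1)^2 + p, then p would divide 2 x + 1 and p^2 would divide p. *)
Lemma qroots_pX k : qroots p (p ^ k.+2) = 0%N.
Proof.
apply/eqP; rewrite cards_eq0; apply/eqP/setP => x; rewrite !inE.
apply/negP => pf.
have pp2 : (p ^ 2 %| f x)%N by apply: dvdn_trans pf; apply: dvdn_exp2l.
have cp4 : coprime p 4 by rewrite (_ : 4 = 2 ^ 2)%N // coprimeXr // prime_coprime // gtnNdvd // odd_prime_gt2.
have p1 : (p ^ 2 %| (x.*2.+1) ^ 2 + p)%N by rewrite -qnorm4 // dvdn_mull.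
have px : (p %| x.*2.+1)%N.
  have : (p %| (x.*2.+1) ^ 2 + p)%N by apply: dvdn_trans p1; apply: dvdn_exp.
  by rewrite dvdn_addl // Euclid_dvdX // andbT.
have : (p ^ 2 %| p)%N by rewrite -(dvdn_addr _ (dvdn_exp2r 2 px)).
by move/dvdn_leq => /(_ (prime_gt0 pp)); rewrite -{2}(expn1 p) leq_exp2l // prime_gt1.
Qed.

(** Hensel's lemma: the derivative 2 x + 1 is a unit modulo q, since q | 2 x + 1 would give q =
    p. *)
Lemma qnorm_lift q k x : prime q -> q != p -> (q ^ k.+1 %| f x)%N ->
  exists y, (q ^ k.+2 %| f y)%N.
Proof.
move=> pq qp qf; have [u fE] := dvdnP qf.
have cx : ~~ (q %| x.*2.+1)%N.
  apply: contra qp => qx; apply/eqP; apply: prime_dvd_qdisc qx => //.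
  by apply: dvdn_trans qf; apply: dvdn_exp.
have [t tE] : exists t, (q %| u + t * x.*2.+1)%N.
  (* The Newton correction, taken in ['F_q] and read back as a natural number. *)
  exists (- (u%:R / (x.*2.+1)%:R) : 'F_q).
  rewrite -natr_Fp_eq0 // natrD natrM Fp_valK mulNr divfK ?subrr //.
  by rewrite natr_Fp_eq0.
exists (x + q ^ k.+1 * t)%N.
have -> : f (x + q ^ k.+1 * t) = (q ^ k.+1 * (u + t * x.*2.+1) + q ^ k.+1 * q ^ k.+1 * t ^ 2)%N.
  by move: fE; rewrite /qnorm; move: (q ^ k.+1)%N (p.+1 %/ 4)%N => N c; clear; nia.
rewrite dvdn_add //; first by rewrite expnSr dvdn_pmul2l // expn_gt0 prime_gt0.
by rewrite dvdn_mulr // -expnD dvdn_exp2l // addSn addnS ltnS ltnS leq_addr.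
Qed.

(** From f(y) - f(x) = (y - x)(y + x + 1), where q cannot divide both factors because they differ by
    2 x + 1: the only roots are x and N - 1 - x, which is [rev_ord x]. *)
Lemma qroots_prime_pow q k : prime q -> q != p ->
  qroots p (q ^ k.+1) = if lg (q%:R : 'F_p) == 1 then 2%N else 0%N.
Proof.
move=> pq qp; set N := (q ^ k.+1)%N.
have N0 : (0 < N)%N by rewrite expn_gt0 prime_gt0.
have qN : (q %| N)%N by apply: dvdn_exp.
case: ifP => [/eqP q1|q1]; last first.
  apply/eqP; rewrite cards_eq0; apply/eqP/setP => x; rewrite !inE; apply/negP => Nf.
  case/eqP: q1; apply/qnorm_root => //; exists x; exact: dvdn_trans Nf.
have [y0 y0N] : exists y, (N %| f y)%N.
  rewrite /N; elim: (k) => [|k' [y yE]]; last exact: qnorm_lift yE.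
  by rewrite expn1; apply/qnorm_root.
pose x := Ordinal (ltn_pmod y0 N0).
have xN : (N %| f x)%N by rewrite dvdn_qnorm_mod.
have qx : ~~ (q %| x.*2.+1)%N.
  by apply: contra qp => qx; apply/eqP; apply: prime_dvd_qdisc qx => //; apply: dvdn_trans xN.
have rE : (rev_ord x : nat) = (N - x.+1)%N by [].
rewrite /qroots (_ : [set _ | _] = [set x; rev_ord x]).
  rewrite cards2; case: eqP => //= xr; case/negP: qx; apply: dvdn_trans qN _.
  by rewrite (_ : _.*2.+1 = N) //; have := ltn_ord x; have := congr1 (@nat_of_ord _) xr; rewrite /= -/N; clear; lia.
apply/setP => y; rewrite !inE -!(inj_eq val_inj) /=.
have fD (a b : nat) : ((f a)%:Z - (f b)%:Z = (a%:Z - b%:Z) * (a%:Z + b%:Z + 1))%R.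
  by rewrite /qnorm -!mulnn !PoszD !PoszM; ring.
have NfE (a : nat) : (N %| f a)%N = (N %| (a%:Z - (x : nat)%:Z) * (a%:Z + (x : nat)%:Z + 1))%Z.
  rewrite -fD; apply/idP/idP => [h|h].
    exact: (@dvdz_sub N (f a) (f x)).
  by have := @dvdz_add _ _ (f x) h xN; rewrite subrK.
rewrite NfE; apply/idP/orP => [Nf|].
  have [qy|qy] := boolP (q %| (y : nat)%:Z - (x : nat)%:Z)%Z.
    have cN : coprimez N ((y : nat)%:Z + (x : nat)%:Z + 1).
      rewrite coprimezE absz_nat coprimeXl // prime_coprime //.
      apply: contra qx => h; suff : (q %| ((x : nat).*2.+1)%:Z)%Z by [].
      have -> : ((x : nat).*2.+1)%:Z = ((y : nat)%:Z + (x : nat)%:Z + 1) - ((y : nat)%:Z - (x : nat)%:Z).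
        by clear; lia.
      exact: dvdz_sub.
    left; move: Nf; rewrite Gauss_dvdzl // => /dvdz_small h; apply/eqP.
    by move: h (ltn_ord y) (ltn_ord x); rewrite /= -/N; clear; lia.
  have cN : coprimez N ((y : nat)%:Z - (x : nat)%:Z).
    by rewrite coprimezE absz_nat coprimeXl // prime_coprime.
  right; move: Nf; rewrite Gauss_dvdzr // => /dvdz_sub/(_ (dvdzz N))/dvdz_small h.
  by apply/eqP; move: h (ltn_ord y) (ltn_ord x); rewrite /= -/N; clear; lia.
case=> /eqP ->; first by rewrite subrr mul0r dvdz0.
rewrite (_ : _ + _ + 1 = N%:Z) ?dvdz_mull //; move: (ltn_ord x); rewrite /= -/N; clear; lia.
Qed.

End IdealCount.

Section IdealCountSum.
Variable p : nat.
Hypothesis (pp : prime p) (p3 : p = 3 %[mod 4]).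
Let op := odd_3mod4 p3.

Definition is_square (d : nat) : bool := [exists g : 'I_d.+1, (g ^ 2 == d)%N].

Lemma is_squareP d : reflect (exists g, d = (g ^ 2)%N) (is_square d).
Proof.
apply: (iffP existsP) => [[g /eqP <-]|[g ->]]; first by exists (g : nat).
have gd : (g < (g ^ 2).+1)%N by rewrite ltnS -mulnn; case: g => // g; rewrite leq_pmulr.
by exists (Ordinal gd).
Qed.

(** Take d = gcd(m, g), m = m' d and g = g' d. Then m' n = d g'^2, and the coprimality of m' with g'
    and of d with n gives m' | d and d | m'. *)
Lemma coprime_mul_sqr m n g : (0 < m)%N -> coprime m n -> (m * n = g ^ 2)%N ->
  exists d, m = (d ^ 2)%N.
Proof.
move=> m0 cmn mng; pose d := gcdn m g.
have d0 : (0 < d)%N by rewrite gcdn_gt0 m0.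
have [/dvdnP[m' mE] /dvdnP[g' gE]] := (dvdn_gcdl m g, dvdn_gcdr m g).
rewrite -/d in mE gE.
have cmg : coprime m' g'.
  by rewrite /coprime -(eqn_pmul2r d0) muln_gcdl -mE -gE mul1n.
have E : (m' * n = d * g' ^ 2)%N.
  by apply/eqP; rewrite -(eqn_pmul2l d0); apply/eqP; nia.
exists d; rewrite {1}mE -mulnn; congr (_ * d)%N; apply/eqP; rewrite eqn_dvd.
apply/andP; split.
  have : (m' %| d * g' ^ 2)%N by rewrite -E dvdn_mulr.
  by rewrite Gauss_dvdl // coprimeXr.
have : (d %| m' * n)%N by rewrite E dvdn_mulr.
by rewrite Gauss_dvdl //; apply: coprime_dvdl cmn; rewrite mE dvdn_mull.
Qed.

Lemma is_square_mul m n : (0 < m)%N -> (0 < n)%N -> coprime m n ->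
  is_square (m * n) = is_square m && is_square n.
Proof.
move=> m0 n0 cmn; apply/is_squareP/andP => [[g mng]|[/is_squareP[a ->] /is_squareP[b ->]]].
  split; apply/is_squareP; first exact: coprime_mul_sqr mng.
  by apply: (@coprime_mul_sqr _ m g); rewrite // 1?coprime_sym // mulnC.
by exists (a * b)%N; rewrite expnMn.
Qed.

Lemma is_square_prime_pow q i : prime q -> is_square (q ^ i) = ~~ odd i.
Proof.
move=> pq; apply/is_squareP/idP => [[g /(congr1 (logn q))]|oi].
  by rewrite pfactorK // lognX => ->; rewrite mul2n odd_double.
by exists (q ^ i./2)%N; rewrite -expnM muln2 even_halfK.
Qed.

Definition chi (d : nat) : int := lg (d%:R : 'F_p).

(* The number of ideals g(Za + Z(x + w)) of norm g^2 a = m. *)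
Definition ideal_count (m : nat) : nat :=
  \sum_(1 <= g < m.+1 | (g ^ 2 %| m)%N) qroots p (m %/ g ^ 2).

Lemma ideal_count_dirichlet m : (0 < m)%N ->
  (ideal_count m)%:Z = dirichlet (fun d => (is_square d)%:Z) (fun a => (qroots p a)%:Z) m.
Proof.
move=> m0; rewrite /ideal_count /dirichlet -[LHS]/(Posz _) (big_morph Posz PoszD (erefl _)).
transitivity (\sum_(1 <= g < m.+1) \sum_(d <- divisors m | d == (g ^ 2)%N) (qroots p (m %/ d))%:Z).
  rewrite big_mkcond; apply: eq_bigr => g _; case: ifP => gm.
    rewrite (big_rem (g ^ 2)%N) /= -?dvdn_divisors // eqxx big1_seq ?addr0 // => d.
    by rewrite mem_rem_uniq ?divisors_uniq // inE => /andP[/eqP ->] /andP[/eqP].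
  rewrite big1_seq // => d /andP[/eqP ->]; rewrite -dvdn_divisors //.
  by rewrite gm.
rewrite (exchange_big_dep xpredT) //= big_seq [RHS]big_seq; apply: eq_bigr => d.
rewrite -dvdn_divisors // => dm; have d0 := dvdn_gt0 m0 dm.
case: is_squareP => [[g dE]|nsq]; last first.
  by rewrite mul0r big1 // => g /eqP dE; case: nsq; exists g.
rewrite mul1r (big_rem g) /=; last first.
  rewrite mem_index_iota; apply/andP; split; first by move: d0; rewrite dE sqrn_gt0.
  by rewrite ltnS (leq_trans _ (dvdn_leq m0 dm)) // dE -mulnn leq_pmulr //; move: d0; rewrite dE sqrn_gt0.
rewrite dE eqxx big1_seq ?addr0 // => k /andP[/eqP].
move/eqP; rewrite eqn_exp2r // => /eqP ->.
by rewrite mem_rem_uniq ?iota_uniq // inE eqxx.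
Qed.

Lemma chi_pow q i : chi (q ^ i) = chi q ^+ i.
Proof.
rewrite /chi natrX; elim: i => [|i IH]; first by rewrite !expr0 lg1.
by rewrite !exprS lgM // IH.
Qed.

(** A single formula for the ramified, split and inert cases; in the ramified one chi q = 0 and the
    value at k = 0 relies on 0^0 = 1. *)
Lemma qroots_pow_chi q k : prime q -> (qroots p (q ^ k.+1))%:Z = chi q ^+ k * (1 + chi q).
Proof.
move=> pq; have [->|qp] := eqVneq q p.
  have -> : chi p = 0 by apply/eqP; rewrite /chi lg_eq0 natr_Fp_eq0 // dvdnn.
  case: k => [|k]; first by rewrite expr0 expn1 qroots_p.
  by rewrite qroots_pX // exprS !mul0r.
have q0 : (q%:R : 'F_p) != 0 by rewrite natr_Fp_eq0 // dvdn_prime2 // eq_sym.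
rewrite qroots_prime_pow // /chi; have [->|->] := lg_cases q0.
  by rewrite eqxx expr1n.
by rewrite subrr mulr0.
Qed.

(** This is zeta_K = zeta L(chi) coefficient by coefficient; both sides are multiplicative, so prime
    powers suffice. *)
Theorem ideal_countE m : (0 < m)%N ->
  (ideal_count m)%:Z = \sum_(d <- divisors m) chi d.
Proof.
move=> m0; rewrite ideal_count_dirichlet //.
transitivity (dirichlet chi (fun=> 1) m); last first.
  by rewrite /dirichlet; under eq_bigr do rewrite mulr1.
apply: eq_multiplicative m0.
- apply: dirichlet_mul; split.
  + by rewrite -(expn0 p) is_square_prime_pow.
  + by move=> a b a0 b0 cab; rewrite is_square_mul //; case: is_square; case: is_square.
  + by rewrite qroots1.
  + by move=> a b a0 b0 cab; rewrite qroots_coprime // PoszM.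
- apply: dirichlet_mul; split => //; first by rewrite /chi lg1.
  by move=> a b _ _ _; rewrite /chi natrM lgM.
move=> q j pq; rewrite !dirichlet_pfactor //.
under eq_bigr do rewrite is_square_prime_pow //.
under [RHS]eq_bigr do rewrite mulr1 chi_pow.
(* The induction moves by two: the sum for q^(j + 2) is that for q^j plus its term i = 0, which is
   chi^(j + 1) + chi^(j + 2). *)
suff : (\sum_(i < j.+1) (~~ odd i)%:Z * (qroots p (q ^ (j - i)))%:Z
        = \sum_(i < j.+1) chi q ^+ i) /\
       (\sum_(i < j.+2) (~~ odd i)%:Z * (qroots p (q ^ (j.+1 - i)))%:Z
        = \sum_(i < j.+2) chi q ^+ i) by case.
elim: j => [|j [IH1 IH2]].
  rewrite !big_ord_recl !big_ord0 /= !expr0 !subn0 expn0 qroots1 expr1 qroots_pow_chi //.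
  by split; ring.
split => //; rewrite [RHS]big_ord_recr [X in _ = X + _]big_ord_recr /=.
rewrite big_ord_recl big_ord_recl /= subn0 mul1r qroots_pow_chi // mul0r add0r.
rewrite (eq_bigr (fun i : 'I_j.+1 => (~~ odd i)%:Z * (qroots p (q ^ (j - i)))%:Z)).
  by rewrite IH1 !exprS; ring.
by move=> i _; rewrite /bump /= !add1n /= negbK !subSS.
Qed.

End IdealCountSum.

(** * Ideal classes as lattices *)

Lemma int_subgroup (S : int -> Prop) :
  (forall x y, S x -> S y -> S (x - y)) -> (exists2 x, S x & x != 0) ->
  exists2 d : nat, (0 < d)%N & forall z, S z <-> (d %| z)%Z.
Proof.
move=> SB [x Sx x0].
have S0 : S 0 by rewrite -(subrr x); apply: SB.
have SN y : S y -> S (- y) by rewrite -sub0r => Sy; apply: SB.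
have ex : exists d : nat, (0 < d)%N && `[< S d%:Z >].
  exists `|x|%N; rewrite absz_gt0 x0 /=; apply/asboolP.
  by case: (intP x) Sx => [|k|k] // /SN; rewrite opprK.
case: (ex_minnP ex) => d /andP[d0 /asboolP Sd] dmin.
have SM (k : nat) : S (k%:Z * d%:Z).
  elim: k => [|k IH]; first by rewrite mul0r.
  have -> : (k.+1)%:Z * d%:Z = k%:Z * d%:Z - - d%:Z by lia.
  by apply: SB => //; apply: SN.
have SZ (k : int) : S (k * d%:Z).
  case: (intP k) => [|i|i]; [exact: (SM 0%N)|exact: SM|].
  by rewrite mulNr; apply/SN/SM.
exists d => // z; split => [Sz|/dvdzP[k ->] //].
apply/dvdz_mod0P; have d0' : d%:Z != 0 by lia.
have Sr : S (z %% d)%Z.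
  have -> : (z %% d)%Z = z - (z %/ d)%Z * d.
    by apply/eqP; rewrite eq_sym subr_eq addrC -divz_eq.
  exact: SB.
have rE : (z %% d)%Z = `|(z %% d)%Z|%N by rewrite gez0_abs // modz_ge0.
case: (posnP `|(z %% d)%Z|%N) => [r0|r0]; first by rewrite rE r0.
have := dmin `|(z %% d)%Z|%N; rewrite r0 -rE /=.
have -> : `[< S (z %% d)%Z >] by apply/asboolP.
move=> /(_ isT); have : ((z %% d)%Z < d)%R by rewrite ltz_pmod; lia.
by rewrite {1}rE; lia.
Qed.

Section QuadraticLattice.
Variable p : nat.
Local Notation c0 := (p.+1 %/ 4)%N.

Definition nform (u v : int) : int := u ^+ 2 + u * v + c0%:Z * v ^+ 2.

Lemma nformE (x : nat) : nform x 1 = (qnorm p x)%:Z.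
Proof. by rewrite /nform /qnorm -mulnn !PoszD PoszM; ring. Qed.

Hypothesis c0_gt0 : (0 < c0)%N.

Lemma nform_ge u v : u ^+ 2 + u * v + v ^+ 2 <= nform u v.
Proof.
rewrite /nform -subr_ge0; set a := u ^+ 2 + u * v.
rewrite (_ : _ - _ = (c0%:Z - 1) * v ^+ 2); last by ring.
by apply: mulr_ge0; [move: c0_gt0; clear; lia|exact: sqr_ge0].
Qed.

Lemma nform_gt0 u v : (u != 0) || (v != 0) -> 0 < nform u v.
Proof.
move=> uv; apply: lt_le_trans (nform_ge u v).
have E : 2 * (u ^+ 2 + u * v + v ^+ 2) = u ^+ 2 + v ^+ 2 + (u + v) ^+ 2 by ring.
have h1 := sqr_ge0 u; have h2 := sqr_ge0 v; have h3 := sqr_ge0 (u + v).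
have h4 : 0 < u ^+ 2 + v ^+ 2.
  case/orP: uv => h; [apply: ltr_wpDr|apply: ltr_pwDr] => //;
  by rewrite lt_neqAle eq_sym sqrf_eq0 h sqr_ge0.
lra.
Qed.

(** P is a nonzero ideal in the coordinates of u + v w, the second hypothesis being multiplication
    by w. Let g generate the second coordinates and A the elements with v = 0. Multiplication by w
    moves first coordinates into second ones, so g divides A = a g and the first coordinate over g;
    and a | N(x + w) because g N(x + w) is g (x + w) times the conjugate of x + w. *)
Lemma hermite_form (P : int -> int -> Prop) :
  (forall u v u' v', P u v -> P u' v' -> P (u - u') (v - v')) ->
  (forall u v, P u v -> P (- (c0%:Z * v)) (u + v)) ->
  (exists u v, P u v /\ (u != 0) || (v != 0)) ->
  exists g a x : nat, [/\ (0 < g)%N, (x < a)%N, (a %| qnorm p x)%N &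
    forall u v, P u v <-> exists i j : int,
      u = g%:Z * (i * a%:Z + j * x%:Z) /\ v = g%:Z * j].
Proof.
move=> PB Pw [u1 [v1 [Puv1 uv1]]].
have PN u v : P u v -> P (- u) (- v).
  move=> Puv; have := PB _ _ _ _ Puv Puv; rewrite !subrr => P0.
  by have := PB _ _ _ _ P0 Puv; rewrite !sub0r.
have PD u v u' v' : P u v -> P u' v' -> P (u + u') (v + v').
  by move=> Puv /PN Puv'; rewrite -(opprK u') -(opprK v'); apply: PB.
have PZ (k : int) u v : P u v -> P (k * u) (k * v).
  move=> Puv; have [|//|d d0 dP] := @int_subgroup (fun k => P (k * u) (k * v)).
  - by move=> a b Pa Pb; rewrite !mulrBl; apply: PB.
  - by exists 1; rewrite ?mul1r.
  apply/dP; apply: dvdz_trans (dvd1z k); rewrite -dP !mul1r //.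
(* Closure under multiplication by i + j w. *)
have PM u v i j : P u v -> P (u * i - c0%:Z * v * j) (v * i + u * j + v * j).
  move=> Puv; have := PD _ _ _ _ (PZ i _ _ Puv) (PZ j _ _ (Pw _ _ Puv)).
  by congr P; ring.
have [g g0 gP] : exists2 g : nat, (0 < g)%N & forall v, (exists u, P u v) <-> (g %| v)%Z.
  apply: (@int_subgroup (fun v => exists u, P u v)).
    by move=> v v' [u Pu] [u' Pu']; exists (u - u'); apply: PB.
  have [v0|v0] := eqVneq v1 0; last by exists v1 => //; exists u1.
  exists (u1 + v1); first by exists (- (c0%:Z * v1)); apply: Pw.
  by move: uv1; rewrite v0 addr0 eqxx orbF.
have [A A0 AP] : exists2 A : nat, (0 < A)%N & forall u, P u 0 <-> (A %| u)%Z.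
  apply: (@int_subgroup (fun u => P u 0)).
    by move=> u u' Pu Pu'; rewrite -(subrr 0); apply: PB.
  (* The norm, reached through multiplication by the conjugate (u1 + v1) - v1 w. *)
  exists (nform u1 v1); last by rewrite gt_eqF // nform_gt0.
  have := PM _ _ (u1 + v1) (- v1) Puv1; rewrite /nform.
  by congr P; ring.
have gA : (g %| A)%N.
  have PA : P A%:Z 0 by apply/AP; exact: dvdzz.
  have := Pw _ _ PA; rewrite addr0 => PA'.
  by apply: (iffLR (gP A)); exists (- (c0%:Z * 0)).
have [a AE] := dvdnP gA.
have [u0 Pu0] : exists u, P u g%:Z by apply/gP; exact: dvdzz.
have gu : (g %| u0)%Z.
  have : (g %| u0 + g)%Z by apply/gP; exists (- (c0%:Z * g%:Z)); apply: Pw.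
  by move=> h; have := dvdz_sub h (dvdzz g); rewrite addrK.
have [y u0E] := dvdzP gu.
have a0 : (0 < a)%N by move: A0; rewrite AE muln_gt0 => /andP[].
have a0' : a%:Z != 0 by lia.
have xE : (y %% a)%Z = `|(y %% a)%Z|%N by rewrite gez0_abs // modz_ge0.
pose x := `|(y %% a)%Z|%N.
have Px : P (g%:Z * x%:Z) g%:Z.
  have -> : g%:Z * x%:Z = u0 - A%:Z * (y %/ a)%Z.
    by rewrite /x -xE u0E [X in X * _ - _](divz_eq y a) AE PoszM; ring.
  by rewrite -[X in P _ X]subr0; apply: PB => //; apply/AP; rewrite dvdz_mulr.
have xa : (x < a)%N by rewrite -ltz_nat /x -xE ltz_pmod; lia.
exists g, a, x; split => //.
  have : (A %| g%:Z * (qnorm p x)%:Z)%Z.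
    apply/AP; have := PM _ _ (x%:Z + 1) (-1) Px; rewrite -nformE /nform.
    by congr P; ring.
  by rewrite -PoszM dvdzE !absz_nat AE [(a * g)%N]mulnC dvdn_pmul2l.
move=> u v; split => [Puv|[i [j [-> ->]]]].
  have /dvdzP[j vE] : (g %| v)%Z by apply/gP; exists u.
  have : P (u - j * (g%:Z * x%:Z)) 0.
    by rewrite -[X in P _ X](subrr v) {2}vE; apply: PB => //; apply: PZ.
  move/AP => /dvdzP[i uE]; exists i, j; split; last by rewrite vE mulrC.
  by rewrite -(subrK (j * (g%:Z * x%:Z)) u) uE AE PoszM; ring.
have -> : g%:Z * (i * a%:Z + j * x%:Z) = i * A%:Z + j * (g%:Z * x%:Z).
  by rewrite AE PoszM; ring.
rewrite [g%:Z * j]mulrC -[X in P _ X]add0r -(mulr0 i); apply: PD; apply: PZ => //.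
by apply/AP; exact: dvdzz.
Qed.

End QuadraticLattice.

Lemma hermite_form_uniq (g a x g' a' x' : nat) :
  (0 < g)%N -> (x < a)%N -> (0 < g')%N -> (x' < a')%N ->
  (forall u v, (exists i j : int, u = g%:Z * (i * a%:Z + j * x%:Z) /\ v = g%:Z * j) <->
               (exists i j : int, u = g'%:Z * (i * a'%:Z + j * x'%:Z) /\ v = g'%:Z * j)) ->
  [/\ g = g', a = a' & x = x'].
Proof.
move=> g0 xa g0' xa' H.
have [i1 [j1 [E1 F1]]] : exists i j : int, g%:Z * x%:Z = g'%:Z * (i * a'%:Z + j * x'%:Z) /\ g%:Z = g'%:Z * j.
  by apply/H; exists 0, 1; split; ring.
have [i2 [j2 [E2 F2]]] : exists i j : int, g'%:Z * x'%:Z = g%:Z * (i * a%:Z + j * x%:Z) /\ g'%:Z = g%:Z * j.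
  by apply/H; exists 0, 1; split; ring.
have gg : g = g'.
  apply/eqP; rewrite eqn_dvd; apply/andP; split.
    by have : (g %| g'%:Z)%Z by rewrite F2 dvdz_mulr.
  by have : (g' %| g%:Z)%Z by rewrite F1 dvdz_mulr.
subst g'; have g00 : g%:Z != 0 by lia.
have [i3 [j3 [E3 F3]]] : exists i j : int, g%:Z * a%:Z = g%:Z * (i * a'%:Z + j * x'%:Z) /\ (0 : int) = g%:Z * j.
  by apply/H; exists 1, 0; split; ring.
have [i4 [j4 [E4 F4]]] : exists i j : int, g%:Z * a'%:Z = g%:Z * (i * a%:Z + j * x%:Z) /\ (0 : int) = g%:Z * j.
  by apply/H; exists 1, 0; split; ring.
have j30 : j3 = 0 by apply: (mulfI g00); rewrite mulr0.
have j40 : j4 = 0 by apply: (mulfI g00); rewrite mulr0.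
move/(mulfI g00): E3; move/(mulfI g00): E4; rewrite j30 j40 !mul0r !addr0 => E4 E3.
have aa : a = a'.
  apply/eqP; rewrite eqn_dvd; apply/andP; split.
    by have : (a %| a'%:Z)%Z by rewrite E4 dvdz_mull.
  by have : (a' %| a%:Z)%Z by rewrite E3 dvdz_mull.
subst a'; split => //.
have j11 : j1 = 1 by apply: (mulfI g00); rewrite mulr1.
move/(mulfI g00): E1; rewrite j11 mul1r => E1.
suff : x%:Z - x'%:Z = 0 by lia.
by apply: (@dvdz_small a); [rewrite E1 addrK dvdz_mull|lia].
Qed.

Local Open Scope classical_set_scope.

Lemma quadratic_Aint (b c : int) (x : algC) : x ^+ 2 + b%:~R * x + c%:~R = 0 -> x \in Aint.
Proof.
move=> xE; apply: (@root_monic_Aint ('X^2 + b%:~R%:P * 'X + c%:~R%:P)).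
- by rewrite rootE !hornerE xE.
- rewrite monicE -addrA lead_coefDl ?lead_coefXn // size_polyXn ltnS.
  by rewrite size_MXaddC; case: ifP => // _; rewrite ltnS size_polyC leq_b1.
- apply/polyOverP => i; rewrite !(coefD, coefXn, coefMX, coefC).
  by apply: rpredD; [apply: rpredD|]; do ?case: ifP; rewrite ?rpred0 ?intr_int ?rpred_nat.
Qed.

(** * The field Q(sqrt(-p)) and its ring of integers Z[w] *)

Section QuadraticField.
Variable p : nat.
Hypothesis (pp : prime p) (p3 : p = 3 %[mod 4]).
Local Notation c0 := (p.+1 %/ 4)%N.

Definition qgen : algC := (1 + sqrtC ((- p%:Z)%:~R)) / 2%:R.
Local Notation w := qgen.
Local Notation K := (quadratic_field (- p%:Z)).
Local Notation O := (ring_of_integers (quadratic_field (- p%:Z))).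

Lemma sqrt_disc : sqrtC ((- p%:Z)%:~R) = 2%:R * w - 1 :> algC.
Proof. by rewrite /qgen mulrCA mulfV ?mulr1 ?pnatr_eq0 // addrC addKr. Qed.

Lemma disc_c0 : p%:R = 4%:R * c0%:R - 1 :> algC.
Proof.
apply/eqP; rewrite eq_sym subr_eq -natrM natr1; apply/eqP; congr _%:R.
by move: p3; clear; lia.
Qed.

Lemma qgen_sqr : w ^+ 2 = w - c0%:R.
Proof.
have h := sqrtCK ((- p%:Z)%:~R : algC); move: h; rewrite sqrt_disc rmorphN /= -pmulrn disc_c0.
move=> h; apply: (@mulfI _ 4%:R); first by rewrite pnatr_eq0.
have : (2%:R * w - 1) ^+ 2 + 4%:R * w - 1 = - (4%:R * c0%:R - 1) + 4%:R * w - 1 by rewrite h.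
move=> {}h; have -> : 4%:R * w ^+ 2 = (2%:R * w - 1) ^+ 2 + 4%:R * w - 1 by ring.
by rewrite h; ring.
Qed.

(** The conjugate has the same square, and a real root would have a nonnegative square. *)
Lemma sqrt_disc_conj : (sqrtC ((- p%:Z)%:~R) : algC)^* = - sqrtC ((- p%:Z)%:~R).
Proof.
set s := sqrtC _; have s2 : s ^+ 2 = (- p%:Z)%:~R by rewrite sqrtCK.
have : (s^*) ^+ 2 == s ^+ 2 by rewrite -rmorphXn /= s2 rmorph_int.
rewrite eqf_sqr => /orP[/eqP/CrealP sR|/eqP //].
have : 0 <= s ^+ 2 by rewrite real_exprn_even_ge0.
by rewrite s2 ler0z oppr_ge0 lez_nat leqn0 gtn_eqF ?prime_gt0.
Qed.

Lemma qgen_conj : w^* = 1 - w.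
Proof.
rewrite /qgen fmorph_div rmorphD rmorph1 /= sqrt_disc_conj rmorph_nat.
by field.
Qed.

Let ratrD (a b : rat) : (ratr (a + b) : algC) = ratr a + ratr b.
Proof. exact: rmorphD. Qed.

Let ratrM (a b : rat) : (ratr (a * b) : algC) = ratr a * ratr b.
Proof. exact: rmorphM. Qed.

Let ratrN (a : rat) : (ratr (- a) : algC) = - ratr a.
Proof. exact: rmorphN. Qed.

Let ratr2 : (ratr 2%:R : algC) = 2%:R. Proof. exact: ratr_nat. Qed.

Definition qelt (a b : rat) : algC := (ratr a : algC) + (ratr b : algC) * w.

Lemma quadratic_fieldE z : K z <-> exists a b : rat, z = qelt a b.
Proof.
split=> [[a [b ->]]|[a [b ->]]].
  exists (a - b), (2%:R * b); rewrite sqrt_disc /qelt rmorphB rmorphM /= ratr_nat.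
  by rewrite -[LHS]/((ratr a : algC) + (ratr b : algC) * (2%:R * w - 1)); ring.
exists (a + b / 2%:R), (b / 2%:R).
rewrite /qelt /qgen; set s := sqrtC _.
rewrite -[RHS]/((ratr (a + b / 2%:R) : algC) + (ratr (b / 2%:R) : algC) * s).
by rewrite rmorphD !fmorph_div /= ratr_nat; ring.
Qed.

Lemma qeltM a b a' b' : qelt a b * qelt a' b' =
  qelt (a * a' - c0%:R * b * b') (a * b' + b * a' + b * b').
Proof.
rewrite /qelt !(rmorphD, rmorphB, rmorphM, ratr_nat) /=.
transitivity (ratr a * ratr a' + (ratr a * ratr b' + ratr b * ratr a') * w
   + ratr b * ratr b' * w ^+ 2 : algC); first by ring.
by rewrite qgen_sqr; ring.
Qed.

Lemma qelt_conj a b : (qelt a b)^* = qelt (a + b) (- b).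
Proof.
have cr (r : rat) : (ratr r : algC)^* = ratr r by rewrite conj_Crat ?Crat_rat.
have -> : (qelt a b)^* = (ratr a : algC)^* + (ratr b : algC)^* * w^*.
  by rewrite /qelt; move: (ratr a : algC) (ratr b : algC) => x y; rewrite rmorphD rmorphM.
by rewrite !cr qgen_conj /qelt rmorphD rmorphN /=; ring.
Qed.

(** With b != 0, w and hence sqrt(-p) would be rational, so equal to its own conjugate -sqrt(-p). *)
Lemma qelt_eq0 a b : qelt a b = 0 -> a = 0 /\ b = 0.
Proof.
move=> E; have b0 : b = 0.
  apply/eqP/negPn/negP => b0.
  have b0' : ratr b != 0 :> algC by rewrite fmorph_eq0.
  have wR : w \in Crat.
    have -> : w = ratr (- a / b).
      rewrite fmorph_div rmorphN /=; apply: (mulIf b0'); rewrite divfK //.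
      by apply/eqP; rewrite -addr_eq0 addrC mulrC -/(qelt a b) E.
    exact: Crat_rat.
  have sR : sqrtC ((- p%:Z)%:~R) \in Creal.
    by apply: Creal_Crat; rewrite sqrt_disc rpredB ?rpred1 // rpredM // rpred_nat.
  have := sqrt_disc_conj; move/CrealP: sR => -> /eqP.
  rewrite -subr_eq0 opprK -mulr2n -mulr_natr mulf_eq0 pnatr_eq0 orbF sqrtC_eq0.
  by rewrite intr_eq0 oppr_eq0; case: (p) (prime_gt0 pp).
by split=> //; apply/eqP; move: E; rewrite /qelt b0 rmorph0 mul0r addr0 => /eqP; rewrite fmorph_eq0.
Qed.

Definition emb (u v : int) : algC := u%:~R + v%:~R * w.

Lemma embE u v : emb u v = qelt u%:~R v%:~R.
Proof. by rewrite /emb /qelt !ratr_int. Qed.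

Lemma emb0 : emb 0 0 = 0. Proof. by rewrite /emb mul0r addr0. Qed.

Lemma embB u v u' v' : emb u v - emb u' v' = emb (u - u') (v - v').
Proof. by rewrite /emb !rmorphB /=; ring. Qed.

Lemma embN u v : - emb u v = emb (- u) (- v).
Proof. by rewrite /emb !rmorphN /=; ring. Qed.

Lemma embM u v u' v' : emb u v * emb u' v' =
  emb (u * u' - c0%:Z * v * v') (u * v' + v * u' + v * v').
Proof.
rewrite !embE qeltM; congr qelt; last by rewrite !rmorphD !rmorphM.
by rewrite rmorphB !rmorphM /= -pmulrn.
Qed.

Lemma embZ (k u v : int) : k%:~R * emb u v = emb (k * u) (k * v).
Proof. by rewrite /emb !rmorphM /=; ring. Qed.

Lemma emb_inj u v u' v' : emb u v = emb u' v' -> u = u' /\ v = v'.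
Proof.
move/eqP; rewrite -subr_eq0 embB embE => /eqP/qelt_eq0[] /eqP + /eqP.
by rewrite !intr_eq0 !subr_eq0 => /eqP-> /eqP->.
Qed.

Lemma emb_conj u v : (emb u v)^* = emb (u + v) (- v).
Proof. by rewrite !embE qelt_conj rmorphD rmorphN. Qed.

Lemma emb_norm u v : emb u v * emb (u + v) (- v) = (nform p u v)%:~R.
Proof. by rewrite embM /nform -[RHS]addr0 -(mul0r w) -[0 in RHS]/(0%:~R); congr emb; ring. Qed.

Lemma qgenE : w = emb 0 1. Proof. by rewrite /emb mul1r add0r. Qed.

Lemma quadratic_field_den z : K z <-> exists d u v : int, d != 0 /\ z = emb u v / d%:~R.
Proof.
rewrite quadratic_fieldE; split=> [[a [b ->]]|[d [u [v [d0 ->]]]]].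
  exists (denq a * denq b), (numq a * denq b), (numq b * denq a).
  rewrite mulf_neq0 ?denq_neq0 //; split=> //.
  rewrite /qelt -{1}(divq_num_den a) -{1}(divq_num_den b) /emb !fmorph_div /= !ratr_int !rmorphM /=.
  have da : (denq a)%:~R != 0 :> algC by rewrite intr_eq0 denq_neq0.
  have db : (denq b)%:~R != 0 :> algC by rewrite intr_eq0 denq_neq0.
  by field; rewrite da db.
exists (u%:~R / d%:~R), (v%:~R / d%:~R).
by rewrite /qelt /emb !fmorph_div /= !ratr_int; ring.
Qed.

(** If a + b w is integral, its trace A = 2 a + b and its norm N are integers with p b^2 = 4 N -
    A^2. So p b is an integer whose square is divisible by p, whence b is an integer; then a is a
    rational root of a monic integral quadratic. *)
Lemma ring_of_integersE z : O z <-> exists u v : int, z = emb u v.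
Proof.
split=> [[/quadratic_fieldE[a [b zE]] zA]|[u [v ->]]]; last first.
  split; first by apply/quadratic_fieldE; exists u%:~R, v%:~R; rewrite embE.
  have wA : w \in Aint.
    by apply: (@quadratic_Aint (-1) c0%:Z); rewrite qgen_sqr rmorphN1 -pmulrn; ring.
  by apply: rpredD; [|apply: rpredM]; rewrite ?Aint_int.
have cA : z^* \in Aint by rewrite Aint_aut.
have toint (q : rat) : (ratr q : algC) \in Aint -> exists n : int, q = n%:~R.
  move=> qA; have /intrP[n nE] := Cint_rat_Aint (Crat_rat q) qA.
  by exists n; apply: (fmorph_inj (ratr : rat -> algC)); apply: etrans nE (esym (ratr_int _ n)).
have [A AE] : exists n : int, 2%:R * a + b = n%:~R.
  apply: toint; have -> : ratr (2%:R * a + b) = z + z^* :> algC.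
    by rewrite zE qelt_conj /qelt !(ratr2, ratrD, ratrN, ratrM); ring.
  exact: rpredD.
have [N NE] : exists n : int, a ^+ 2 + a * b + c0%:R * b ^+ 2 = n%:~R.
  apply: toint; have -> : ratr (a ^+ 2 + a * b + c0%:R * b ^+ 2) = z * z^* :> algC.
    rewrite zE qelt_conj qeltM /qelt.
    have -> : a * - b + b * (a + b) + b * - b = 0 by ring.
    by rewrite rmorph0 mul0r addr0; congr ratr; ring.
  exact: rpredM.
have pq : p%:R = 4%:R * c0%:R - 1 :> rat.
  apply/eqP; rewrite eq_sym subr_eq -natrM natr1; apply/eqP; congr _%:R.
  by move: p3; clear; lia.
have pb : (p%:R * b) ^+ 2 = (p%:Z * (4 * N - A ^+ 2))%:~R.
  rewrite rmorphM rmorphB rmorphM rmorphXn /= -AE -NE -pmulrn exprMn expr2 -mulrA; congr (_ * _).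
  by rewrite [4%:~R]pmulrn pq; ring.
have [B BE] : exists n : int, p%:R * b = n%:~R.
  apply: toint; apply: (@quadratic_Aint 0 (- (p%:Z * (4 * N - A ^+ 2)))).
  by rewrite mul0r addr0 -rmorphXn /= pb ratr_int rmorphN /= subrr.
have pB : (p %| B)%Z.
  have : (p %| B ^+ 2)%Z.
    move: pb; rewrite BE -rmorphXn /= => /(@intr_inj rat) ->.
    by rewrite dvdz_mulr.
  by rewrite !dvdzE abszX Euclid_dvdX // andbT.
have [v bv] : exists v : int, b = v%:~R.
  move/dvdzP: pB => [v vE]; exists v; have p0 : p%:R != 0 :> rat by rewrite pnatr_eq0 gtn_eqF ?prime_gt0.
  by apply: (mulfI p0); rewrite BE vE rmorphM /= mulrC -pmulrn.
have [u au] : exists u : int, a = u%:~R.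
  apply: toint; apply: (@quadratic_Aint v (c0%:Z * v ^+ 2 - N)).
  rewrite -(ratr_int _ v) -(ratr_int _ (_ - _)) -bv -rmorphXn -rmorphM -!rmorphD /=.
  rewrite rmorphB /= -NE rmorphM rmorphXn /= -bv -pmulrn -[RHS](rmorph0 (ratr : rat -> algC)).
  by congr ratr; ring.
by exists u, v; rewrite zE au bv embE.
Qed.

End QuadraticField.

(** * Fractional ideals as multiples of lattices, their multipliers and units *)

Section Lattices.
Variable p : nat.
Hypothesis (pp : prime p) (p3 : p = 3 %[mod 4]) (pn3 : p <> 3%N).
Local Notation c0 := (p.+1 %/ 4)%N.
Local Notation w := (qgen p).
Local Notation K := (quadratic_field (- p%:Z)).
Local Notation O := (ring_of_integers (quadratic_field (- p%:Z))).
Local Notation emb := (emb p).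

Lemma c0_gt1 : (1 < c0)%N.
Proof.
by move: p3 pn3 (prime_gt1 pp); clear; lia.
Qed.
Let c0_gt0 : (0 < c0)%N := ltnW c0_gt1.

Let KE := quadratic_fieldE p.
Let OE := ring_of_integersE pp p3.
Let eM := embM p3.

Lemma K_emb u v : K (emb u v).
Proof. by apply/KE; exists u%:~R, v%:~R; rewrite embE. Qed.

Lemma K_mul x y : K x -> K y -> K (x * y).
Proof.
move=> /KE[a [b ->]] /KE[a' [b' ->]]; apply/KE; rewrite (qeltM p3).
by eexists; eexists.
Qed.

Lemma K_int (n : int) : K n%:~R.
Proof. by have := K_emb n 0; rewrite /emb mul0r addr0. Qed.

Lemma K_inv x : K x -> K x^-1.
Proof.
have [->|x0] := eqVneq x 0; first by rewrite invr0.
move=> /(quadratic_field_den p)[d [u [v [d0 xE]]]]; rewrite xE.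
have uv0 : (u != 0) || (v != 0).
  rewrite -negb_and; apply: contra x0 => /andP[/eqP u0 /eqP v0].
  by rewrite xE u0 v0 emb0 mul0r.
have n0 := nform_gt0 c0_gt0 uv0.
have d0' : d%:~R != 0 :> algC by rewrite intr_eq0.
have n0' : (nform p u v)%:~R != 0 :> algC by rewrite intr_eq0 gt_eqF.
have e0 : emb u v != 0.
  by apply: contraNneq n0' => e0; rewrite -(emb_norm p3) e0 mul0r.
apply/(quadratic_field_den p); exists (nform p u v), (d * (u + v)), (d * - v).
split; first by rewrite gt_eqF.
have E : (emb u v)^-1 = emb (u + v) (- v) / (nform p u v)%:~R.
  by apply: (mulfI e0); rewrite mulfV // mulrA (emb_norm p3) mulfV.
by rewrite invf_div E mulrA embZ.
Qed.

Definition lat (a x : nat) : set algC :=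
  [set z | exists i j : int, z = emb (i * a%:Z + j * x%:Z) j].

Lemma lat_gen1 a x : lat a x a%:R.
Proof. by exists 1, 0; rewrite mul1r mul0r addr0 /emb mul0r addr0 -pmulrn. Qed.

Lemma lat_gen2 a x : lat a x (emb x%:Z 1).
Proof. by exists 0, 1; rewrite mul1r mul0r add0r. Qed.

Lemma lat_sub a x y z : lat a x y -> lat a x z -> lat a x (y - z).
Proof.
move=> [i [j ->]] [i' [j' ->]]; exists (i - i'), (j - j'); rewrite embB.
by congr emb; ring.
Qed.

(** Since w (x + w) = (x + 1)(x + w) - N(x + w), the divisibility by a is what keeps the lattice
    stable. *)
Lemma lat_stable a x r z : (a %| qnorm p x)%N -> O r -> lat a x z -> lat a x (r * z).
Proof.
move=> /dvdnP[c cE] /OE[u [v ->]] [i [j ->]]; rewrite eM.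
have cE' : nform p x%:Z 1 = c%:Z * a%:Z by rewrite nformE cE PoszM.
exists (u * i - x%:Z * v * i - v * j * c%:Z), (u * j + v * (i * a%:Z + j * x%:Z) + v * j).
congr emb; move: cE'; rewrite /nform => cE'.
have -> : (u * i - x%:Z * v * i - v * j * c%:Z) * a%:Z
  = u * i * a%:Z - x%:Z * v * i * a%:Z - v * j * (c%:Z * a%:Z) by ring.
by rewrite -cE'; ring.
Qed.

(* A fractional ideal is d^-1 times an integral one, whose Hermite normal form
   is g (Z a + Z (x + w)). *)
Lemma fractional_ideal_lat I : fractional_ideal K I ->
  exists c a x, [/\ K c, c != 0, (x < a)%N, (a %| qnorm p x)%N &
    I = [set c * z | z in lat a x]].
Proof.
move=> [IK [I0 [z Iz z0]] IA IM [d [Od [d0 dI]]]].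
have Kd : K d by case: Od.
have INeg y : I y -> I (- y).
  move=> Iy; have -> : - y = emb (-1) 0 * y.
    by rewrite /emb mul0r addr0 rmorphN1 mulN1r.
  by apply: IM => //; apply/OE; exists (-1), 0.
have IB y y' : I y -> I y' -> I (y - y') by move=> Iy /INeg; apply: IA.
pose P u v := I (d^-1 * emb u v).
have PB u v u' v' : P u v -> P u' v' -> P (u - u') (v - v').
  by rewrite /P -embB mulrBr; apply: IB.
have Pw u v : P u v -> P (- (c0%:Z * v)) (u + v).
  rewrite /P => Puv; have -> : emb (- (c0%:Z * v)) (u + v) = w * emb u v.
    by rewrite qgenE eM; congr emb; ring.
  by rewrite mulrCA; apply: IM => //; apply/OE; exists 0, 1; rewrite qgenE.
have Pnz : exists u v, P u v /\ (u != 0) || (v != 0).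
  have [u [v uv]] := iffLR (OE _) (dI _ Iz).
  exists u, v; split; first by rewrite /P -uv mulKf.
  rewrite -negb_and; apply: contra_neqN (mulf_neq0 d0 z0) => /andP[/eqP u0 /eqP v0].
  by rewrite uv u0 v0 emb0.
have [g [a [x [g0 xa ax gP]]]] := hermite_form c0_gt0 PB Pw Pnz.
have g0' : g%:R != 0 :> algC by rewrite pnatr_eq0 -lt0n.
exists (g%:R / d), a, x; split => //.
- by apply: K_mul; [have := K_int g; rewrite -pmulrn|apply: K_inv].
- by rewrite mulf_neq0 // invr_eq0.
apply/seteqP; split => [y Iy|_ [_ [i [j ->]] <-]].
  have [u [v uv]] := iffLR (OE _) (dI _ Iy).
  have [] := iffLR (gP u v); first by rewrite /P -uv mulKf.
  move=> i [j [uE vE]]; exists (emb (i * a%:Z + j * x%:Z) j); first by exists i, j.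
  by rewrite mulrAC [g%:R]pmulrn embZ -uE -vE -uv mulrC mulKf.
rewrite mulrAC [g%:R]pmulrn embZ mulrC.
by apply/(gP (_ * _) (_ * _)); exists i, j.
Qed.

Lemma lat_fractional_ideal a x : (0 < a)%N -> (a %| qnorm p x)%N ->
  fractional_ideal K (lat a x).
Proof.
move=> a0 ax; split.
- by move=> _ [i [j ->]]; apply: K_emb.
- split; first by exists 0, 0; rewrite !mul0r addr0 emb0.
  exists a%:R; first exact: lat_gen1.
  by rewrite pnatr_eq0 -lt0n.
- move=> y z Ly Lz; have L0 : lat a x 0 by rewrite -(subrr y); apply: lat_sub.
  by rewrite -[z]opprK; apply: lat_sub => //; rewrite -sub0r; apply: lat_sub.
- by move=> r z Or Lz; apply: lat_stable.
exists 1.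
  by split; [apply/OE; exists 1, 0; rewrite /emb mul0r addr0|exact: oner_neq0].
by move=> _ [i [j ->]]; rewrite mul1r; apply/OE; exists (i * a%:Z + j * x%:Z), j.
Qed.

Definition lat_equiv (a x a' x' : nat) : Prop :=
  exists c, [/\ K c, c != 0 & lat a' x' = [set c * z | z in lat a x]].

Lemma scale_set1 (S : set algC) : [set 1 * z | z in S] = S.
Proof.
apply/seteqP; split => [_ [z Sz <-]|z Sz]; first by rewrite mul1r.
by exists z; rewrite ?mul1r.
Qed.

Lemma scale_setM (c d : algC) (S : set algC) :
  [set c * z | z in [set d * z | z in S]] = [set c * d * z | z in S].
Proof.
apply/seteqP; split => [_ [_ [z Sz <-] <-]|_ [z Sz <-]]; first by exists z; rewrite ?mulrA.
by exists (d * z); [exists z|rewrite mulrA].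
Qed.

Lemma lat_equiv_refl a x : lat_equiv a x a x.
Proof.
by exists 1; split; rewrite ?oner_neq0 ?scale_set1 //; have := K_int 1.
Qed.

Lemma lat_equiv_sym a x a' x' : lat_equiv a x a' x' -> lat_equiv a' x' a x.
Proof.
move=> [c [Kc c0' E]]; exists c^-1; split; [exact: K_inv|by rewrite invr_eq0|].
by rewrite E scale_setM mulVf // scale_set1.
Qed.

Lemma lat_equiv_trans a x a' x' a'' x'' :
  lat_equiv a x a' x' -> lat_equiv a' x' a'' x'' -> lat_equiv a x a'' x''.
Proof.
move=> [c [Kc c0 E]] [c' [Kc' c0' E']]; exists (c' * c).
by split; [exact: K_mul|rewrite mulf_neq0|rewrite E' E scale_setM].
Qed.

Lemma ideal_class_eq I I' : ideal_class K I = ideal_class K I' <->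
  exists2 c, K c /\ c != 0 & I' = [set c * z | z in I].
Proof.
have cls J : ideal_class K J J.
  by exists 1; rewrite ?scale_set1 //; split; [exact: (K_int 1)|exact: oner_neq0].
split=> [E|[c [Kc c0 ->]]].
  by have := cls I'; rewrite -E.
apply/seteqP; split => [J [d [Kd d0 ->]]|J [d [Kd d0 ->]]].
  exists (d * c^-1); last by rewrite scale_setM divfK.
  by split; [apply: K_mul => //; apply: K_inv|rewrite mulf_neq0 // invr_eq0].
exists (d * c); last by rewrite scale_setM.
by split; [apply: K_mul|rewrite mulf_neq0].
Qed.

(* The ring of multipliers of Za + Z(x + w) is O: its elements are
   i + j (x + w) / a with a dividing j (2x + 1) and j N(x + w) / a, and
   a, 2x + 1, N(x + w) / a have no common factor since their form has the squarefree
   discriminant -p. *)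
Lemma lat_multiplier a x c : (0 < a)%N -> (a %| qnorm p x)%N ->
  (forall z, lat a x z -> lat a x (c * z)) -> O c.
Proof.
move=> a0 ax cL; have a0' : a%:R != 0 :> algC by rewrite pnatr_eq0 -lt0n.
have [k kE] := dvdnP ax.
have [i [j E1]] := cL _ (lat_gen1 a x).
have [i' [j' E2]] := cL _ (lat_gen2 a x).
have E3 : emb (i * a%:Z + j * x%:Z) j * emb x%:Z 1 = a%:~R * emb (i' * a%:Z + j' * x%:Z) j'.
  by rewrite -E1 -E2 -pmulrn; ring.
move: E3; rewrite eM embZ => /(emb_inj pp)[F1 F2].
have kE' : nform p x%:Z 1 = k%:Z * a%:Z by rewrite nformE kE PoszM.
rewrite /nform in kE'.
have d1 : (a %| j * (x.*2.+1)%:Z)%Z.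
  apply/dvdzP; exists (j' - i).
  have -> : (x.*2.+1)%:Z = x%:Z + x%:Z + 1 by clear; lia.
  by transitivity (a%:Z * j' - i * a%:Z); [rewrite -F2|]; ring.
have d2 : (a %| j * k%:Z)%Z.
  have a0z : a%:Z != 0 by move: a0; clear; lia.
  apply/dvdzP; exists (- i'); apply: (mulIf a0z).
  have -> : j * k%:Z * a%:Z = j * (k%:Z * a%:Z) by ring.
  have F1' : c0%:Z * j = i * a%:Z * x%:Z + j * x%:Z ^+ 2 - a%:Z * (i' * a%:Z + j' * x%:Z).
    by rewrite -F1; ring.
  have F2' : a%:Z * j' = i * a%:Z + j * x%:Z + j * x%:Z + j by rewrite -F2; ring.
  transitivity (j * x%:Z ^+ 2 + j * x%:Z + c0%:Z * j); first by rewrite -kE'; ring.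
  rewrite F1'; transitivity (2 * j * x%:Z ^+ 2 + j * x%:Z + i * a%:Z * x%:Z - a%:Z * i' * a%:Z - (a%:Z * j') * x%:Z).
    by ring.
  by rewrite F2'; ring.
have cop : coprime a (gcdn x.*2.+1 k).
  apply/negPn/negP => ncop.
  have g1 : (1 < gcdn a (gcdn x.*2.+1 k))%N.
    by rewrite ltn_neqAle eq_sym ncop gcdn_gt0 a0.
  have qg := pdiv_dvd (gcdn a (gcdn x.*2.+1 k)); have pq := pdiv_prime g1.
  move: (pdiv _) pq qg => q pq; rewrite !dvdn_gcd => /and3P[qa qx qk].
  have q2 : (q ^ 2 %| (x.*2.+1) ^ 2 + p)%N.
    by rewrite -qnorm4 // kE -mulnn dvdn_mull // dvdn_mul.
  have qp : (q ^ 2 %| p)%N by rewrite -(dvdn_addr _ (dvdn_exp2r 2 qx)).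
  have qE : q = p.
    by apply/eqP; rewrite -dvdn_prime2 //; apply: dvdn_trans qp; apply: dvdn_exp.
  move: qp; rewrite qE => /(dvdn_leq (prime_gt0 pp)).
  by rewrite -{2}(expn1 p) leq_exp2l // prime_gt1.
have aj : (a %| j)%Z.
  move: d1 d2; rewrite !dvdzE !abszM !absz_nat => d1 d2.
  by rewrite -(Gauss_dvdl _ cop) muln_gcdr dvdn_gcd d1.
have /dvdzP[l lE] := aj; apply/OE; exists (i + l * x%:Z), l.
apply: (mulIf a0'); rewrite E1 [a%:R]pmulrn [RHS]mulrC embZ lE.
by congr emb; ring.
Qed.

(** The norm of a unit is 1, and 4 = (2 u + v)^2 + (4 c0 - 1) v^2 forces v = 0 because 4 c0 - 1 is
    at least 7; p = 3 would allow v = 1 or -1. *)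
Lemma unit_integer c : c != 0 -> O c -> O c^-1 -> c = 1 \/ c = -1.
Proof.
move=> c0' /OE[u [v cE]] /OE[u' [v' cE']].
have E : (nform p u v * nform p u' v')%:~R = 1 :> algC.
  rewrite rmorphM /= -!(emb_norm p3) -!(emb_conj pp) -cE -cE' mulrACA mulfV // mul1r.
  by rewrite -rmorphM mulfV // rmorph1.
have uv : (u != 0) || (v != 0).
  rewrite -negb_and; apply: contra c0' => /andP[/eqP u0 /eqP v0].
  by rewrite cE u0 v0 emb0.
have n1 : nform p u v = 1.
  have n0 := nform_gt0 c0_gt0 uv; move: E => /eqP; rewrite -[1]/(1%:~R) eqr_int => /eqP E.
  have : (nform p u v %| 1)%Z.
    by apply/dvdzP; exists (nform p u' v'); rewrite mulrC; apply: esym E.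
  by rewrite dvdz1; move: n0; clear; lia.
have v0 : v = 0.
  have E4 : (2 * u + v) ^+ 2 + (4 * c0%:Z - 1) * v ^+ 2 = 4.
    by transitivity (4 * nform p u v); [rewrite /nform; ring|rewrite n1].
  have h1 := c0_gt1; have h2 := sqr_ge0 (2 * u + v).
  case: (eqVneq v 0) => // v0; have v1 : 1 <= v ^+ 2.
    by rewrite -gtz0_ge1 lt_neqAle eq_sym sqrf_eq0 v0 sqr_ge0.
  have c7 : 7 <= 4 * c0%:Z - 1 by move: h1; clear; lia.
  have := ler_pM (isT : 0 <= 7 :> int) (isT : 0 <= 1 :> int) c7 v1.
  lra.
move: n1; rewrite /nform v0 mulr0 expr0n /= mulr0 !addr0 cE v0 => /eqP.
rewrite -subr_eq0 subr_sqr_1 mulf_eq0 subr_eq0 addr_eq0 => /orP[] /eqP ->; [left|right].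
  by rewrite /emb mul0r addr0.
by rewrite /emb mul0r addr0 rmorphN1.
Qed.

End Lattices.

(** * Reduction and a finite system of representatives of the classes *)

Section Representatives.
Variable p : nat.
Hypothesis (pp : prime p) (p3 : p = 3 %[mod 4]) (pn3 : p <> 3%N).
Local Notation c0 := (p.+1 %/ 4)%N.
Local Notation K := (quadratic_field (- p%:Z)).
Local Notation emb := (emb p).

Lemma dvdn_nform (b : nat) (u : int) (y t : int) : u = y + t * b%:Z ->
  (b %| nform p u 1)%Z = (b %| nform p y 1)%Z.
Proof.
move=> uE; have E : nform p u 1 - nform p y 1 = t * (u + y + 1) * b%:Z.
  by rewrite /nform uE; ring.
have d : (b %| nform p u 1 - nform p y 1)%Z by rewrite E dvdz_mull.
apply/idP/idP => h; last by have := dvdz_add h d; rewrite addrC subrK.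
by have := dvdz_sub h d; rewrite subKr.
Qed.

(* Multiplying by the conjugate of (x + w) / a exchanges a and N(x + w) / a. *)
Lemma lat_descend a x : (c0 < a)%N -> (x < a)%N -> (a %| qnorm p x)%N ->
  exists b y, [/\ (b < a)%N, (y < b)%N, (b %| qnorm p y)%N & lat_equiv p a x b y].
Proof.
move=> ca xa /dvdnP[b bE]; have c1 := c0_gt1 pp p3 pn3.
have a0 : (0 < a)%N := leq_ltn_trans (leq0n _) ca.
have b0 : (0 < b)%N.
  case: (posnP b) bE => // -> /eqP; rewrite mul0n /qnorm addn_eq0 => /andP[_ /eqP c00].
  by move: c1; rewrite c00.
(* From x < a one has x^2 + x <= a^2 - a, so c0 < a gives a b = N(x + w) < a^2. *)
have ba : (b < a)%N.
  rewrite -(ltn_pmul2r a0) -bE /qnorm; move: c1 ca xa; move: (p.+1 %/ 4)%N => c.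
  by clear; nia.
have b0z : b%:Z != 0 by move: b0; clear; lia.
(* The conjugate of x + w is -((-x - 1) + w), so the new lattice is Zb + Z((-x - 1) + w), with -x -
   1 reduced modulo b. *)
pose y := `|((- x%:Z - 1) %% b)%Z|%N.
have yE : ((- x%:Z - 1) %% b)%Z = y%:Z by rewrite /y gez0_abs // modz_ge0.
have yb : (y < b)%N by rewrite -ltz_nat -yE ltz_pmod; move: b0; clear; lia.
pose t := ((- x%:Z - 1) %/ b)%Z.
have tE : - x%:Z - 1 = y%:Z + t * b%:Z by rewrite [LHS](divz_eq _ b) yE addrC.
exists b, y; split => //.
  have : (b %| nform p y%:Z 1)%Z; last by rewrite nformE.
  rewrite -(dvdn_nform tE); apply/dvdzP; exists a%:Z.
  by rewrite -PoszM mulnC -bE -nformE /nform; ring.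
have a0' : a%:R != 0 :> algC by rewrite pnatr_eq0 -lt0n.
have e0 : emb (x%:Z + 1) (-1) != 0.
  rewrite -(emb0 p); apply/eqP => /(emb_inj pp)[_ /eqP]; by rewrite oppr_eq0.
exists (emb (x%:Z + 1) (-1) / a%:R); split.
- by apply: (K_mul p3); [exact: K_emb|apply: (K_inv pp p3 pn3); have := K_int p a; rewrite -pmulrn].
- by rewrite mulf_neq0 ?invr_eq0.
have key i j : emb (x%:Z + 1) (-1) / a%:R * emb (i * a%:Z + j * x%:Z) j
   = emb (i * (x%:Z + 1) + j * b%:Z) (- i).
  apply: (mulIf a0'); rewrite mulrAC divfK // (embM p3) [a%:R]pmulrn [RHS]mulrC embZ.
  have bE' : nform p x%:Z 1 = b%:Z * a%:Z by rewrite nformE bE PoszM.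
  rewrite /nform in bE'; congr emb; last by ring.
  transitivity (i * (x%:Z + 1) * a%:Z + j * (b%:Z * a%:Z)); last by ring.
  by rewrite -bE'; ring.
apply/seteqP; split => [_ [i [j ->]]|_ [_ [i [j ->]] <-]]; last first.
  rewrite key; exists (j - i * t), (- i); congr emb.
  have -> : x%:Z + 1 = - (y%:Z + t * b%:Z) by rewrite -tE; ring.
  by ring.
exists (emb (- j * a%:Z + (i - j * t) * x%:Z) (i - j * t)); first by exists (- j), (i - j * t).
rewrite key opprK; congr emb.
have -> : x%:Z + 1 = - (y%:Z + t * b%:Z) by rewrite -tE; ring.
by ring.
Qed.

(** Descent brings a down to at most c0 and x stays below a: this finite type meets every class,
    which also makes the class group finite. *)
Definition lat_idx : finType := ('I_c0.+1 * 'I_c0.+1)%type.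
Implicit Type t : lat_idx.

Definition lat_valid t := (t.2 < t.1)%N && (t.1 %| qnorm p t.2)%N.
Definition lat_eqb t t' := `[< lat_equiv p t.1 t.2 t'.1 t'.2 >].
(** A choice of one valid pair per class. The default [t] can only be returned for an invalid [t],
    since a valid one is itself a candidate. *)
Definition lat_canon t := odflt t [pick t' | lat_valid t' && lat_eqb t t'].
Definition lat_reps : {set lat_idx} := [set t | lat_valid t & lat_canon t == t].

Lemma lat_reduce a x : (x < a)%N -> (a %| qnorm p x)%N ->
  exists2 t, lat_valid t & lat_equiv p a x t.1 t.2.
Proof.
elim/ltn_ind: a x => a IH x xa ax.
have [ac|ca] := leqP a c0; last first.
  have [b [y [ba yb bY E]]] := lat_descend ca xa ax.
  have [t tv E'] := IH _ ba _ yb bY; exists t => //.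
  exact: (lat_equiv_trans p3) E E'.
have ac' : (a < c0.+1)%N by [].
have xc : (x < c0.+1)%N by apply: leq_trans xa (ltnW ac').
exists (Ordinal ac', Ordinal xc); first by rewrite /lat_valid /= xa ax.
exact: lat_equiv_refl.
Qed.

Lemma lat_canonP t : lat_valid t -> lat_valid (lat_canon t) /\ lat_eqb t (lat_canon t).
Proof.
move=> tv; rewrite /lat_canon; case: pickP => [t' /andP[] //|/(_ t)].
by rewrite tv /=; move/asboolP; case; apply: lat_equiv_refl.
Qed.

Lemma lat_canon_eq t t' : lat_valid t -> lat_valid t' -> lat_eqb t t' ->
  lat_canon t = lat_canon t'.
Proof.
move=> tv tv' /asboolP E.
have Eb s : lat_valid s && lat_eqb t s = lat_valid s && lat_eqb t' s.
  congr (_ && _); apply/asboolP/asboolP => h.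
    by apply: (lat_equiv_trans p3) h; apply: (lat_equiv_sym pp p3 pn3).
  exact: (lat_equiv_trans p3) h.
rewrite /lat_canon (eq_pick Eb); case: pickP => // /(_ t').
by rewrite tv' /=; move/asboolP; case; apply: lat_equiv_refl.
Qed.

Lemma lat_reps_valid t : t \in lat_reps -> lat_valid t.
Proof. by rewrite inE => /andP[]. Qed.

Lemma lat_reps_ex a x : (x < a)%N -> (a %| qnorm p x)%N ->
  exists2 t, t \in lat_reps & lat_equiv p a x t.1 t.2.
Proof.
move=> xa ax; have [t tv E] := lat_reduce xa ax.
have [cv /asboolP Ec] := lat_canonP tv.
exists (lat_canon t); last exact: (lat_equiv_trans p3) E Ec.
rewrite inE cv /=; apply/eqP/esym/lat_canon_eq => //; exact/asboolP.
Qed.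

Lemma lat_reps_inj t t' : t \in lat_reps -> t' \in lat_reps ->
  lat_equiv p t.1 t.2 t'.1 t'.2 -> t = t'.
Proof.
rewrite !inE => /andP[tv /eqP tc] /andP[tv' /eqP tc'] E.
by rewrite -tc -tc'; apply: lat_canon_eq => //; apply/asboolP.
Qed.

Lemma lat_valid_gt0 t : lat_valid t -> (0 < t.1)%N.
Proof. by case/andP => h _; apply: leq_ltn_trans h. Qed.

Theorem class_numberE : class_number K = #|lat_reps|.
Proof.
pose f t := ideal_class K (lat p t.1 t.2).
have E : class_group K = [set` [fset f t | t in lat_reps]%fset].
  apply/seteqP; split => [C [I If <-]|C /= /imfsetP[t /= tr ->]].
    have [c [a [x [Kc c_0 xa ax IE]]]] := fractional_ideal_lat pp p3 pn3 If.
    have [t tr [d [Kd d0 dE]]] := lat_reps_ex xa ax.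
    apply/imfsetP; exists t => //=; rewrite /f.
    apply/(ideal_class_eq pp p3 pn3); exists (d * c^-1).
      split; first by apply: (K_mul p3) => //; apply: (K_inv pp p3 pn3).
      by rewrite mulf_neq0 // invr_eq0.
    by rewrite IE scale_setM divfK.
  exists (lat p t.1 t.2) => //; have tv := lat_reps_valid tr.
  have t0 := lat_valid_gt0 tv; case/andP: tv => _ tx.
  exact: lat_fractional_ideal.
rewrite /class_number E set_fsetK card_in_imfset /=; first by rewrite -cardE.
move=> t t' tr tr' /(ideal_class_eq pp p3 pn3)[c [Kc c_0] cE].
by apply: lat_reps_inj => //; exists c.
Qed.

End Representatives.

(** * Representations by the reduced forms *)

(** Multiplicativity of the determinant; applied in both directions, it shows that two bases of one
    lattice have determinants that divide each other. *)
Lemma det_dvd_span (e11 e12 e21 e22 f11 f12 f21 f22 : int) :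
  (exists i j : int, e11 = i * f11 + j * f21 /\ e12 = i * f12 + j * f22) ->
  (exists i j : int, e21 = i * f11 + j * f21 /\ e22 = i * f12 + j * f22) ->
  (f11 * f22 - f21 * f12 %| e11 * e22 - e21 * e12)%Z.
Proof.
move=> [i [j [-> ->]]] [i' [j' [-> ->]]]; apply/dvdzP; exists (i * j' - i' * j).
by ring.
Qed.

Section RepresentationCount.
Variable p : nat.
Hypothesis (pp : prime p) (p3 : p = 3 %[mod 4]) (pn3 : p <> 3%N).
Local Notation c0 := (p.+1 %/ 4)%N.
Local Notation K := (quadratic_field (- p%:Z)).
Local Notation O := (ring_of_integers (quadratic_field (- p%:Z))).
Local Notation emb := (emb p).
Local Notation lat := (lat p).
Local Notation idx := (lat_idx p).
Let c0_gt0 : (0 < c0)%N := ltnW (c0_gt1 pp p3 pn3).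
Implicit Types (t : idx) (z : int * int).

(** The form N(u a + v (x + w)) / a, of discriminant -p. *)
Definition lat_form t z : int :=
  (t.1 : nat)%:Z * z.1 ^+ 2 + ((t.2 : nat).*2.+1)%:Z * z.1 * z.2
  + (qnorm p t.2 %/ t.1)%N%:Z * z.2 ^+ 2.

(* For z = (u, v), the conjugate of ua + v(x + w) divided by a generates with
   Za + Z(x + w) an integral ideal of norm lat_form t z. *)
Definition lat_coef t z : algC :=
  emb (z.1 * (t.1 : nat)%:Z + z.2 * (t.2 : nat)%:Z + z.2) (- z.2) / (t.1 : nat)%:R.

Definition coef_ideal t z : set algC := [set lat_coef t z * y | y in lat t.1 t.2].
Definition normal_ideal (g a x : nat) : set algC := [set g%:R * y | y in lat a x].

Lemma lat_cofactor t : lat_valid t ->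
  nform p (t.2 : nat)%:Z 1 = (qnorm p t.2 %/ t.1)%N%:Z * (t.1 : nat)%:Z.
Proof. by case/andP=> _ tx; rewrite nformE -PoszM divnK. Qed.

Lemma lat_coef_mul t z i j : lat_valid t ->
  lat_coef t z * emb (i * (t.1 : nat)%:Z + j * (t.2 : nat)%:Z) j =
  emb (i * (z.1 * (t.1 : nat)%:Z + z.2 * (t.2 : nat)%:Z + z.2)
       + j * (z.1 * (t.2 : nat)%:Z + z.2 * (qnorm p t.2 %/ t.1)%N%:Z))
      (- (i * z.2) + j * z.1).
Proof.
move=> tv; have a0 : (t.1 : nat)%:R != 0 :> algC.
  by rewrite pnatr_eq0 -lt0n lat_valid_gt0.
apply: (mulIf a0); rewrite /lat_coef mulrAC divfK // (embM p3).
rewrite [X in _ = _ * X]pmulrn [RHS]mulrC embZ.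
have E := lat_cofactor tv; rewrite /nform in E; case: z => u v /=.
move: (qnorm p t.2 %/ t.1)%N E => c E.
congr emb; last by ring.
transitivity (i * (u * (t.1 : nat)%:Z + v * (t.2 : nat)%:Z + v) * (t.1 : nat)%:Z
  + j * (u * (t.2 : nat)%:Z * (t.1 : nat)%:Z + v * (c%:Z * (t.1 : nat)%:Z))); last by ring.
by rewrite -E; ring.
Qed.

Lemma coef_idealP t z s r : lat_valid t -> coef_ideal t z (emb s r) <->
  exists i j : int,
    s = i * (z.1 * (t.1 : nat)%:Z + z.2 * (t.2 : nat)%:Z + z.2)
        + j * (z.1 * (t.2 : nat)%:Z + z.2 * (qnorm p t.2 %/ t.1)%N%:Z) /\
    r = i * (- z.2) + j * z.1.
Proof.
move=> tv; split => [[_ [i [j ->]]]|[i [j [-> ->]]]].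
  by rewrite lat_coef_mul // => /(emb_inj pp)[<- <-]; exists i, j; rewrite mulrN.
exists (emb (i * (t.1 : nat)%:Z + j * (t.2 : nat)%:Z) j); first by exists i, j.
by rewrite lat_coef_mul // mulrN.
Qed.

Lemma normal_idealP g a x s r : normal_ideal g a x (emb s r) <->
  exists i j : int, s = g%:Z * (i * a%:Z + j * x%:Z) /\ r = g%:Z * j.
Proof.
split => [[_ [i [j ->]]]|[i [j [-> ->]]]].
  by rewrite [g%:R]pmulrn embZ => /(emb_inj pp)[<- <-]; exists i, j.
exists (emb (i * a%:Z + j * x%:Z) j); first by exists i, j.
by rewrite [g%:R]pmulrn embZ.
Qed.

Lemma normal_ideal_emb g a x y : normal_ideal g a x y -> exists s r, y = emb s r.
Proof. by move=> [_ [i [j ->]] <-]; rewrite [g%:R]pmulrn embZ; do 2!eexists. Qed.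

Lemma coef_ideal_emb t z y : lat_valid t -> coef_ideal t z y -> exists s r, y = emb s r.
Proof. by move=> tv [_ [i [j ->]] <-]; rewrite lat_coef_mul //; do 2!eexists. Qed.

Lemma normal_ideal_uniq g a x g' a' x' :
  (0 < g)%N -> (x < a)%N -> (0 < g')%N -> (x' < a')%N ->
  normal_ideal g a x = normal_ideal g' a' x' -> [/\ g = g', a = a' & x = x'].
Proof.
move=> g0 xa g0' xa' E; apply: hermite_form_uniq => // u v.
by rewrite -!normal_idealP E.
Qed.

(** Both numbers are determinants of a basis of the same lattice with respect to 1, w, hence equal
    up to sign, and neither is negative. *)
Lemma lat_form_norm t z g a x : lat_valid t -> (0 < g)%N -> (x < a)%N ->
  0 <= lat_form t z ->
  coef_ideal t z = normal_ideal g a x -> lat_form t z = (g ^ 2 * a)%N%:Z.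
Proof.
move=> tv g0 xa Q0 E.
pose e11 := z.1 * (t.1 : nat)%:Z + z.2 * (t.2 : nat)%:Z + z.2.
pose e21 := z.1 * (t.2 : nat)%:Z + z.2 * (qnorm p t.2 %/ t.1)%N%:Z.
have QE : lat_form t z = e11 * z.1 - e21 * (- z.2).
  rewrite /lat_form /e11 /e21; have -> : ((t.2 : nat).*2.+1)%:Z = (t.2 : nat)%:Z * 2 + 1.
    by clear; lia.
  by ring.
have NE : (g ^ 2 * a)%N%:Z = (g%:Z * a%:Z) * g%:Z - (g%:Z * x%:Z) * 0.
  by rewrite -mulnn !PoszM; ring.
have n_in i j : normal_ideal g a x (emb (g%:Z * (i * a%:Z + j * x%:Z)) (g%:Z * j)).
  by apply/normal_idealP; exists i, j.
have c_in i j : coef_ideal t z (emb (i * e11 + j * e21) (i * (- z.2) + j * z.1)).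
  by apply/coef_idealP => //; exists i, j.
have d1 : (lat_form t z %| (g ^ 2 * a)%N%:Z)%Z.
  rewrite QE NE; apply: det_dvd_span; rewrite -coef_idealP // E.
    by have := n_in 1 0; congr (normal_ideal _ _ _ (emb _ _)); ring.
  by have := n_in 0 1; congr (normal_ideal _ _ _ (emb _ _)); ring.
have spanP s r : normal_ideal g a x (emb s r) -> exists i j : int,
    s = i * (g%:Z * a%:Z) + j * (g%:Z * x%:Z) /\ r = i * 0 + j * g%:Z.
  by move/normal_idealP => [i [j [-> ->]]]; exists i, j; split; ring.
have d2 : ((g ^ 2 * a)%N%:Z %| lat_form t z)%Z.
  rewrite QE NE; apply: det_dvd_span; apply: spanP; rewrite -E.
    by have := c_in 1 0; congr (coef_ideal _ _ (emb _ _)); ring.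
  by have := c_in 0 1; congr (coef_ideal _ _ (emb _ _)); ring.
rewrite -[LHS]gez0_abs //; congr Posz; apply/eqP; rewrite eqn_dvd.
by rewrite !dvdzE absz_nat in d1 d2; rewrite d1 d2.
Qed.

Lemma lat_form4 t z : lat_valid t -> 4 * (t.1 : nat)%:Z * lat_form t z =
  (2 * (t.1 : nat)%:Z * z.1 + ((t.2 : nat).*2.+1)%:Z * z.2) ^+ 2 + p%:Z * z.2 ^+ 2.
Proof.
move=> tv; have E := lat_cofactor tv.
have q4 : 4 * nform p (t.2 : nat)%:Z 1 = ((t.2 : nat).*2.+1)%:Z ^+ 2 + p%:Z.
  by rewrite nformE -PoszM qnorm4 // PoszD -mulnn PoszM.
rewrite /lat_form.
transitivity (4 * (t.1 : nat)%:Z ^+ 2 * z.1 ^+ 2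
   + 4 * (t.1 : nat)%:Z * ((t.2 : nat).*2.+1)%:Z * z.1 * z.2
   + (4 * ((qnorm p t.2 %/ t.1)%N%:Z * (t.1 : nat)%:Z)) * z.2 ^+ 2); first by ring.
by rewrite -E q4; ring.
Qed.

Lemma lat_form_ge0 t z : lat_valid t -> 0 <= lat_form t z.
Proof.
move=> tv; have a0 : 0 < 4 * (t.1 : nat)%:Z by have := lat_valid_gt0 tv; lia.
rewrite -(pmulr_rge0 _ a0) lat_form4 //.
by apply: addr_ge0; [exact: sqr_ge0|apply: mulr_ge0 => //; exact: sqr_ge0].
Qed.

Lemma coef_ideal_normal t z : lat_valid t -> 0 < lat_form t z ->
  exists g a x : nat, [/\ (0 < g)%N, (x < a)%N, (a %| qnorm p x)%N &
    coef_ideal t z = normal_ideal g a x].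
Proof.
move=> tv Q0; pose P s r := coef_ideal t z (emb s r).
have [|||g [a [x [g0 xa ax gP]]]] := @hermite_form p c0_gt0 P.
- move=> u v u' v' [y Ly yE] [y' Ly' yE']; exists (y - y'); first exact: lat_sub.
  by rewrite mulrBr yE yE' embB.
- move=> u v [y Ly yE]; exists (qgen p * y).
    apply: (lat_stable pp p3) Ly; first by case/andP: tv.
    by apply/(ring_of_integersE pp p3); exists 0, 1; rewrite qgenE.
  by rewrite mulrCA yE qgenE (embM p3); congr emb; ring.
- case: (eqVneq z.1 0) => z1; last first.
    exists (z.1 * (t.2 : nat)%:Z + z.2 * (qnorm p t.2 %/ t.1)%N%:Z), z.1.
    by rewrite z1 orbT; split=> //; apply/coef_idealP => //; exists 0, 1; split; ring.
  exists (z.1 * (t.1 : nat)%:Z + z.2 * (t.2 : nat)%:Z + z.2), (- z.2); split.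
    by apply/coef_idealP => //; exists 1, 0; split; ring.
  rewrite oppr_eq0 orbC; apply/orP; left; apply: contraTneq Q0 => z2.
  by rewrite /lat_form z1 z2 !expr0n /= !mulr0 !addr0.
exists g, a, x; split => //; apply/seteqP; split => y yI.
  have [s [r yE]] := coef_ideal_emb tv yI; rewrite yE in yI *.
  by apply/normal_idealP/gP.
have [s [r yE]] := normal_ideal_emb yI; rewrite yE in yI *.
by apply/gP/normal_idealP.
Qed.

Lemma lat_coef_neq0 t z : lat_valid t -> 0 < lat_form t z -> lat_coef t z != 0.
Proof.
move=> tv Q0; apply/eqP => c_0.
have [g [a [x [g0 xa ax E]]]] := coef_ideal_normal tv Q0.
have : normal_ideal g a x (g%:R * a%:R) by exists a%:R => //; apply: lat_gen1.
rewrite -E => -[y _]; rewrite c_0 mul0r => /esym/eqP.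
rewrite -natrM pnatr_eq0 muln_eq0 gtn_eqF //= gtn_eqF //.
exact: leq_ltn_trans xa.
Qed.

Lemma K_nat (n : nat) : K n%:R.
Proof. by have := K_int p n; rewrite -pmulrn. Qed.

Lemma K_lat_coef t z : K (lat_coef t z).
Proof. by apply: (K_mul p3); [exact: K_emb|apply: (K_inv pp p3 pn3); exact: K_nat]. Qed.

Lemma lat_coefN t z : lat_coef t (- z.1, - z.2) = - lat_coef t z.
Proof.
by rewrite /lat_coef /= -mulNr embN; congr (emb _ _ / _); ring.
Qed.

Lemma lat_coef_inj t z z' : lat_valid t -> lat_coef t z = lat_coef t z' -> z = z'.
Proof.
move=> tv; have a0 : (t.1 : nat)%:R != 0 :> algC.
  by rewrite pnatr_eq0 -lt0n lat_valid_gt0.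
have a0z : (t.1 : nat)%:Z != 0 by have := lat_valid_gt0 tv; lia.
move/(congr1 ( *%R^~ (t.1 : nat)%:R)); rewrite !divfK // => /(emb_inj pp)[+ /oppr_inj].
case: z z' => [u v] [u' v'] /= E vE; subst v'; congr pair.
by move: E => /addIr/addIr/(mulIf a0z).
Qed.

(** Equal ideals make the two lattices homothetic, so the representatives agree. The quotient of the
    coefficients then maps the lattice onto itself; it and its inverse are multipliers, hence
    integers, and a unit is 1 or -1. *)
Lemma coef_ideal_rep t t' z z' : t \in lat_reps p -> t' \in lat_reps p ->
  0 < lat_form t z -> 0 < lat_form t' z' -> coef_ideal t z = coef_ideal t' z' ->
  t = t' /\ (z' = z \/ z' = (- z.1, - z.2)).
Proof.
move=> tr tr' Q0 Q0' E; have tv := lat_reps_valid tr; have tv' := lat_reps_valid tr'.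
have n0 := lat_coef_neq0 tv Q0; have n0' := lat_coef_neq0 tv' Q0'.
have scal (c d : algC) (S S' : set algC) : d != 0 ->
    [set c * y | y in S] = [set d * y | y in S'] -> S' = [set d^-1 * c * y | y in S].
  by move=> d0 H; rewrite -scale_setM H scale_setM mulVf // scale_set1.
have tt : t = t'.
  apply: (lat_reps_inj pp p3 pn3) => //; exists ((lat_coef t' z')^-1 * lat_coef t z).
  split; last exact: scal.
    by apply: (K_mul p3); [apply: (K_inv pp p3 pn3)|]; exact: K_lat_coef.
  by rewrite mulf_neq0 ?invr_eq0.
subst t'; split => //.
set c := lat_coef t z in n0; set c' := lat_coef t z' in n0'.
have mult (d d' : algC) : d' != 0 -> [set d * y | y in lat t.1 t.2] = [set d' * y | y in lat t.1 t.2] ->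
    O (d'^-1 * d).
  move=> d0 H; have a0 := lat_valid_gt0 tv; case/andP: tv => _ ax.
  apply: (lat_multiplier pp p3 a0 ax) => y Ly.
  by rewrite [lat t.1 t.2 in X in X _](scal _ _ _ _ d0 H); exists y.
have Oe : O (c'^-1 * c) by apply: mult.
have Oe' : O (c'^-1 * c)^-1 by rewrite invfM invrK mulrC; apply: mult.
have e0 : c'^-1 * c != 0 by rewrite mulf_neq0 ?invr_eq0.
case: (unit_integer pp p3 pn3 e0 Oe Oe') => e1.
  left; apply: (lat_coef_inj tv); rewrite -/c -/c'.
  by apply: (mulfI (invr_neq0 n0')); rewrite e1 mulVf.
right; apply: (lat_coef_inj tv); rewrite lat_coefN -/c -/c'.
by apply: (mulfI (invr_neq0 n0')); rewrite mulVf // mulrN e1 opprK.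
Qed.

Lemma normal_ideal_coef g a x : (0 < g)%N -> (x < a)%N -> (a %| qnorm p x)%N ->
  exists t z, t \in lat_reps p /\ coef_ideal t z = normal_ideal g a x.
Proof.
move=> g0 xa ax; have [t tr te] := lat_reps_ex pp p3 pn3 xa ax.
have [c [Kc c_0 cE]] := lat_equiv_sym pp p3 pn3 te.
have tv := lat_reps_valid tr.
have IE : normal_ideal g a x = [set g%:R * c * y | y in lat t.1 t.2].
  by rewrite -scale_setM -cE.
have a0 : (t.1 : nat)%:R != 0 :> algC by rewrite pnatr_eq0 -lt0n lat_valid_gt0.
have in_I y : lat t.1 t.2 y -> exists s r, g%:R * c * y = emb s r.
  by move=> Ly; apply: (@normal_ideal_emb g a x); rewrite IE; exists y.
have [p1 [p2 E1]] := in_I _ (lat_gen1 p t.1 t.2).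
have [q1 [q2 E2]] := in_I _ (lat_gen2 p t.1 t.2).
have E3 : emb p1 p2 * emb (t.2 : nat)%:Z 1 = (t.1 : nat)%:Z%:~R * emb q1 q2.
  by rewrite -E1 -E2 -pmulrn; ring.
move: E3; rewrite (embM p3) embZ => /(emb_inj pp)[_ F].
(* With d = g c, d a = p1 + p2 w and d (x + w) = q1 + q2 w, comparing the coefficients of w in (d
   a)(x + w) = a (d (x + w)) gives p1 = a q2 - p2 x - p2, which is the shape required of d a. *)
exists t, (q2, - p2); split => //; rewrite IE; congr image; apply: funext => y.
congr (_ * _); apply: (mulIf a0); rewrite /lat_coef divfK // E1 /= opprK; congr emb.
transitivity ((t.1 : nat)%:Z * q2 - p2 * (t.2 : nat)%:Z - p2); first by ring.
by rewrite -F; ring.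
Qed.

Definition normal_pairs (m : nat) : seq (nat * nat) :=
  [seq gx <- [seq (g, x) | g <- iota 1 m, x <- iota 0 m] |
    [&& (gx.1 ^ 2 %| m)%N, (gx.2 < m %/ gx.1 ^ 2)%N & (m %/ gx.1 ^ 2 %| qnorm p gx.2)%N]].

Lemma normal_pairs_uniq m : uniq (normal_pairs m).
Proof.
rewrite filter_uniq // allpairs_uniq ?iota_uniq //.
by move=> [a b] [c d] _ _ [-> ->].
Qed.

Lemma normal_pairsP m g x : (0 < m)%N -> (g, x) \in normal_pairs m <->
  [/\ (0 < g)%N, (g ^ 2 %| m)%N, (x < m %/ g ^ 2)%N & (m %/ g ^ 2 %| qnorm p x)%N].
Proof.
move=> m0; rewrite mem_filter /=; split.
  move=> /andP[/and3P[gm xa ax] /allpairsP[[g' x'] /= [+ _ [gE _]]]].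
  by rewrite -gE mem_iota => /andP[].
move=> [g0 gm xa ax]; rewrite gm xa ax /=; apply/allpairsP; exists (g, x).
rewrite !mem_iota g0 /= add0n add1n ltnS; split=> //.
  by apply: leq_trans (dvdn_leq m0 gm); rewrite -mulnn leq_pmulr.
exact: leq_trans xa (leq_div _ _).
Qed.

Lemma size_normal_pairs m : size (normal_pairs m) = ideal_count p m.
Proof.
rewrite size_filter -sum1_count big_mkcond big_allpairs_dep /=.
rewrite /ideal_count /index_iota subSS subn0 [RHS]big_mkcond /=; apply: eq_bigr => g _.
rewrite -big_mkcond; case: ifP => gm; last by rewrite big_pred0.
rewrite /=.
rewrite /qroots -sum1_card (eq_bigl (fun x : 'I_(m %/ g ^ 2) => m %/ g ^ 2 %| qnorm p x)%N); last first.
  by move=> x; rewrite inE.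
rewrite -(big_mkord (fun x => m %/ g ^ 2 %| qnorm p x)%N (fun=> 1%N)).
have -> : iota 0 m = index_iota 0 m by rewrite /index_iota subn0.
rewrite (@big_cat_nat _ _ _ (m %/ g ^ 2)) //=; last exact: leq_div.
rewrite [X in (_ + X)%N]big1_seq ?addn0; last first.
  by move=> x /andP[/andP[xa _]]; rewrite mem_index_iota leqNgt xa.
rewrite big_nat_cond [RHS]big_nat_cond; apply: eq_bigl => x.
by rewrite leq0n /=; case: ltnP.
Qed.

(** Double counting of incidences between vectors representing m and ideals of norm m: each vector
    generates one ideal, and each ideal belongs to a single form and to exactly two vectors z and
    -z. The windows [W] only make the set of vectors finite. *)
Theorem lat_form_count m (W : idx -> seq (int * int)) : (0 < m)%N ->
  (forall t, uniq (W t)) ->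
  (forall t z, t \in lat_reps p -> lat_form t z = m%:Z -> z \in W t) ->
  (\sum_(t in lat_reps p) count (fun z => lat_form t z == m%:Z) (W t)
   = 2 * ideal_count p m)%N.
Proof.
move=> m0 Wu Wm; pose R t z (gx : nat * nat) : bool :=
  `[< coef_ideal t z = normal_ideal gx.1 (m %/ gx.1 ^ 2) gx.2 >].
have mz : 0 < m%:Z by rewrite ltz_nat.
have R1 t z : t \in lat_reps p -> lat_form t z == m%:Z ->
    count (R t z) (normal_pairs m) = 1%N.
  move=> tr /eqP Qm; have tv := lat_reps_valid tr.
  have Q0 : 0 < lat_form t z by rewrite Qm.
  have [g [a [x [g0 xa ax E]]]] := coef_ideal_normal tv Q0.
  have := lat_form_norm tv g0 xa (ltW Q0) E; rewrite Qm => -[mE].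
  have aE : (m %/ g ^ 2 = a)%N by rewrite mE mulKn // expn_gt0 g0.
  have gxm : (g, x) \in normal_pairs m.
    by apply/normal_pairsP => //; rewrite aE; split=> //; rewrite mE dvdn_mulr.
  rewrite (@eq_in_count _ _ (pred1 (g, x))) => [|[g' x'] gxm'].
    by rewrite count_uniq_mem ?normal_pairs_uniq // gxm.
  apply/asboolP/eqP => [|[-> ->]] /=; last by rewrite aE.
  have [g0' gm' xa' _] := iffLR (normal_pairsP _ _ m0) gxm'.
  by rewrite /= E => /(normal_ideal_uniq g0 xa g0' xa')[-> _ ->].
have R2 gx : gx \in normal_pairs m ->
    (\sum_(t in lat_reps p) \sum_(z <- W t | lat_form t z == m%:Z) R t z gx = 2)%N.
  case: gx => g x gxm; have [g0 gm xa ax] := iffLR (normal_pairsP _ _ m0) gxm.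
  have [t [z [tr E]]] := normal_ideal_coef g0 xa ax.
  have tv := lat_reps_valid tr.
  have Qm : lat_form t z = m%:Z.
    by rewrite (lat_form_norm tv g0 xa (lat_form_ge0 z tv) E) mulnC divnK.
  have Q0 : 0 < lat_form t z by rewrite Qm.
  pose z' := (- z.1, - z.2).
  have Qm' : lat_form t z' = m%:Z by rewrite -Qm /lat_form /=; ring.
  have zz' : z != z'.
    apply/eqP => /(congr1 (fun y : int * int => (y.1 + y.1, y.2 + y.2))) /=.
    move=> [h1 h2]; have [z1 z2] : z.1 = 0 /\ z.2 = 0 by move: h1 h2; clear; lia.
    by move: Q0; rewrite /lat_form z1 z2 !expr0n /= !mulr0 !addr0.
  have E' : coef_ideal t z' = coef_ideal t z.
    rewrite /coef_ideal lat_coefN; apply/seteqP; split => [_ [y Ly <-]|_ [y Ly <-]];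
      exists (- y); rewrite ?mulrN ?mulNr ?opprK //;
      by rewrite -sub0r; apply: lat_sub => //; rewrite -(subrr y); apply: lat_sub.
  rewrite (bigD1 t) //= [X in (_ + X)%N]big1 ?addn0; last first.
    move=> t' /andP[tr' tt']; rewrite big1 // => z1 /eqP Q1.
    rewrite /R; case: asboolP => // E1; case/eqP: tt'.
    have Q10 : 0 < lat_form t' z1 by rewrite Q1.
    have E2 : coef_ideal t z = coef_ideal t' z1 by rewrite E E1.
    by have [] := coef_ideal_rep tr tr' Q0 Q10 E2.
  rewrite -big_mkcondr -big_filter -/(index_enum _).
  rewrite (perm_big [:: z; z']) /=; first by rewrite big_cons big_seq1.
  apply: uniq_perm; rewrite ?filter_uniq //= ?inE ?andbT // => z1.
  rewrite mem_filter !inE; apply/andP/orP => [[/andP[/eqP Q1 /asboolP E1] _]|].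
    have Q10 : 0 < lat_form t z1 by rewrite Q1.
    have E2 : coef_ideal t z = coef_ideal t z1 by rewrite E E1.
    by have [_ [->|->]] := coef_ideal_rep tr tr Q0 Q10 E2; rewrite eqxx; [left|right].
  case=> /eqP ->; split; rewrite ?Wm ?Qm ?Qm' ?eqxx //=; apply/asboolP => //.
  by rewrite E'.
transitivity (\sum_(t in lat_reps p) \sum_(z <- W t | lat_form t z == m%:Z)
   \sum_(gx <- normal_pairs m) R t z gx)%N.
  apply: eq_bigr => t tr; rewrite -sum1_count; apply: eq_bigr => z zm.
  by rewrite -[LHS](R1 t z tr zm) -sum1_count big_mkcond.
rewrite (eq_bigr (fun t => \sum_(gx <- normal_pairs m)
    \sum_(z <- W t | lat_form t z == m%:Z) R t z gx)%N); last first.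
  by move=> t _; rewrite exchange_big.
rewrite exchange_big /= big_seq (eq_bigr (fun=> 2%N)) //.
by rewrite -big_seq big_const_seq count_predT iter_addn_0 size_normal_pairs.
Qed.

End RepresentationCount.

Local Close Scope classical_set_scope.

(** * Alternating Gaussian sums *)

Section AbelSummation.
Variable R : realFieldType.
Implicit Types (chi f d : nat -> R).

Lemma abel_summation chi f N :
  \sum_(k < N) chi k * f k =
  (\sum_(k < N) chi k) * f N + \sum_(k < N) (\sum_(i < k.+1) chi i) * (f k - f k.+1).
Proof.
elim: N => [|N IH]; first by rewrite !big_ord0 mul0r addr0.
rewrite big_ord_recr /= IH [X in _ = _ + X]big_ord_recr /= [X in _ = X * _ + _]big_ord_recr /=.
rewrite [X in _ = _ + (_ + X * _)]big_ord_recr /=.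
by move: (\sum_(k < N) chi k) (\sum_(k < N) _ * _) => a b; ring.
Qed.

Definition adiff d k : R := `|(d k - d k.+1 : R)|.

Lemma adiff_le d k : d k <= d k.+1 -> adiff d k = d k.+1 - d k.
Proof. by move=> h; rewrite /adiff distrC ger0_norm ?subr_ge0. Qed.

Lemma adiff_ge d k : d k.+1 <= d k -> adiff d k = d k - d k.+1.
Proof. by move=> h; rewrite /adiff ger0_norm ?subr_ge0. Qed.

(** After its first descent the sequence only descends, so within [0, m] it rises by at most m and
    falls by at most m. *)
Lemma unimodal_variation d (m : R) N : (forall k, 0 <= d k <= m) ->
  (forall k, d k.+1 <= d k -> d k.+2 <= d k.+1) ->
  \sum_(k < N) adiff d k <= 2 * m.
Proof.
move=> dm du; have m0 : 0 <= m by have /andP[] := dm 0%N; apply: le_trans.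
have dp k : 0 <= d k by case/andP: (dm k).
have dl k : d k <= m by case/andP: (dm k).
pose W n : R := \sum_(k < n) adiff d k.
have WS n : W n.+1 = W n + adiff d n by rewrite /W big_ord_recr.
(* The two phases: while rising, the variation is at most the current value; afterwards, it is at
   most 2 m minus that value. *)
rewrite -/(W N); suff : W N <= d N \/ d N.+1 <= d N /\ W N <= 2 * m - d N.
  by case=> [|[_]]; have := dp N; have := dl N; lra.
have W0 : W 0%N = 0 by rewrite /W big_ord0.
clearbody W; elim: N => [|N IH]; first by left; rewrite W0.
rewrite WS; case: IH => [V1|[dN V2]].
  have [le|lt] := leP (d N) (d N.+1).
    by left; rewrite adiff_le //; lra.
  right; split; first exact/du/ltW.
  by rewrite (adiff_ge (ltW lt)); have := dl N; lra.
right; split; first exact: du.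
by rewrite adiff_ge //; lra.
Qed.

Lemma abel_bound chi f (s B m : R) N :
  (forall n, `|\sum_(k < n) chi k| <= B) ->
  (forall n, `|\sum_(k < n) (\sum_(i < k.+1) chi i - s)| <= B) ->
  (forall k, 0 <= f k) -> (forall k, 0 <= f k - f k.+1 <= m) ->
  (forall k, f k.+1 - f k.+2 <= f k - f k.+1 -> f k.+2 - f k.+3 <= f k.+1 - f k.+2) ->
  `|\sum_(k < N) chi k * f k - s * f 0%N| <= (B + `|s|) * f N + 3 * B * m.
Proof.
move=> S1 S2 f0 fd fu; pose d k := f k - f k.+1.
have B0 : 0 <= B by apply: le_trans (S1 0%N); rewrite big_ord0 normr0.
have V := unimodal_variation N fd fu.
have tele : \sum_(k < N) d k = f 0%N - f N.
  rewrite -(big_mkord xpredT d); elim: (N) => [|n IH]; first by rewrite big_geq // subrr.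
  by rewrite big_nat_recr //= IH /d; ring.
have E : \sum_(k < N) chi k * f k - s * f 0%N =
   (\sum_(k < N) chi k) * f N - s * f N
   + ((\sum_(k < N) (\sum_(i < k.+1) chi i - s)) * d N
   + \sum_(k < N) (\sum_(j < k.+1) (\sum_(i < j.+1) chi i - s)) * (d k - d k.+1)).
  rewrite -(abel_summation (fun k => \sum_(i < k.+1) chi i - s) d) abel_summation.
  under [X in _ = _ + X]eq_bigr do rewrite mulrBl.
  by rewrite sumrB -mulr_sumr tele; ring.
rewrite E.
have h1 : `|(\sum_(k < N) chi k) * f N - s * f N| <= (B + `|s|) * f N.
  rewrite -mulrBl normrM (ger0_norm (f0 N)) ler_wpM2r //.
  by apply: le_trans (ler_normB _ _) _; rewrite lerD2r.
have h2 : `|(\sum_(k < N) (\sum_(i < k.+1) chi i - s)) * d N| <= B * m.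
  rewrite normrM; have /andP[d0 dm] := fd N; rewrite (ger0_norm d0).
  by apply: ler_pM.
have h3 : `|\sum_(k < N) (\sum_(j < k.+1) (\sum_(i < j.+1) chi i - s)) * (d k - d k.+1)| <= B * (2 * m).
  apply: le_trans (ler_norm_sum _ _ _) _; apply: le_trans (ler_wpM2l B0 V).
  rewrite mulr_sumr; apply: ler_sum => k _; rewrite normrM ler_wpM2r //.
have := ler_normD ((\sum_(k < N) chi k) * f N - s * f N)
   ((\sum_(k < N) (\sum_(i < k.+1) chi i - s)) * d N
   + \sum_(k < N) (\sum_(j < k.+1) (\sum_(i < j.+1) chi i - s)) * (d k - d k.+1)).
have := ler_normD ((\sum_(k < N) (\sum_(i < k.+1) chi i - s)) * d N)
   (\sum_(k < N) (\sum_(j < k.+1) (\sum_(i < j.+1) chi i - s)) * (d k - d k.+1)).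
by lra.
Qed.

Lemma alternating_bound f N : (forall k, 0 <= f k) -> (forall k, f k.+1 <= f k) ->
  0 <= \sum_(k < N) (-1) ^+ k * f k <= f 0%N.
Proof.
move=> f0 fd.
pose W n : R := \sum_(k < n) (-1) ^+ k * f k.
have WS n : W n.+1 = W n + (-1) ^+ n * f n by rewrite /W big_ord_recr.
(* The induction has to know that the next term, whose sign depends on the parity of N, cannot
   overshoot. *)
rewrite -/(W N); suff : 0 <= W N <= f 0%N /\
  (if odd N then f N <= W N else W N <= f 0%N - f N) by case.
have W0 : W 0%N = 0 by rewrite /W big_ord0.
clearbody W; elim: N => [|N [IH1 IH2]]; first by rewrite W0 /= lexx f0 subrr.
rewrite WS /= -signr_odd; case/andP: IH1 => V0 V1; move: IH2.
have := f0 N; have := fd N; have := f0 N.+1; case: odd => /= h1 h2 h3 h4.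
  by rewrite expr1; split; [apply/andP; split|]; lra.
by rewrite expr0; split; [apply/andP; split|]; lra.
Qed.

Lemma bernoulli_sub (z : R) n : 0 <= z <= 1 -> 1 - z ^+ n <= n%:R * (1 - z).
Proof.
move=> /andP[z0 z1]; elim: n => [|n IH]; first by rewrite expr0 subrr mul0r.
rewrite -natr1 exprS; have := exprn_ge0 n z0; have := exprn_ile1 n z0 z1.
move: (z ^+ n) (n%:R) IH => y t; nra.
Qed.

Lemma pow_mul_le1 (z : R) n : 0 <= z <= 1 -> z ^+ n * (1 + n%:R * (1 - z)) <= 1.
Proof.
move=> /andP[z0 z1]; elim: n => [|n IH]; first by rewrite expr0 mul0r addr0 mulr1.
have := exprn_ge0 n z0; rewrite exprS -natr1; have : 0 <= n%:R :> R by [].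
move: (z ^+ n) (n%:R) IH => y t h1 t0 y0.
have h2 : z * (1 + (t + 1) * (1 - z)) <= 1 + t * (1 - z).
  rewrite -subr_ge0; have -> : 1 + t * (1 - z) - z * (1 + (t + 1) * (1 - z)) = (t + 1) * (1 - z) ^+ 2.
    by ring.
  by rewrite mulr_ge0 ?sqr_ge0 // addr_ge0.
by rewrite -mulrA mulrCA; apply: le_trans h1; apply: ler_wpM2l.
Qed.

End AbelSummation.

Section GaussianSums.
Variables (R : realFieldType) (z tau : R).
Hypothesis (z0 : 0 < z) (z1 : z <= 1) (tau0 : 0 <= tau) (tau1 : tau <= 1).
Hypothesis ztau : 1 - z <= tau ^+ 2.

Let z01 : 0 <= z <= 1. Proof. by rewrite ltW. Qed.

Lemma pow_le1 n : z ^+ n <= 1. Proof. by rewrite exprn_ile1 // ltW. Qed.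
Lemma pow_gt0 n : 0 < z ^+ n. Proof. exact: exprn_gt0. Qed.
Lemma pow_le m n : (m <= n)%N -> z ^+ n <= z ^+ m.
Proof. by move=> mn; rewrite ler_wiXn2l // ltW. Qed.

(** [tau] stands in for the square root of 1 - z. This is the bound of order 1/sqrt(eps) on x
    exp(-eps x^2), obtained from (tau x - 1)^2 >= 0 and [pow_mul_le1]; if tau = 0 then z = 1. *)
Lemma linear_gaussian_le (x : nat) : x%:R * (1 - z) * z ^+ (x ^ 2) * 2 <= tau.
Proof.
have h := pow_mul_le1 (x ^ 2) z01; have y0 := ltW (pow_gt0 (x ^ 2)).
move: h; rewrite natrX; move: (z ^+ _) (x%:R : R) y0 => y t y0 h.
have e0 : 0 <= 1 - z by rewrite subr_ge0.
have [tp|] := ltP 0 tau; last first.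
  move=> t0; have -> : 1 - z = 0 by have t00 : tau = 0; [apply/eqP; rewrite eq_le t0 tau0|
      apply/eqP; rewrite eq_le e0 andbT; move: ztau; rewrite t00 expr2 mul0r].
  by rewrite mulr0 !mul0r.
have key : 2 * t * (1 - z) <= tau * (1 + t ^+ 2 * (1 - z)).
  rewrite -(ler_pM2l tp) -subr_ge0.
  have -> : tau * (tau * (1 + t ^+ 2 * (1 - z))) - tau * (2 * t * (1 - z))
     = (1 - z) * (tau * t - 1) ^+ 2 + (tau ^+ 2 - (1 - z)) by ring.
  by rewrite addr_ge0 ?subr_ge0 // mulr_ge0 ?sqr_ge0.
have := ler_wpM2l y0 key; have := ler_wpM2l tau0 h.
have -> : tau * (y * (1 + t ^+ 2 * (1 - z))) = y * (tau * (1 + t ^+ 2 * (1 - z))) by ring.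
have -> : t * (1 - z) * y * 2 = y * (2 * t * (1 - z)) by ring.
by rewrite mulr1 => h1 h2; apply: le_trans h2 h1.
Qed.

Lemma gaussian_diff (x L : nat) : (0 < L)%N ->
  0 <= z ^+ (x ^ 2) - z ^+ ((x + L) ^ 2) <= 2 * (L ^ 2)%:R * tau.
Proof.
move=> L0; have -> : ((x + L) ^ 2 = x ^ 2 + (2 * x * L + L ^ 2))%N by nia.
rewrite exprD; have y1 := pow_le1 (x ^ 2); have y0 := ltW (pow_gt0 (x ^ 2)).
have h := linear_gaussian_le x; have b := bernoulli_sub (2 * x * L + L ^ 2) z01.
have w1 := pow_le1 (2 * x * L + L ^ 2).
have e0 : 0 <= 1 - z by rewrite subr_ge0.
have L1 : 1 <= L%:R :> R by rewrite ler1n.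
move: b; rewrite natrX natrD natrX 2!natrM; 
set y : R := z ^+ (x ^ 2) in y1 y0 h *; set w : R := z ^+ (2 * x * L + L ^ 2) in w1 *; move=> b.
have -> : y - y * w = y * (1 - w) by ring.
apply/andP; split.
  by rewrite mulr_ge0 // subr_ge0.
apply: le_trans (ler_wpM2l y0 b) _.
have -> : y * ((2 * x%:R * L%:R + L%:R ^+ 2) * (1 - z)) =
  L%:R * (x%:R * (1 - z) * y * 2) + L%:R ^+ 2 * (y * (1 - z)) by ring.
have h1 : L%:R * (x%:R * (1 - z) * y * 2) <= L%:R ^+ 2 * tau.
  apply: (@le_trans _ _ (L%:R * tau)); first by rewrite ler_wpM2l // ltW // ltr0n.
  by rewrite ler_wpM2r // expr2 ler_peMr // ler0n.
have h2 : L%:R ^+ 2 * (y * (1 - z)) <= L%:R ^+ 2 * tau.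
  rewrite ler_wpM2l ?sqr_ge0 //; apply: (@le_trans _ _ (1 * tau ^+ 2)).
    by apply: ler_pM.
  by rewrite mul1r expr2 ler_piMr.
by have := lerD h1 h2; have -> : 2 * L%:R ^+ 2 * tau = L%:R ^+ 2 * tau + L%:R ^+ 2 * tau by ring.
Qed.

(** The second difference at y is z^(y^2) (1 - 2 k w + k^4 w^2) with k = z^(L^2) and w = z^(2 y L).
    The bracket decreases in w on [0, 1] and w decreases in y, so once nonnegative it stays so. *)
Lemma gaussian_unimodal (L x : nat) :
  z ^+ ((x + L) ^ 2) - z ^+ ((x + L + L) ^ 2) <= z ^+ (x ^ 2) - z ^+ ((x + L) ^ 2) ->
  z ^+ ((x + L + L) ^ 2) - z ^+ ((x + L + L + L) ^ 2)
    <= z ^+ ((x + L) ^ 2) - z ^+ ((x + L + L) ^ 2).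
Proof.
pose k := z ^+ (L ^ 2); pose w x := z ^+ (2 * x * L).
have E (y : nat) : z ^+ (y ^ 2) - z ^+ ((y + L) ^ 2) - (z ^+ ((y + L) ^ 2) - z ^+ ((y + L + L) ^ 2))
   = z ^+ (y ^ 2) * (1 - 2 * k * w y + k ^+ 4 * w y ^+ 2).
  have -> : ((y + L) ^ 2 = y ^ 2 + L ^ 2 + 2 * y * L)%N by nia.
  have -> : ((y + L + L) ^ 2 = y ^ 2 + L ^ 2 * 4 + 2 * y * L * 2)%N by nia.
  by rewrite !exprD (exprM _ (L ^ 2) 4) (exprM _ (2 * y * L) 2) -/k -/(w y); ring.
have phi (y : nat) : (z ^+ ((y + L) ^ 2) - z ^+ ((y + L + L) ^ 2) <= z ^+ (y ^ 2) - z ^+ ((y + L) ^ 2))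
   = (0 <= 1 - 2 * k * w y + k ^+ 4 * w y ^+ 2).
  by rewrite -subr_ge0 E pmulr_rge0 // pow_gt0.
rewrite !phi; have ww : w (x + L)%N = w x * k ^+ 2.
  by rewrite /w /k -exprM -exprD; congr (_ ^+ _); nia.
have k0 : 0 <= k by rewrite ltW ?pow_gt0.
have k1 : k <= 1 by apply: pow_le1.
have w0 : 0 <= w x by rewrite ltW ?pow_gt0.
have w1 : w x <= 1 by apply: pow_le1.
have w2 : w (x + L)%N <= w x by rewrite ww ler_piMr // exprn_ile1.
have w3 : 0 <= w (x + L)%N by rewrite ltW ?pow_gt0.
move: (w x) (w (x + L)%N) w0 w1 w2 w3 => a b a0 a1 ba b0 h; clear ww.
have k4 : k ^+ 4 <= k by rewrite -{2}[k]expr1 ler_wiXn2l.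
have k40 : 0 <= k ^+ 4 by apply: exprn_ge0.
have c1 : k ^+ 4 * (a + b) <= k * 2.
  apply: ler_pM => //; first exact: addr_ge0.
  exact: lerD a1 (le_trans ba a1).
have c2 : 0 <= (a - b) * (2 * k - k ^+ 4 * (a + b)).
  by apply: mulr_ge0; [rewrite subr_ge0|rewrite subr_ge0 [2 * k]mulrC].
have -> : 1 - 2 * k * b + k ^+ 4 * b ^+ 2 = (1 - 2 * k * a + k ^+ 4 * a ^+ 2)
   + (a - b) * (2 * k - k ^+ 4 * (a + b)) by ring.
exact: addr_ge0.
Qed.

Lemma sum_alternating n : \sum_(k < n) (-1) ^+ k = (odd n)%:R :> R.
Proof.
elim: n => [|n IH]; first by rewrite big_ord0.
rewrite big_ord_recr /= IH -signr_odd; case: odd; rewrite /= ?expr1 ?expr0 ?subrr ?add0r //.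
Qed.

(** [abel_bound] for the signs (-1)^k, whose partial sums 1, 0, 1, 0, ... have mean 1/2 and bound B
    = 1, with m = 2 L^2 tau from [gaussian_diff]. *)
Lemma gaussian_alternating (L r N : nat) : (0 < L)%N ->
  `|\sum_(k < N) (-1) ^+ k * z ^+ ((L * k + r) ^ 2) - 2^-1 * z ^+ (r ^ 2)|
    <= 2 * z ^+ N + 6 * (L ^ 2)%:R * tau.
Proof.
move=> L0; pose f k := z ^+ ((L * k + r) ^ 2).
have fS k : f k.+1 = z ^+ ((L * k + r + L) ^ 2).
  by rewrite /f mulnS -addnA addnC.
have := @abel_bound R (fun k => (-1) ^+ k) f 2^-1 1 (2 * (L ^ 2)%:R * tau) N.
have -> : f 0%N = z ^+ (r ^ 2) by rewrite /f muln0 add0n.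
have h2 : 0 <= (2^-1 : R) <= 1 by rewrite invr_ge0 ler0n invf_le1 ?ltr0n // ler1n.
move=> /(_ _ _ _ _ _)/le_trans; apply.
- by move=> n; rewrite sum_alternating; case: odd; rewrite ?normr1 ?normr0.
- move=> n.
  have -> : \sum_(k < n) (\sum_(i < k.+1) (-1) ^+ i - 2^-1) = 2^-1 * (odd n)%:R :> R.
    elim: n => [|n IH]; first by rewrite big_ord0 mulr0.
    by rewrite big_ord_recr /= IH sum_alternating /=; case: odd => /=; lra.
  by case: odd; rewrite ?mulr1 ?mulr0 ?normr0 // ger0_norm; case/andP: h2.
- by move=> k; rewrite ltW ?pow_gt0.
- by move=> k; rewrite fS; apply: gaussian_diff.
- move=> k; rewrite !fS mulnS -[(L + _ + r)%N]addnA [(L + (L * k + r))%N]addnC.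
  by rewrite [(L * k.+2)%N]mulnS [(L * k.+1)%N]mulnS (_ : L + (L + L * k) + r = L * k + r + L + L)%N; [apply: gaussian_unimodal|lia].
have fN : f N <= z ^+ N.
  apply: pow_le; apply: (@leq_trans (N ^ 2)); first by rewrite -mulnn; case: N => // n; rewrite leq_pmulr.
  by rewrite leq_exp2r // (leq_trans _ (leq_addr _ _)) // leq_pmull.
have f0 : 0 <= f N by rewrite ltW ?pow_gt0.
rewrite ger0_norm; last by case/andP: h2.
have := tau0; lra.
Qed.

(** The sum of (-1)^k z^((L k + r)^2) over -N <= k < N; the subtracted part is that of k = -1 - i.
    Both halves are close to 1/2, so they nearly cancel. *)
Definition alt_gauss (L r N : nat) : R :=
  \sum_(k < N) (-1) ^+ k * z ^+ ((L * k + r) ^ 2)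
  - \sum_(k < N) (-1) ^+ k * z ^+ ((L * k + (L - r)) ^ 2).

Lemma alt_gauss_small (L r N : nat) : (0 < L)%N -> (r <= L)%N ->
  `|alt_gauss L r N| <= 4 * z ^+ N + 13 * (L ^ 2)%:R * tau.
Proof.
move=> L0 rL; rewrite /alt_gauss.
have h1 := gaussian_alternating r N L0; have h2 := gaussian_alternating (L - r) N L0.
have L2 k : (k <= L)%N -> 0 <= 1 - z ^+ (k ^ 2) <= (L ^ 2)%:R * tau.
  move=> kL; rewrite subr_ge0 pow_le1 /=; apply: le_trans (bernoulli_sub _ z01) _.
  apply: ler_pM => //; rewrite ?ler_nat ?leq_exp2r // ?subr_ge0 //.
  by apply: le_trans ztau _; rewrite expr2 ler_piMr.
have h3 := L2 _ rL; have h4 := L2 _ (leq_subr r L).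
move: h1 h2; set A : R := \sum_(k < N) _; set B : R := \sum_(k < N) _.
clearbody A B; rewrite !ler_norml; move/andP: h3 => [h3 h3']; move/andP: h4 => [h4 h4'].
move=> /andP[h1 h1'] /andP[h2 h2'].
have y0 := pow_gt0 N; have t0 : 0 <= (L ^ 2)%:R * tau by rewrite mulr_ge0.
by apply/andP; split; lra.
Qed.

Lemma alt_gauss_le1 (L r N : nat) : `|alt_gauss L r N| <= 1.
Proof.
have h r' : 0 <= \sum_(k < N) (-1) ^+ k * z ^+ ((L * k + r') ^ 2) <= 1.
  have dec k : z ^+ ((L * k.+1 + r') ^ 2) <= z ^+ ((L * k + r') ^ 2).
    by apply: pow_le; rewrite leq_exp2r // leq_add2r leq_mul2l leqnSn orbT.
  have pos k : 0 <= z ^+ ((L * k + r') ^ 2) by rewrite ltW ?pow_gt0.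
  have /andP[a b] := alternating_bound N pos dec.
  by rewrite a /=; apply: le_trans b (pow_le1 _).
have /andP[a b] := h r; have /andP[c d] := h (L - r)%N.
rewrite /alt_gauss ler_norml; move: a b c d.
set A : R := \sum_(k < N) _; set B : R := \sum_(k < N) _; clearbody A B => a b c d.
by apply/andP; split; lra.
Qed.

End GaussianSums.

(** * Lattice sums of binary quadratic forms *)

Definition int_box (N : nat) : seq int :=
  [seq i%:Z | i <- iota 0 N] ++ [seq - (i.+1)%:Z | i <- iota 0 N].

Lemma mem_int_box N (k : int) : (k \in int_box N) = (- N%:Z <= k < N%:Z).
Proof.
rewrite mem_cat; apply/orP/idP => [[|] /mapP[i]|].
- by rewrite mem_iota => /= iN ->; lia.
- by rewrite mem_iota => /= iN ->; lia.
case: k => k kN; [left|right]; apply/mapP; exists k => //; rewrite ?mem_iota ?NegzE //; lia.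
Qed.

Lemma int_box_uniq N : uniq (int_box N).
Proof.
rewrite cat_uniq !map_inj_uniq ?iota_uniq //=; try by move=> i j; lia.
rewrite andbT; apply/hasPn => x /mapP[i _ ->]; apply/mapP => -[j _]; lia.
Qed.

Lemma size_int_box N : size (int_box N) = N.*2.
Proof. by rewrite size_cat !size_map size_iota addnn. Qed.

Section LatticeSum.
Variables (R : realFieldType) (z tau : R).
Hypothesis (z0 : 0 < z) (z1 : z <= 1) (tau0 : 0 <= tau) (tau1 : tau <= 1).
Hypothesis ztau : 1 - z <= tau ^+ 2.
Variables (p A C b : nat).
Hypothesis (p0 : (0 < p)%N) (A0 : (0 < A)%N) (ob : odd b) (disc : (4 * A * C = b ^ 2 + p)%N).

Definition isign (k : int) : R := (-1) ^+ `|k|%N.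

Lemma isignD k l : isign (k + l) = isign k * isign l.
Proof.
rewrite /isign -exprD -signr_odd -[RHS]signr_odd; congr (_ ^+ nat_of_bool _).
by clear; lia.
Qed.

Lemma isignM_odd k l : odd `|k|%N -> isign (k * l) = isign l.
Proof. by move=> ok; rewrite /isign abszM -signr_odd oddM ok signr_odd. Qed.

Lemma isignN k : isign (- k) = isign k.
Proof. by rewrite /isign abszN. Qed.

Lemma norm_isign k : `|isign k| = 1.
Proof. by rewrite /isign normrX normrN1 expr1n. Qed.

Definition sqpow (y : R) (k : int) : R := y ^+ (`|k| ^ 2)%N.

Lemma sum_int_box_gauss (y : R) (L r N : nat) : (r <= L)%N ->
  \sum_(k <- int_box N) isign k * sqpow y (L%:Z * k + r%:Z) = alt_gauss y L r N.
Proof.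
move=> rL; have -> : int_box N = [seq i%:Z | i <- index_iota 0 N] ++ [seq - (i.+1)%:Z | i <- index_iota 0 N].
  by rewrite /index_iota subn0.
rewrite big_cat !big_map !big_mkord /alt_gauss /=.
congr (_ + _).
rewrite -sumrN; apply: eq_bigr => i _; rewrite isignN /isign /sqpow absz_nat exprS mulN1r mulNr.
by congr (- (_ * _ ^+ (_ ^ 2))); nia.
Qed.

Definition bqf (w : int * int) : int :=
  A%:Z * w.1 ^+ 2 + b%:Z * w.1 * w.2 + C%:Z * w.2 ^+ 2.

Lemma bqf4 w : 4 * A%:Z * bqf w = (2 * A%:Z * w.1 + b%:Z * w.2) ^+ 2 + p%:Z * w.2 ^+ 2.
Proof.
have d : 4 * A%:Z * C%:Z = b%:Z ^+ 2 + p%:Z by move: disc; clear; nia.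
transitivity (4 * A%:Z ^+ 2 * w.1 ^+ 2 + 4 * A%:Z * b%:Z * w.1 * w.2 + (4 * A%:Z * C%:Z) * w.2 ^+ 2).
  by rewrite /bqf; ring.
by rewrite d; ring.
Qed.

Lemma bqf_ge0 w : 0 <= bqf w.
Proof.
have a0 : 0 < 4 * A%:Z by move: A0; clear; lia.
by rewrite -(pmulr_rge0 _ a0) bqf4; apply: addr_ge0; [exact: sqr_ge0|apply: mulr_ge0 => //; exact: sqr_ge0].
Qed.

Local Notation q := (z ^+ (4 * A)).

(** Writing q = z^(4 A) keeps the exponents integral when the square is completed in 4 A Q. *)
Lemma q_bqf w : q ^+ `|bqf w|%N = sqpow z (2 * A%:Z * w.1 + b%:Z * w.2) * sqpow (z ^+ p) w.2.
Proof.
rewrite /sqpow -!exprM -exprD; congr (_ ^+ _).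
have sqE (k : int) : (`|k| ^ 2)%N%:Z = k ^+ 2.
  by rewrite -mulnn PoszM -expr2 abszE real_normK ?num_real.
apply/eqP; rewrite -eqz_nat; apply/eqP.
rewrite PoszD [X in _ = _ + X]PoszM !sqE [LHS]PoszM gez0_abs ?bqf_ge0 //.
by rewrite [X in X * _]PoszM bqf4.
Qed.

Let L := (2 * A)%N.

(* At this point 2A w.1 + b w.2 = 2A u + (b v0 mod 2A), so that j and u decouple. *)
Definition lattice_pt (v0 : nat) (j u : int) : int * int :=
  (u - b%:Z * j - ((b * v0) %/ L)%N%:Z, v0%:Z + L%:Z * j).

Definition lattice_box (N : nat) : seq (int * int) :=
  [seq lattice_pt x.1 x.2.1 x.2.2 | x <- [seq (v0, ju) | v0 <- iota 0 L, ju <- [seq (j, u) | j <- int_box N, u <- int_box N]]].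

Lemma L_gt0 : (0 < L)%N. Proof. by rewrite muln_gt0. Qed.

Lemma lattice_pt_inj v0 j u v0' j' u' : (v0 < L)%N -> (v0' < L)%N ->
  lattice_pt v0 j u = lattice_pt v0' j' u' -> [/\ v0 = v0', j = j' & u = u'].
Proof.
move=> vL vL' [E1 E2].
have vv : v0%:Z - v0'%:Z = 0.
  apply: (@dvdz_small L); last by move: vL vL'; clear; lia.
  by apply/dvdzP; exists (j' - j); rewrite mulrBl; move: E2; rewrite ![L%:Z * _]mulrC; clear; lia.
have v_eq : v0 = v0' by move: vv; clear; lia.
subst v0'; have jj : j = j'.
  have Lz : L%:Z != 0 by have := L_gt0; clear; lia.
  by apply: (mulfI Lz); apply: (addrI v0%:Z).
by split => //; move: E1; rewrite jj; clear; lia.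
Qed.

Lemma lattice_box_uniq N : uniq (lattice_box N).
Proof.
rewrite map_inj_in_uniq.
  apply: allpairs_uniq; rewrite ?iota_uniq //.
    by apply: allpairs_uniq; rewrite ?int_box_uniq // => -[a c] [a' c'] _ _ [-> ->].
  by move=> [a c] [a' c'] _ _ [-> ->].
move=> [v0 [j u]] [v0' [j' u']] /allpairsP[[x y] /= [xL _ [-> _]]] /allpairsP[[x' y'] /= [xL' _ [-> _]]].
rewrite !mem_iota /= add0n in xL xL'.
by move=> /(lattice_pt_inj xL xL')[-> -> ->].
Qed.

Lemma size_lattice_box N : size (lattice_box N) = (L * (N.*2 * N.*2))%N.
Proof. by rewrite size_map !size_allpairs size_iota !size_int_box. Qed.

Lemma mem_lattice_box (M : nat) w : bqf w < M%:Z -> w \in lattice_box (4 * A * M).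
Proof.
move=> QM; set N := (4 * A * M)%N.
have h4 := bqf4 w; have Az : 0 < 4 * A%:Z by move: A0; clear; lia.
have hN : 4 * A%:Z * bqf w < N%:Z by rewrite /N !PoszM ltr_pM2l.
pose v0 := `|(w.2 %% L)%Z|%N; pose j := (w.2 %/ L)%Z.
have Lz : L%:Z != 0 by have := L_gt0; clear; lia.
have Lp : 0 < L%:Z by have := L_gt0; clear; lia.
have v0E : (w.2 %% L)%Z = v0%:Z by rewrite /v0 gez0_abs // modz_ge0.
have vE : w.2 = v0%:Z + L%:Z * j by rewrite [LHS](divz_eq _ L%:Z) v0E addrC mulrC.
have vL : (v0 < L)%N by rewrite -ltz_nat -v0E ltz_pmod.
pose s := ((b * v0) %/ L)%N; pose r := ((b * v0) %% L)%N.
have sE : b%:Z * v0%:Z = L%:Z * s%:Z + r%:Z by rewrite -!PoszM -PoszD mulnC [(L * s)%N]mulnC -divn_eq mulnC.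
have rL : (r < L)%N by rewrite ltn_mod L_gt0.
pose u := w.1 + b%:Z * j + s%:Z.
have wE : w = lattice_pt v0 j u.
  by rewrite /lattice_pt -vE /u; case: (w) => a c /=; congr pair; clear; lia.
have fE : 2 * A%:Z * w.1 + b%:Z * w.2 = L%:Z * u + r%:Z.
  by rewrite vE [b%:Z * (_ + _)]mulrDr sE /u /L PoszM; ring.
rewrite fE in h4.
have v2 : w.2 ^+ 2 < N%:Z.
  apply: le_lt_trans hN; rewrite h4; apply: (@le_trans _ _ (p%:Z * w.2 ^+ 2)).
    by rewrite ler_peMl ?sqr_ge0 //; move: p0; clear; lia.
  by rewrite lerDr sqr_ge0.
have u2 : (L%:Z * u + r%:Z) ^+ 2 < N%:Z.
  apply: le_lt_trans hN; rewrite h4 lerDl mulr_ge0 ?sqr_ge0 //.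
have sq_lt (k : int) : k ^+ 2 < N%:Z -> - N%:Z < k < N%:Z by clear; nia.
have := sq_lt _ v2; have := sq_lt _ u2 => /andP[u3 u4] /andP[v3 v4].
rewrite wE; apply/mapP; exists (v0, (j, u)) => //=.
apply/allpairsP; exists (v0, (j, u)); split=> //=; first by rewrite mem_iota.
apply/allpairsP; exists (j, u); split=> //=; rewrite mem_int_box.
  have L1 : 1 <= L%:Z by move: Lp; clear; lia.
  rewrite vE in v3 v4; move: v3 v4 vL L1; move: (L) (N) (v0) (j); clear; nia.
have NL : L%:Z * 2 <= N%:Z.
  have M0 : (0 < M)%N by have := bqf_ge0 w; move: QM; clear; lia.
  by rewrite -PoszM lez_nat /N /L; move: M0 A0; clear; nia.
have L1 : 1 <= L%:Z by move: Lp; clear; lia.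
move: u3 u4 rL L1 NL; move: (L) (N) (r) (u); clear; nia.
Qed.

(** As b is odd and L even, the sign alternates in both decoupled coordinates j and u. Each class v0
    thus yields a product of two alternating sums, of which the one in z^p is at most 1 and the one
    in z is small. *)
Lemma lattice_box_sum (e N : nat) :
  `|\sum_(w <- lattice_box N) isign (w.1 + e%:Z * w.2) * q ^+ `|bqf w|%N|
   <= L%:R * (4 * z ^+ N + 13 * (L ^ 2)%:R * tau).
Proof.
have -> : \sum_(w <- lattice_box N) isign (w.1 + e%:Z * w.2) * q ^+ `|bqf w|%N =
   \sum_(v0 < L) isign ((b * v0) %/ L)%N%:Z * isign (e%:Z * v0%:Z)
      * (alt_gauss (z ^+ p) L v0 N * alt_gauss z L ((b * v0) %% L) N).
  rewrite big_map big_allpairs_dep /= (_ : iota 0 L = index_iota 0 L) ?big_mkord; last by rewrite /index_iota subn0.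
  apply: eq_bigr => v0 _; rewrite -!sum_int_box_gauss; last 2 first.
  - by rewrite ltnW // ltn_mod L_gt0.
  - exact: ltnW (ltn_ord v0).
  rewrite big_allpairs_dep /= mulr_suml mulr_sumr; apply: eq_bigr => j _.
  rewrite 2!mulr_sumr; apply: eq_bigr => u _.
  rewrite q_bqf /=.
  set s := ((b * v0) %/ L)%N; set r := ((b * v0) %% L)%N.
  have sE : b%:Z * (v0 : nat)%:Z = L%:Z * s%:Z + r%:Z.
    by rewrite -!PoszM -PoszD mulnC [(L * s)%N]mulnC -divn_eq mulnC.
  have -> : 2 * A%:Z * (u - b%:Z * j - s%:Z) + b%:Z * ((v0 : nat)%:Z + L%:Z * j) = L%:Z * u + r%:Z.
    rewrite [b%:Z * (_ + _)]mulrDr sE /L PoszM; ring.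
  have -> : isign (u - b%:Z * j - s%:Z + e%:Z * ((v0 : nat)%:Z + L%:Z * j)) =
     isign u * isign j * isign s%:Z * isign (e%:Z * (v0 : nat)%:Z).
    rewrite mulrDr !isignD !isignN (isignM_odd j) ?absz_nat //.
    have -> : isign (e%:Z * (L%:Z * j)) = 1; last by rewrite mulr1.
    by rewrite /isign !abszM !absz_nat /L mulnCA -mulnA -signr_odd oddM.
  rewrite [(v0 : nat)%:Z + _]addrC.
  by move: (isign _) (isign _) (isign _) (isign _) (sqpow _ _) (sqpow _ _) => *; ring.
apply: le_trans (ler_norm_sum _ _ _) _.
have -> : L%:R * (4 * z ^+ N + 13 * (L ^ 2)%:R * tau) = \sum_(v0 < L) (4 * z ^+ N + 13 * (L ^ 2)%:R * tau).
  by rewrite sumr_const card_ord mulr_natl.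
apply: ler_sum => v0 _; rewrite normrM [X in X * _]normrM !norm_isign !mul1r normrM.
have zp0 : 0 < z ^+ p by rewrite exprn_gt0.
have zp1 : z ^+ p <= 1 by rewrite exprn_ile1 // ltW.
have h1 := alt_gauss_le1 zp0 zp1 L v0 N.
have h2 : `|alt_gauss z L ((b * v0) %% L) N| <= 4 * z ^+ N + 13 * (L ^ 2)%:R * tau.
  by apply: alt_gauss_small; rewrite ?L_gt0 // ltnW // ltn_mod L_gt0.
by rewrite -[leRHS]mul1r; apply: ler_pM.
Qed.

(** The box with N = 4 A M contains the region Q < M; its other points number at most L (2 N)^2 and
    contribute at most q^M each. The constant 136 covers 13 L^3 = 104 A^3 as well as 4 L + L (2 N)^2
    = 8 A + 128 A^3 M^2. *)
Lemma lattice_sum_bound (e M : nat) (W : seq (int * int)) : uniq W ->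
  (forall w, bqf w < M%:Z -> w \in W) ->
  `|\sum_(w <- W | bqf w < M%:Z) isign (w.1 + e%:Z * w.2) * q ^+ `|bqf w|%N|
   <= (136 * A ^ 3)%:R * (tau + (M.+1 ^ 2)%:R * q ^+ M).
Proof.
move=> Wu WM; set F := fun w : int * int => isign (w.1 + e%:Z * w.2) * q ^+ `|bqf w|%N.
pose N := (4 * A * M)%N.
have -> : \sum_(w <- W | bqf w < M%:Z) F w = \sum_(w <- lattice_box N | bqf w < M%:Z) F w.
  rewrite -big_filter -[RHS]big_filter; apply: perm_big; apply: uniq_perm.
  - exact: filter_uniq.
  - exact/filter_uniq/lattice_box_uniq.
  - move=> w; rewrite !mem_filter; case: ltP => //= QM.
    by rewrite WM // mem_lattice_box.
have -> : \sum_(w <- lattice_box N | bqf w < M%:Z) F w =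
   \sum_(w <- lattice_box N) F w - \sum_(w <- lattice_box N | ~~ (bqf w < M%:Z)) F w.
  by rewrite [in RHS](bigID (fun w => bqf w < M%:Z)) /= addrK.
have q0 : 0 <= q by rewrite exprn_ge0 // ltW.
have q1 : q <= 1 by rewrite exprn_ile1 // ltW.
have h1 := lattice_box_sum e N.
have h2 : `|\sum_(w <- lattice_box N | ~~ (bqf w < M%:Z)) F w| <= (L * (N.*2 * N.*2))%:R * q ^+ M.
  apply: le_trans (ler_norm_sum _ _ _) _.
  rewrite -size_lattice_box -sum1_size natr_sum mulr_suml big_mkcond /=.
  apply: ler_sum => w _; rewrite mul1r -leNgt; case: ifP => [QM|_]; last exact: exprn_ge0.
  rewrite normrM norm_isign mul1r ger0_norm; last by apply: exprn_ge0.
  by rewrite ler_wiXn2l //; move: QM (bqf_ge0 w); clear; lia.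
apply: le_trans (ler_normB _ _) _; apply: le_trans (lerD h1 h2) _.
have -> : z ^+ N = q ^+ M by rewrite -exprM.
have y0 : 0 <= q ^+ M by apply: exprn_ge0.
have A1 : (1 <= A)%N := A0.
have e1 : L%:R * (4 * q ^+ M + 13 * (L ^ 2)%:R * tau) + (L * (N.*2 * N.*2))%:R * q ^+ M
   = (104 * A ^ 3)%:R * tau + (8 * A + 128 * A ^ 3 * M ^ 2)%:R * q ^+ M.
  have n1 : ((L * (N.*2 * N.*2)) = 128 * A ^ 3 * M ^ 2)%N by rewrite /L /N -!muln2; clear; nia.
  have n2 : (104 * A ^ 3 = L * (13 * L ^ 2))%N by rewrite /L; clear; nia.
  have n3 : ((8 * A + 128 * A ^ 3 * M ^ 2) = L * 4 + 128 * A ^ 3 * M ^ 2)%N by rewrite /L; clear; lia.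
  rewrite n1 n2 n3 [(L * (13 * _))%:R]natrM [(13 * _)%:R]natrM [(_ + _)%:R]natrD [(L * 4)%:R]natrM.
  by move: (_ ^ 2)%N%:R (_ * _ ^ 2)%N%:R (L%:R) (q ^+ M) => ? ? ? ?; ring.
rewrite e1 mulrDr; apply: lerD.
  by rewrite ler_wpM2r // ler_nat leq_pmul2r ?expn_gt0 ?A1.
rewrite mulrA -natrM ler_wpM2r // ler_nat.
have : (A <= A ^ 3)%N by rewrite -{1}(expn1 A) leq_pexp2l.
by move: (A ^ 3)%N => a; clear; nia.
Qed.

End LatticeSum.

(** * The class number formula *)

Section PeriodicSums.
Variables (R : realFieldType) (p : nat) (g : nat -> R).
Hypothesis (p0 : (0 < p)%N) (gp : forall k, g (k + p)%N = g k).

Lemma periodic_sum_addn n : \sum_(k < p) g k = 0 ->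
  \sum_(k < n + p) g k = \sum_(k < n) g k.
Proof.
move=> g0; rewrite addnC big_split_ord /= g0 add0r.
by apply: eq_bigr => k _; rewrite addnC gp.
Qed.

Lemma periodic_sum_bound b n : \sum_(k < p) g k = 0 -> (forall k, `|g k| <= b) ->
  `|\sum_(k < n) g k| <= p%:R * b.
Proof.
move=> g0 gb; have b0 : 0 <= b by apply: le_trans (gb 0%N).
have [m] := ubnP n; elim: m n => // m IH n nm.
have [np|pn] := ltnP n p.
  apply: le_trans (ler_norm_sum _ _ _) _.
  apply: (@le_trans _ _ (\sum_(k < n) b)); first by apply: ler_sum => k _.
  by rewrite sumr_const card_ord -[leLHS]mulr_natl ler_wpM2r // ler_nat ltnW.
rewrite -(subnK pn) periodic_sum_addn //; apply: IH.
by move: p0 nm pn; clear; lia.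
Qed.

End PeriodicSums.

(** * Lambert series and their Abel summation *)

Section Lambert.
Variables (R : realFieldType) (q : R).
Hypothesis (q0 : 0 < q) (q1 : q < 1).

Let q01 : 0 <= q <= 1. Proof. by rewrite !ltW. Qed.

Definition multiples_sum (M d : nat) : R := \sum_(1 <= m < M | (d %| m)%N) q ^+ m.

Lemma multiples_sumE M d : (0 < d)%N -> exists2 r, (M <= r)%N &
  (1 - q ^+ d) * multiples_sum M d = q ^+ d - q ^+ r.
Proof.
move=> d0; case: M => [|M].
  by exists d => //; rewrite /multiples_sum big_geq // mulr0 subrr.
(* The exponent r is the least multiple of d beyond M; the induction needs this, not only the lower
   bound. *)
suff [r [dr Mr rM]] : exists r, [/\ (d %| r)%N, (M < r <= M + d)%N &
    (1 - q ^+ d) * multiples_sum M.+1 d = q ^+ d - q ^+ r].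
  by exists r => //; case/andP: Mr.
elim: M => [|M [r [dr /andP[Mr rM] IH]]].
  exists d; split; rewrite ?dvdnn ?d0 ?leqnn //.
  by rewrite /multiples_sum big_geq // mulr0 subrr.
rewrite /multiples_sum big_mkcond big_nat_recr //= -big_mkcond -/(multiples_sum _ _) mulrDr IH.
case: ifP => dM; last first.
  exists r; split=> //; last by rewrite mulr0 addr0.
  rewrite addSn (leq_trans rM) // andbT ltn_neqAle Mr andbT.
  by apply: contraFneq dM => ->.
have rE : r = M.+1.
  have : (d %| r - M.+1)%N by rewrite dvdn_sub.
  by move=> /dvdnP[j E]; move: d0 rM Mr E; clear; case: j => [|j]; nia.
exists (M.+1 + d)%N; split; rewrite ?dvdn_add ?leqnn ?andbT //.
  by rewrite -[X in (X < _)%N]addn0 ltn_add2l.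
by rewrite rE exprD; ring.
Qed.

Lemma multiples_sum_error M d : (0 < d)%N ->
  `|multiples_sum M d - q ^+ d / (1 - q ^+ d)| <= q ^+ M / (1 - q).
Proof.
move=> d0; have [r Mr E] := multiples_sumE M d0.
have zq : q ^+ d <= q by rewrite -[leRHS]expr1 ler_wiXn2l // ltW.
have h1 : 0 < 1 - q by rewrite subr_gt0.
have h2 : 0 < 1 - q ^+ d by rewrite subr_gt0 (le_lt_trans zq).
have -> : multiples_sum M d = (q ^+ d - q ^+ r) / (1 - q ^+ d).
  by rewrite -E mulrC mulKf // gt_eqF.
rewrite -mulrBl addrAC subrr add0r mulNr normrN ger0_norm; last first.
  by rewrite divr_ge0 ?exprn_ge0 // ltW.
apply: ler_pM.
- by rewrite exprn_ge0 // ltW.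
- by rewrite invr_ge0 ltW.
- by rewrite ler_wiXn2l // ltW.
by rewrite lef_pV2 ?posrE // lerD2l lerN2.
Qed.

(** The poles at z = 1 cancel, and what remains is bounded, so that Abel summation against chi
    applies. *)
Lemma logistic_split (z : R) : 0 < z < 1 ->
  z / (1 - z) - 4 * (z ^+ 4 / (1 - z ^+ 4)) = z / (1 + z) + 2 * (z ^+ 2 / (1 + z ^+ 2)).
Proof.
move=> /andP[z0 z1].
have z2 : z ^+ 2 < 1 by rewrite exprn_ilt1 // ltW.
have z20 : 0 < z ^+ 2 by rewrite exprn_gt0.
have -> : 1 - z ^+ 4 = (1 - z) * (1 + z) * (1 + z ^+ 2) by ring.
field; apply/and3P; split; lra.
Qed.

(** The function k -> q^k / (1 + q^k) starts at 1/2, decreases by steps of at most 1 - q and is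
    convex, so its differences are unimodal. *)
Lemma logistic_abel (chi : nat -> R) (s B : R) N :
  (forall n, `|\sum_(k < n) chi k| <= B) ->
  (forall n, `|\sum_(k < n) (\sum_(i < k.+1) chi i - s)| <= B) ->
  `|\sum_(k < N) chi k * (q ^+ k / (1 + q ^+ k)) - s / 2| <= (B + `|s|) * q ^+ N + 3 * B * (1 - q).
Proof.
move=> S1 S2; pose f k := q ^+ k / (1 + q ^+ k).
have B0 : 0 <= B by apply: le_trans (S1 0%N).
have y0 k : 0 < q ^+ k by exact: exprn_gt0.
have y1 k : q ^+ k <= 1 by rewrite exprn_ile1 // ltW.
have fE k : f k = 1 - (1 + q ^+ k)^-1.
  by rewrite /f; field; have := y0 k; lra.
have f0 k : 0 <= f k by rewrite divr_ge0 ?addr_ge0 // ltW.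
have df k : 0 <= f k - f k.+1 <= 1 - q.
  have -> : f k - f k.+1 = (q ^+ k * (1 - q)) * ((1 + q ^+ k)^-1 * (1 + q ^+ k.+1)^-1).
    by rewrite /f exprS; field; have := mulr_gt0 q0 (y0 k); have := y0 k; lra.
  have i1 n : 0 < (1 + q ^+ n)^-1 <= 1.
    rewrite invr_gt0 ltr_pDl ?y0 ?ltr01 //= invf_le1 ?lerDl ?ltW //.
    by rewrite addr_gt0.
  have /andP[a0 a1] := i1 k; have /andP[b0 b1] := i1 k.+1.
  have q1' : 0 <= 1 - q by rewrite subr_ge0 ltW.
  apply/andP; split; first by rewrite !mulr_ge0 // ltW.
  rewrite -[leRHS]mul1r -[leRHS]mulr1; apply: ler_pM.
  - by rewrite mulr_ge0 // ltW.
  - by rewrite mulr_ge0 // ltW.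
  - by apply: ler_wpM2r.
  - by rewrite mulr_ile1 // ltW.
have dd k : f k.+1 - f k.+2 <= f k - f k.+1.
  rewrite -subr_ge0 !fE; have := y0 k.
  rewrite (_ : q ^+ k.+2 = q ^+ 2 * q ^+ k) 1?exprS; last by rewrite -exprD.
  have := y1 k; move: (q ^+ k) => z z1 z0.
  have qz : 0 < q * z by rewrite mulr_gt0.
  have qz1 : q * z <= 1 by rewrite mulr_ile1 // ltW.
  have qqz : 0 < q ^+ 2 * z by rewrite mulr_gt0 ?exprn_gt0.
  have -> : 1 - (1 + z)^-1 - (1 - (1 + q * z)^-1) - (1 - (1 + q * z)^-1 - (1 - (1 + q ^+ 2 * z)^-1))
    = z * (1 - q) ^+ 2 * (1 - q * z) / ((1 + z) * (1 + q * z) * (1 + q ^+ 2 * z)).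
    by field; apply/and3P; split; lra.
  apply: divr_ge0; first by rewrite !mulr_ge0 ?sqr_ge0 ?subr_ge0 // ltW.
  by rewrite !mulr_ge0 // addr_ge0 // ltW.
have := abel_bound N S1 S2 f0 df (fun k _ => dd k.+1).
have -> : s * f 0%N = s / 2 by rewrite /f expr0 mul1r.
move=> h; apply: le_trans h _; rewrite lerD2r ler_wpM2l ?addr_ge0 //.
by rewrite /f ler_pdivrMr ?addr_gt0 // ler_peMr ?lerDl ?ltW.
Qed.

End Lambert.

(** * The divisor sums weighted by powers of q *)

Section NumberSide.
Variables (R : realFieldType) (p : nat).
Hypothesis (pp : prime p) (p3 : p = 3 %[mod 4]).

Local Notation ch d := ((chi p d)%:~R : R).
Local Notation rho m := ((ideal_count p m)%:R : R).
Let p0 : (0 < p)%N := prime_gt0 pp.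
Let op : odd p := odd_3mod4 p3.

Lemma chi_addp k : chi p (k + p) = chi p k.
Proof. by rewrite /chi natrD (_ : p%:R = 0) ?addr0 //; apply/eqP; rewrite natr_Fp_eq0. Qed.

Lemma sum_Fp (V : nmodType) (F : 'F_p -> V) : \sum_(k < p) F k%:R = \sum_z F z.
Proof.
rewrite (reindex (fun k : 'I_p => k%:R : 'F_p)) //.
exists (fun z => Ordinal (Fp_val_lt pp z)) => [k|z] _; last exact: Fp_valK.
by apply: val_inj => /=; rewrite Fp_val_nat.
Qed.

Lemma sum_chi : \sum_(k < p) chi p k = 0.
Proof. by rewrite -[RHS](sum_lg pp op) -(sum_Fp (fun z => lg z)). Qed.

Lemma norm_chi k : `|ch k| <= 1.
Proof.
rewrite /chi; have [->|/lg_cases[->|->]] := eqVneq (k%:R : 'F_p) 0;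
by rewrite ?lg0 ?mulr0z ?normr0 ?mulr1z ?normr1 ?mulrN1z ?normrN1.
Qed.

Definition mean_char_sum : R := (\sum_(k < p) \sum_(i < k.+1) ch i) / p%:R.
Local Notation s := mean_char_sum.

Lemma sum_char_bound n : `|\sum_(k < n) ch k| <= p%:R.
Proof.
rewrite -[leRHS]mulr1; apply: (periodic_sum_bound (g := fun k => ch k) p0) => [k||k].
- by rewrite chi_addp.
- by rewrite -rmorph_sum /= sum_chi rmorph0.
- exact: norm_chi.
Qed.

Lemma mean_char_sum_bound : `|s| <= p%:R.
Proof.
have pR : 0 < p%:R :> R by rewrite ltr0n.
rewrite normrM [ `|p%:R^-1|]ger0_norm ?invr_ge0 ?ler0n // ler_pdivrMr //.
apply: le_trans (ler_norm_sum _ _ _) _.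
apply: (@le_trans _ _ (\sum_(k < p) p%:R)); first by apply: ler_sum => k _; exact: sum_char_bound.
by rewrite sumr_const card_ord -[leLHS]mulr_natl.
Qed.

Lemma sum_char_deviation n : `|\sum_(k < n) (\sum_(i < k.+1) ch i - s)| <= (2 * p ^ 2)%:R.
Proof.
have pR : p%:R != 0 :> R by rewrite pnatr_eq0 -lt0n.
rewrite (_ : (2 * p ^ 2)%:R = p%:R * (2 * p%:R) :> R); last by rewrite natrM natrX; ring.
apply: (periodic_sum_bound (g := fun k => \sum_(i < k.+1) ch i - s) p0) => [k||k].
- congr (_ - _); rewrite -addSn (periodic_sum_addn (g := fun k => ch k)) //= => [i|].
    by rewrite chi_addp.
  by rewrite -rmorph_sum /= sum_chi rmorph0.
- rewrite sumrB sumr_const card_ord -mulr_natr /mean_char_sum divfK ?subrr //.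
- apply: le_trans (ler_normB _ _) _; rewrite mulr_natl mulr2n.
  by apply: lerD; [exact: sum_char_bound|exact: mean_char_sum_bound].
Qed.

Lemma ideal_count_sum m M : (0 < m < M)%N ->
  rho m = \sum_(1 <= d < M | (d %| m)%N) ch d.
Proof.
case/andP=> m0 mM; rewrite pmulrn ideal_countE // rmorph_sum /= -[RHS]big_filter.
apply: perm_big; apply: uniq_perm; rewrite ?divisors_uniq ?filter_uniq ?iota_uniq //.
move=> d; rewrite -dvdn_divisors // mem_filter mem_index_iota.
apply/idP/andP=> [dm|[]] //; split=> //; rewrite (dvdn_gt0 m0 dm) /=.
by apply: leq_ltn_trans mM; apply: dvdn_leq.
Qed.

Lemma ideal_count_lambert (q : R) M :
  \sum_(1 <= m < M) q ^+ m * (rho m - 4 * (if (4 %| m)%N then rho (m %/ 4) else 0)) =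
  \sum_(1 <= d < M) ch d * (multiples_sum q M d - 4 * multiples_sum q M (4 * d)).
Proof.
transitivity (\sum_(1 <= m < M) \sum_(1 <= d < M) (q ^+ m * ch d * ((d %| m)%:R - 4 * (4 * d %| m)%:R))).
  rewrite big_nat [RHS]big_nat; apply: eq_bigr => m /andP[m0 mM].
  have e1 : rho m = \sum_(1 <= d < M) ch d * (d %| m)%:R.
    rewrite (@ideal_count_sum m M) ?m0 // big_mkcond; apply: eq_bigr => d _.
    by case: ifP; rewrite ?mulr1 ?mulr0.
  have e2 : (if (4 %| m)%N then rho (m %/ 4) else 0) = \sum_(1 <= d < M) ch d * (4 * d %| m)%:R.
    case: ifP => [m4|m4].
      have mq : (0 < m %/ 4 < M)%N by move: m4 m0 mM; clear; lia.
      rewrite (@ideal_count_sum _ M) // big_mkcond; apply: eq_bigr => d _.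
      by rewrite dvdn_divRL // mulnC; case: ifP; rewrite ?mulr1 ?mulr0.
    rewrite big1 // => d _; case: (boolP (4 * d %| m)%N); rewrite ?mulr0 // => dm.
    by rewrite (dvdn_trans (dvdn_mulr d (dvdnn 4)) dm) in m4.
  rewrite {}e1 {}e2 [4 * _]mulr_sumr -sumrB mulr_sumr; apply: eq_bigr => d _.
  by move: (ch d) (q ^+ m) (_%:R) (_%:R) => a b c d'; ring.
rewrite exchange_big /=; apply: eq_bigr => d _.
rewrite /multiples_sum [\sum_(1 <= m < M | (d %| m)%N) _]big_mkcond
  [\sum_(1 <= m < M | (4 * d %| m)%N) _]big_mkcond /= [4 * _]mulr_sumr -sumrB mulr_sumr.
apply: eq_bigr => m _; do 2 case: ifP => _; rewrite /=; ring.
Qed.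

(** Truncation costs (1 + 4) q^M / (1 - q) for each d < M. Abel summation is used at q and, with
    weight 2, at q^2, with B = 2 p^2 and |s| <= p^2: this gives 3 p^2 + 6 p^2 = 9 p^2 and, as 1 -
    q^2 <= 2 (1 - q), 6 p^2 + 24 p^2 = 30 p^2. *)
Lemma ideal_count_lambert_bound (q : R) M : 0 < q -> q < 1 ->
  `|\sum_(1 <= m < M) q ^+ m * (rho m - 4 * (if (4 %| m)%N then rho (m %/ 4) else 0))
     - 3 / 2 * s| <=
  (5 * M%:R / (1 - q) + (9 * p ^ 2)%:R) * q ^+ M + (30 * p ^ 2)%:R * (1 - q).
Proof.
move=> q0 q1; rewrite ideal_count_lambert.
have q1' : 0 < 1 - q by rewrite subr_gt0.
have qM0 : 0 < q ^+ M by rewrite exprn_gt0.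
have qM1 : q ^+ M <= 1 by rewrite exprn_ile1 // ltW.
pose A d := q ^+ d / (1 + q ^+ d) + 2 * ((q ^+ 2) ^+ d / (1 + (q ^+ 2) ^+ d)).
have main : `|\sum_(k < M) ch k * A k - 3 / 2 * s| <= (9 * p ^ 2)%:R * q ^+ M + (30 * p ^ 2)%:R * (1 - q).
  have S1 n : `|\sum_(k < n) ch k| <= (2 * p ^ 2)%:R.
    by apply: le_trans (sum_char_bound n) _; rewrite ler_nat; move: p0; clear; nia.
  have h1 := logistic_abel q0 q1 (chi := fun k => ch k) M S1 sum_char_deviation.
  have q20 : 0 < q ^+ 2 by rewrite exprn_gt0.
  have q21 : q ^+ 2 < 1 by rewrite exprn_ilt1 // ltW.
  have h2 := logistic_abel q20 q21 (chi := fun k => ch k) M S1 sum_char_deviation.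
  have -> : \sum_(k < M) ch k * A k - 3 / 2 * s =
     (\sum_(k < M) ch k * (q ^+ k / (1 + q ^+ k)) - s / 2)
     + 2 * (\sum_(k < M) ch k * ((q ^+ 2) ^+ k / (1 + (q ^+ 2) ^+ k)) - s / 2).
    rewrite /A; have -> : \sum_(k < M) ch k * (q ^+ k / (1 + q ^+ k) + 2 * ((q ^+ 2) ^+ k / (1 + (q ^+ 2) ^+ k)))
      = \sum_(k < M) ch k * (q ^+ k / (1 + q ^+ k)) + 2 * \sum_(k < M) ch k * ((q ^+ 2) ^+ k / (1 + (q ^+ 2) ^+ k)).
      rewrite mulr_sumr -big_split /=; apply: eq_bigr => k _.
      by rewrite mulrDr [X in _ + X = _]mulrCA.
    by move: (\sum_(k < M) _) (\sum_(k < M) _) => a b; field.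
  apply: le_trans (ler_normD _ _) _; rewrite [X in _ + X <= _]normrM [ `|2|]ger0_norm //.
  have := mean_char_sum_bound; have h3 : p%:R <= (p ^ 2)%:R :> R.
    by rewrite ler_nat; move: p0; clear; nia.
  have q2M : (q ^+ 2) ^+ M <= q ^+ M by rewrite -exprM mul2n -addnn exprD ler_piMl // ltW.
  have q2M0 : 0 <= (q ^+ 2) ^+ M by rewrite exprn_ge0 // ltW.
  have q2' : 1 - q ^+ 2 <= 2 * (1 - q) by rewrite expr2; move: q0 q1; nra.
  move: h1 h2 h3 q2M q2M0 q2' q1' qM0; rewrite ![(_ * p ^ 2)%:R]natrM.
  have : 0 <= (p ^ 2)%:R :> R by [].
  have : 0 <= `|s| by [].
  move: `|\sum_(k < M) _ - _| `|\sum_(k < M) _ - _| `|s| ((p ^ 2)%:R) (p%:R : R) (q ^+ 2 ^+ M) (q ^+ M) (1 - q ^+ 2) (1 - q).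
  move=> a b t P p' y x e2 e t0 P0 h1 h2 pP yx y0 e2e e0 x0 tp.
  have tP : t <= P by lra.
  have f1 : (2%:R * P + t) * x <= 3 * P * x by rewrite ler_wpM2r; lra.
  have f2 : (2%:R * P + t) * y <= 3 * P * x by apply: ler_pM; lra.
  have f3 : P * e2 <= P * (2 * e) by rewrite ler_wpM2l.
  lra.
have err : `|\sum_(1 <= d < M) ch d * (multiples_sum q M d - 4 * multiples_sum q M (4 * d))
   - \sum_(k < M) ch k * A k| <= 5 * M%:R / (1 - q) * q ^+ M.
  have -> : \sum_(k < M) ch k * A k = \sum_(1 <= k < M) ch k * A k.
    rewrite -(big_mkord xpredT (fun k => ch k * A k)); case: (M) => [|m]; first by rewrite !big_geq.
    by rewrite big_ltn // {1}/chi lg0 mul0r add0r.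
  rewrite -sumrB; apply: le_trans (ler_norm_sum _ _ _) _.
  apply: (@le_trans _ _ (\sum_(1 <= d < M) 5 * (q ^+ M / (1 - q)))).
    rewrite big_nat [leRHS]big_nat; apply: ler_sum => d /andP[d0 _].
    rewrite -mulrBr normrM; rewrite -[leRHS]mul1r; apply: ler_pM => //; first exact: norm_chi.
    have qd : 0 < q ^+ d < 1 by rewrite exprn_gt0 //= exprn_ilt1 ?ltW // -lt0n.
    rewrite /A (exprAC q 2 d) -logistic_split //.
    have h1 := multiples_sum_error q0 q1 M d0.
    have d40 : (0 < 4 * d)%N by rewrite muln_gt0.
    have := multiples_sum_error q0 q1 M d40.
    rewrite (_ : q ^+ (4 * d) = (q ^+ d) ^+ 4); last by rewrite -exprM mulnC.
    move: h1; rewrite !ler_norml; move: (multiples_sum _ _ _) (multiples_sum _ _ _) (_ / _) (_ / _) (_ / (1 - q)).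
    by move=> a b c e f; lra.
  rewrite sumr_const_nat -[leLHS]mulr_natl.
  have -> : 5 * M%:R / (1 - q) * q ^+ M = M%:R * (5 * (q ^+ M / (1 - q))) by ring.
  rewrite ler_wpM2r ?ler_nat ?leq_subr //.
  by rewrite !mulr_ge0 ?invr_ge0 // ltW.
rewrite [X in _ <= X + _]mulrDl -[leRHS]addrA; apply: le_trans (lerD err main).
by apply: le_trans (ler_normD _ _); rewrite addrA subrK.
Qed.

End NumberSide.

Lemma sum_powers_count (R : pzRingType) (q : R) (T : eqType) (f : T -> nat) (P : pred T) (s : seq T) M :
  \sum_(w <- s | P w && (f w < M)%N) q ^+ f w =
  \sum_(m < M) q ^+ m * (count (fun w => P w && (f w == m)) s)%:R.
Proof.
rewrite (eq_bigr (fun m : 'I_M => \sum_(w <- s) q ^+ m * (P w && (f w == m))%:R)); last first.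
  move=> m _; rewrite -mulr_sumr -natr_sum; congr (_ * _%:R).
  by rewrite -sum1_count big_mkcond; apply: eq_bigr => w _; case: ifP.
rewrite exchange_big /= big_mkcond; apply: eq_bigr => w _.
case: (P w); last by rewrite big1 // => m _; rewrite mulr0.
case: ltnP => fM /=.
  rewrite (bigD1 (Ordinal fM)) //= eqxx mulr1 big1 ?addr0 // => m mf.
  by rewrite (_ : f w == m = false) ?mulr0 //; apply: contraNF mf => /eqP fm; apply/eqP/val_inj.
by rewrite big1 // => m _; rewrite gtn_eqF ?mulr0 // (leq_trans (ltn_ord m)).
Qed.

(** * The parity-weighted sum over a single form *)

Section ParitySum.
Variables (R : realFieldType) (p A C b : nat).
Hypothesis (p0 : (0 < p)%N) (A0 : (0 < A)%N) (ob : odd b) (disc : (4 * A * C = b ^ 2 + p)%N).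
Local Notation Q := (bqf A C b).

Definition both_even (w : int * int) := ~~ odd `|w.1|%N && ~~ odd `|w.2|%N.

Definition parity_weight (w : int * int) : R :=
  isign R w.1 + isign R w.2 + isign R (w.1 + w.2).

Lemma parity_weightE w : parity_weight w = 4 * (both_even w)%:R - 1.
Proof.
rewrite /parity_weight isignD /isign /both_even -signr_odd -[(-1) ^+ `|w.2|%N]signr_odd.
by case: odd; case: odd; rewrite /= ?expr0 ?expr1; ring.
Qed.

Lemma disc_swap : (4 * C * A = b ^ 2 + p)%N.
Proof. by rewrite -disc mulnAC. Qed.

Lemma bqf_C_gt0 : (0 < C)%N.
Proof. by move: disc p0; clear; nia. Qed.

Lemma bqf_swap w : bqf C A b (w.2, w.1) = Q w.
Proof. by rewrite /bqf /=; ring. Qed.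

(** The signs (-1)^u and (-1)^(u + v) alternate in u and are the cases e = 0 and e = 1 of
    [lattice_sum_bound]. The sign (-1)^v does not, so the variables are swapped, which exchanges A
    and C; this is why q = x^N must be both a 4 A-th and a 4 C-th power. *)
Lemma parity_sum_bound (x tau : R) N M W : 0 < x -> x <= 1 -> 0 <= tau -> tau <= 1 ->
  (4 * A %| N)%N -> (4 * C %| N)%N -> N%:R * (1 - x) <= tau ^+ 2 ->
  uniq W -> (forall w, Q w < M%:Z -> w \in W) ->
  `|\sum_(w <- W | Q w < M%:Z) parity_weight w * (x ^+ N) ^+ `|Q w|%N| <=
  (136 * (2 * A ^ 3 + C ^ 3))%:R * (tau + (M.+1 ^ 2)%:R * (x ^+ N) ^+ M).
Proof.
move=> x0 x1 t0 t1 AN CN xt Wu WM; have C0 := bqf_C_gt0.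
have step (D : nat) : (0 < D)%N -> (4 * D %| N)%N -> exists z : R,
    [/\ 0 < z, z <= 1, 1 - z <= tau ^+ 2 & z ^+ (4 * D) = x ^+ N].
  move=> D0 DN; exists (x ^+ (N %/ (4 * D))).
  split; [exact: exprn_gt0 | by rewrite exprn_ile1 // ltW | | by rewrite -exprM divnK].
  apply: le_trans xt; apply: le_trans (bernoulli_sub _ _) _; first by rewrite (ltW x0).
  by rewrite ler_wpM2r ?subr_ge0 // ler_nat leq_div.
have [z [z0 z1 zt zN]] := step _ A0 AN.
have [z' [z0' z1' zt' zN']] := step _ C0 CN.
have h1 := lattice_sum_bound z0 z1 t0 t1 zt p0 A0 ob disc 0 Wu WM.
have h2 := lattice_sum_bound z0 z1 t0 t1 zt p0 A0 ob disc 1 Wu WM.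
have Wu' : uniq [seq (w.2, w.1) | w <- W] by rewrite map_inj_uniq // => -[a c] [a' c'] [-> ->].
have WM' w : bqf C A b w < M%:Z -> w \in [seq (w.2, w.1) | w <- W].
  case: w => a c h.
  by apply/mapP; exists (c, a) => //; apply: WM; rewrite -bqf_swap.
have h3 := lattice_sum_bound z0' z1' t0 t1 zt' p0 C0 ob disc_swap 0 Wu' WM'.
rewrite zN in h1 h2; rewrite zN' big_map /= in h3.
pose F e1 e2 := \sum_(w <- W | Q w < M%:Z) isign R (e1%:Z * w.1 + e2%:Z * w.2) * (x ^+ N) ^+ `|Q w|%N.
have -> : \sum_(w <- W | Q w < M%:Z) parity_weight w * (x ^+ N) ^+ `|Q w|%N
   = F 1%N 0%N + F 0%N 1%N + F 1%N 1%N.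
  rewrite -!big_split /=; apply: eq_bigr => w _.
  by rewrite -!mulrDl !mul0r !mul1r addr0 add0r.
have g1 : `|F 1%N 0%N| <= (136 * A ^ 3)%:R * (tau + (M.+1 ^ 2)%:R * x ^+ N ^+ M).
  by apply: le_trans h1; rewrite /F; under eq_bigr do rewrite mul1r.
have g2 : `|F 1%N 1%N| <= (136 * A ^ 3)%:R * (tau + (M.+1 ^ 2)%:R * x ^+ N ^+ M).
  by apply: le_trans h2; rewrite /F; under eq_bigr do rewrite mul1r.
have g3 : `|F 0%N 1%N| <= (136 * C ^ 3)%:R * (tau + (M.+1 ^ 2)%:R * x ^+ N ^+ M).
  apply: le_trans h3; rewrite /F.
  rewrite [X in _ <= `|X|](eq_big (fun w => Q w < M%:Z) (fun w => isign R (0%:Z * w.1 + 1%:Z * w.2) * (x ^+ N) ^+ `|Q w|%N)) // => w; rewrite bqf_swap //.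
  by rewrite !mul0r mul1r addr0 add0r.
apply: le_trans (ler_normD _ _) _; apply: le_trans (lerD (ler_normD _ _) (lexx _)) _.
apply: le_trans (lerD (lerD g1 g3) g2) _.
rewrite -!mulrDl -!natrD (_ : 136 * A ^ 3 + 136 * C ^ 3 + 136 * A ^ 3 = 136 * (2 * A ^ 3 + C ^ 3))%N //.
by move: (A ^ 3)%N (C ^ 3)%N; clear; lia.
Qed.

Lemma bqf_double w : Q (2 * w.1, 2 * w.2) = 4 * Q w.
Proof. by rewrite /bqf /=; ring. Qed.

Lemma bqf_eq0 w : (Q w == 0) = (w == (0, 0)).
Proof.
apply/eqP/eqP => [Qw|->]; last by rewrite /bqf /= !mulr0.
have := bqf4 disc w; rewrite Qw mulr0 => E.
case: w E {Qw} => u v /= E.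
have v0 : v = 0.
  have : 0 <= (2 * A%:Z * u + b%:Z * v) ^+ 2 by exact: sqr_ge0.
  move: E p0; move: (_ ^+ 2) => s; clear; nia.
by rewrite v0; congr pair; move: E A0; rewrite v0; clear; nia.
Qed.

(** Halving both coordinates divides the value of the form by 4. *)
Lemma count_bqf_even (W : seq (int * int)) (m M : nat) : (m < M)%N -> uniq W ->
  (forall w, Q w < M%:Z -> w \in W) ->
  count (fun w => both_even w && (Q w == m%:Z)) W =
  if (4 %| m)%N then count (fun w => Q w == (m %/ 4)%N%:Z) W else 0%N.
Proof.
move=> mM Wu WM.
have evenP w : both_even w -> exists w', w = (2 * w'.1, 2 * w'.2).
  case: w => u v /andP[/= eu ev]; exists ((u %/ 2)%Z, (v %/ 2)%Z).
  by congr pair; move: eu ev => /=; clear; lia.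
case: ifP => m4; last first.
  apply/eqP; rewrite -leqn0 leqNgt -has_count; apply/hasPn => w _.
  apply/negP => /andP[/evenP[w' ->]]; rewrite bqf_double => /eqP E.
  by move: E (bqf_ge0 A0 disc w') m4; clear; lia.
rewrite -!size_filter -[in RHS](size_map (fun w => (2 * w.1, 2 * w.2))).
apply: perm_size; apply: uniq_perm; first exact: filter_uniq.
  rewrite map_inj_uniq ?filter_uniq // => -[u v] [u' v'] /= [e1 e2].
  by congr pair; move: e1 e2; clear; lia.
move=> w; rewrite mem_filter; apply/andP/mapP => [[/andP[/evenP[w' ->]]]|[w']].
  rewrite bqf_double => /eqP E _; exists w' => //; rewrite mem_filter.
  have E' : Q w' = (m %/ 4)%N%:Z by move: E m4; clear; lia.
  by rewrite E' eqxx WM // E'; move: mM; clear; lia.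
rewrite mem_filter => /andP[/eqP E _] ->; rewrite bqf_double E /both_even /= !abszM !oddM /=.
have E' : Q (2 * w'.1, 2 * w'.2) = m%:Z by rewrite bqf_double E; move: m4; clear; lia.
by split; [apply/eqP; move: m4; clear; lia|apply: WM; rewrite E' ltz_nat].
Qed.

Lemma parity_sum_counts (q : R) (W : seq (int * int)) M : uniq W ->
  (forall w, Q w < M%:Z -> w \in W) ->
  let r (m : nat) : R := (count (fun w => Q w == m%:Z) W)%:R in
  \sum_(w <- W | Q w < M%:Z) parity_weight w * q ^+ `|Q w|%N =
  \sum_(m < M) q ^+ m * (4 * (if (4 %| m)%N then r (m %/ 4)%N else 0) - r m).
Proof.
move=> Wu WM r.
have QE w (m : nat) : (`|Q w|%N == m) = (Q w == m%:Z).
  by rewrite -eqz_nat gez0_abs ?(bqf_ge0 A0 disc).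
have QM w : (`|Q w| < M)%N = (Q w < M%:Z).
  by rewrite -ltz_nat gez0_abs ?(bqf_ge0 A0 disc).
have -> : \sum_(w <- W | Q w < M%:Z) parity_weight w * q ^+ `|Q w|%N =
  4 * (\sum_(w <- W | both_even w && (`|Q w| < M)%N) q ^+ `|Q w|%N) -
  \sum_(w <- W | predT w && (`|Q w| < M)%N) q ^+ `|Q w|%N.
  rewrite big_mkcond [X in 4 * X]big_mkcond [X in _ - X]big_mkcond mulr_sumr -sumrB.
  apply: eq_bigr => w _; rewrite QM /= parity_weightE.
  by case: ifP; case: both_even; rewrite /= => _; ring.
rewrite !(sum_powers_count q (fun w => `|Q w|%N)) mulr_sumr -sumrB.
apply: eq_bigr => m _; rewrite mulrCA -mulrBr; congr (_ * (4 * _ - _)).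
  rewrite (eq_count (a2 := fun w => both_even w && (Q w == m%:Z))); last by move=> w; rewrite QE.
  by rewrite (count_bqf_even (ltn_ord m) Wu WM) /r; case: ifP.
by rewrite /r; congr _%:R; apply: eq_count => w /=; rewrite QE.
Qed.

Lemma count_bqf0 W M : (0 < M)%N -> uniq W -> (forall w, Q w < M%:Z -> w \in W) ->
  count (fun w => Q w == 0) W = 1%N.
Proof.
move=> M0 Wu WM; rewrite (eq_count (a2 := pred1 (0, 0))); last exact: bqf_eq0.
rewrite count_uniq_mem // WM //.
by have /eqP -> : Q (0, 0) == 0 by rewrite bqf_eq0.
Qed.

End ParitySum.

(** Take M = 3 n and d = 1 - q: each of three factors q^n is at most 1/(1 + n d). Two of them absorb
    (M + 1)^2 d^2, and the third makes the product small once n >= 9 K / (d^3 e). *)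
Lemma pow_tail (R : archiRealFieldType) (q K e : R) : 0 < q -> q < 1 -> 0 <= K -> 0 < e ->
  exists2 M, (0 < M)%N & K * (M.+1 ^ 2)%:R * q ^+ M <= e.
Proof.
move=> q0 q1 K0 e0; pose d := 1 - q.
have d0 : 0 < d by rewrite subr_gt0.
have d1 : d <= 1 by rewrite gerBl ltW.
pose c := 9 * K / (d ^+ 3 * e).
have c0 : 0 <= c by rewrite divr_ge0 ?mulr_ge0 ?exprn_ge0 // ltW.
pose n := (Num.bound c).+1.
have cn : c <= n%:R by apply: ltW (lt_le_trans (archi_boundP c0) _); rewrite ler_nat.
exists (3 * n)%N => //.
have n0 : 0 < n%:R :> R by rewrite ltr0n.
have q01 : 0 <= q <= 1 by rewrite !ltW.
have h := pow_mul_le1 n q01; rewrite -/d in h.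
have -> : q ^+ (3 * n) = (q ^+ n) ^+ 3 by rewrite mulnC exprM.
have y0 : 0 < q ^+ n by rewrite exprn_gt0.
have M2 : ((3 * n).+1 ^ 2)%:R * d ^+ 2 <= 9 * (1 + n%:R * d) ^+ 2.
  have -> : 9 * (1 + n%:R * d) ^+ 2 = (3 * (1 + n%:R * d)) ^+ 2 by rewrite exprMn; congr (_ * _); ring.
  have nd0 : 0 < n%:R * d by rewrite mulr_gt0.
  have m0 : 0 <= (3 * n).+1%:R * d by rewrite mulr_ge0 // ltW.
  rewrite natrX -exprMn; apply: lerXn2r; rewrite ?nnegrE //.
    by rewrite mulr_ge0 // addr_ge0 // ltW.
  by rewrite -natr1 natrM mulrDl mul1r -mulrA; move: nd0 d1 => ? ?; lra.
set t := 1 + n%:R * d in h M2.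
have t0 : 0 < t by rewrite /t addr_gt0 ?mulr_gt0.
have y3 : (q ^+ n) ^+ 3 * t ^+ 3 <= 1.
  by rewrite -exprMn exprn_ile1 // mulr_ge0 // ltW.
have td : n%:R * d <= t by rewrite lerDr.
have d30 : 0 < d ^+ 3 by rewrite exprn_gt0.
have cK : 9 * K <= e * d ^+ 2 * t.
  have : c * (d ^+ 3 * e) <= n%:R * (d ^+ 3 * e) by rewrite ler_wpM2r // mulr_ge0 // ltW.
  rewrite /c divfK ?mulf_neq0 ?gt_eqF // => h1; apply: le_trans h1 _.
  have -> : n%:R * (d ^+ 3 * e) = e * d ^+ 2 * (n%:R * d) by ring.
  by rewrite ler_wpM2l // mulr_ge0 ?exprn_ge0 // ltW.
have d20 : 0 < d ^+ 2 by rewrite exprn_gt0.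
rewrite -(ler_pM2r d20).
have -> : K * ((3 * n).+1 ^ 2)%:R * (q ^+ n) ^+ 3 * d ^+ 2 = K * (q ^+ n) ^+ 3 * (((3 * n).+1 ^ 2)%:R * d ^+ 2).
  by move: (_ ^ 2)%N%:R (q ^+ n) => a y; ring.
have y30 : 0 <= (q ^+ n) ^+ 3 by rewrite exprn_ge0 // ltW.
apply: (@le_trans _ _ (K * (q ^+ n) ^+ 3 * (9 * t ^+ 2))).
  by rewrite ler_wpM2l // mulr_ge0.
have -> : K * (q ^+ n) ^+ 3 * (9 * t ^+ 2) = (9 * K) * ((q ^+ n) ^+ 3 * t ^+ 2) by ring.
apply: (@le_trans _ _ (e * d ^+ 2 * t * ((q ^+ n) ^+ 3 * t ^+ 2))).
  by rewrite ler_wpM2r // mulr_ge0 // exprn_ge0 // ltW.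
have -> : e * d ^+ 2 * t * ((q ^+ n) ^+ 3 * t ^+ 2) = e * d ^+ 2 * ((q ^+ n) ^+ 3 * t ^+ 3) by ring.
by rewrite ler_piMr // mulr_ge0 ?exprn_ge0 // ltW.
Qed.

(** * Comparison of the two evaluations over all classes *)

Section ClassNumber.
Variable p : nat.
Hypothesis (pp : prime p) (p3 : p = 3 %[mod 4]) (pn3 : p <> 3%N).
Local Notation idx := (lat_idx p).
Implicit Types t : idx.
Let p0 : (0 < p)%N := prime_gt0 pp.

Local Notation fA t := (nat_of_ord t.1).
Local Notation fC t := (qnorm p t.2 %/ t.1)%N.
Local Notation fB t := ((nat_of_ord t.2).*2.+1)%N.

Lemma lat_form_disc t : t \in lat_reps p -> (4 * fA t * fC t = fB t ^ 2 + p)%N.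
Proof.
move=> /lat_reps_valid /andP[_ tx].
by rewrite -mulnA [(fA t * _)%N]mulnC divnK // qnorm4.
Qed.

(** Empty for other pairs, whose first entry may be 0, so that the window has no repetition for any
    [t]. *)
Definition lat_window M t : seq (int * int) :=
  if t \in lat_reps p then lattice_box (fA t) (fB t) (4 * fA t * M) else [::].

Lemma lat_window_uniq M t : uniq (lat_window M t).
Proof.
rewrite /lat_window; case: ifP => // /lat_reps_valid/lat_valid_gt0 a0.
exact: lattice_box_uniq.
Qed.

Lemma mem_lat_window M t w : t \in lat_reps p -> lat_form t w < M%:Z -> w \in lat_window M t.
Proof.
move=> tr tM; rewrite /lat_window tr; apply: (mem_lattice_box p0 _ (lat_form_disc tr)) => //.
exact: lat_valid_gt0 (lat_reps_valid tr).
Qed.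

Definition parity_total (q : rat) M : rat :=
  \sum_(t in lat_reps p) \sum_(w <- lat_window M t | lat_form t w < M%:Z)
    parity_weight rat w * q ^+ `|lat_form t w|%N.

Local Notation rho m := ((ideal_count p m)%:R : rat).

(** The value 0 is taken only at the origin, where each class has weight 4 - 1 = 3; for m > 0 all
    classes together represent m in 2 [ideal_count] ways, and the vectors with both entries even
    account for m/4. *)
Lemma parity_totalE q M : (0 < M)%N -> parity_total q M =
  3 * #|lat_reps p|%:R -
  2 * \sum_(1 <= m < M) q ^+ m * (rho m - 4 * (if (4 %| m)%N then rho (m %/ 4) else 0)).
Proof.
case: M => // M _; pose r t (m : nat) : rat := (count (fun w => lat_form t w == m%:Z) (lat_window M.+1 t))%:R.
have -> : parity_total q M.+1 = \sum_(t in lat_reps p) \sum_(m < M.+1)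
    q ^+ m * (4 * (if (4 %| m)%N then r t (m %/ 4)%N else 0) - r t m).
  apply: eq_bigr => t tr; have a0 := lat_valid_gt0 (lat_reps_valid tr).
  exact: (parity_sum_counts a0 (lat_form_disc tr) q (lat_window_uniq M.+1 t)
    (fun w => @mem_lat_window M.+1 t w tr)).
rewrite exchange_big big_ord_recl /=.
have r0 t : t \in lat_reps p -> r t 0%N = 1.
  move=> tr; have a0 := lat_valid_gt0 (lat_reps_valid tr).
  rewrite /r; have -> // := count_bqf0 p0 a0 (lat_form_disc tr) (ltn0Sn M) (lat_window_uniq _ _).
  by move=> w; apply: mem_lat_window.
have rm m : (0 < m < M.+1)%N -> \sum_(t in lat_reps p) r t m = 2 * rho m.
  case/andP=> m0 mM; rewrite -natr_sum -natrM; congr _%:R.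
  apply: lat_form_count => //; first exact: lat_window_uniq.
  by move=> t z tr E; apply: mem_lat_window => //; rewrite E ltz_nat.
congr (_ + _).
  rewrite expr0 (eq_bigr (fun _ => 3)); last first.
    by move=> t tr; rewrite mul1r !r0 //; ring.
  by rewrite sumr_const -[LHS]mulr_natr.
rewrite big_add1 /= big_mkord mulr_sumr -sumrN; apply: eq_bigr => m _.
rewrite -mulr_sumr mulrCA -mulrN; congr (_ * _).
rewrite sumrB /bump /= !add1n rm; last by move: (ltn_ord m); clear; lia.
rewrite -mulr_sumr; case: ifP => m4.
  rewrite rm; last by move: m4 (ltn_ord m); clear; lia.
  by ring.
by rewrite big1 // mulr0; ring.
Qed.

(** A common multiple of all 4 a and 4 c, so that one q suits every form and its swapped version. *)
Definition form_level : nat := \prod_(t in lat_reps p) (4 * fA t * (4 * fC t)).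
Definition form_const : rat := \sum_(t in lat_reps p) (136 * (2 * fA t ^ 3 + fC t ^ 3))%:R.

Lemma form_level_gt0 : (0 < form_level)%N.
Proof.
apply: prodn_cond_gt0 => t tr; have a0 := lat_valid_gt0 (lat_reps_valid tr).
by rewrite !muln_gt0 a0 (bqf_C_gt0 p0 (lat_form_disc tr)).
Qed.

Lemma parity_total_bound (x tau : rat) M : 0 < x -> x <= 1 -> 0 <= tau -> tau <= 1 ->
  form_level%:R * (1 - x) <= tau ^+ 2 ->
  `|parity_total (x ^+ form_level) M| <=
  form_const * (tau + (M.+1 ^ 2)%:R * (x ^+ form_level) ^+ M).
Proof.
move=> x0 x1 t0 t1 xt; apply: le_trans (ler_norm_sum _ _ _) _.
rewrite mulr_suml; apply: ler_sum => t tr.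
have a0 := lat_valid_gt0 (lat_reps_valid tr).
have dl : (4 * fA t * (4 * fC t) %| form_level)%N by rewrite /form_level (bigD1 t) //= dvdn_mulr.
apply: (parity_sum_bound p0 a0 _ (lat_form_disc tr)) => //.
- by rewrite /= odd_double.
- by apply: dvdn_trans dl; rewrite dvdn_mulr.
- by apply: dvdn_trans dl; rewrite dvdn_mull.
- exact: lat_window_uniq.
- by move=> w; apply: mem_lat_window.
Qed.

Local Notation h := (#|lat_reps p|%:R : rat).
Local Notation s := (mean_char_sum rat p).

Lemma card_reps_mean : h = s.
Proof.
(* K collects the coefficients of 1/k: N [form_const] from tau, 60 p^2 N from 1 - q, and 1 from the
   tail. *)
pose N := form_level; pose K := form_const * N%:R + (60 * p ^ 2)%:R * N%:R + 1.
have N0 := form_level_gt0; rewrite -/N in N0.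
have D0 : 0 <= form_const by apply: sumr_ge0.
have K0 : 0 <= K by rewrite /K !addr_ge0 // mulr_ge0.
have key k : (N <= k)%N -> (1 < k)%N -> k%:R * (3 * `|h - s|) <= K.
  move=> Nk k1; have k0 : 0 < k%:R :> rat by rewrite ltr0n ltnW.
  have kn0 : k%:R != 0 :> rat by rewrite gt_eqF.
  have k1' : 1 < k%:R :> rat by rewrite ltr1n.
  have i0 : 0 < k%:R^-1 :> rat by rewrite invr_gt0.
  have i1 : k%:R^-1 < 1 :> rat by rewrite invf_lt1.
  (* With this x the root of 1 - x is rational: N (1 - x) = N / k^2 is at most tau^2 = N^2 / k^2,
     and tau <= 1 as N <= k. *)
  pose x : rat := 1 - k%:R^-1 ^+ 2; pose q := x ^+ N; pose tau : rat := N%:R / k%:R.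
  have i20 : 0 < k%:R^-1 ^+ 2 :> rat by rewrite exprn_gt0.
  have i21 : k%:R^-1 ^+ 2 < 1 :> rat by rewrite exprn_ilt1 // ltW.
  have x0 : 0 < x by rewrite subr_gt0.
  have x1 : x < 1 by rewrite gtrBl.
  have t0 : 0 <= tau by rewrite divr_ge0.
  have t1 : tau <= 1 by rewrite ler_pdivrMr // mul1r ler_nat.
  have xt : N%:R * (1 - x) <= tau ^+ 2.
    rewrite /x opprB addrCA subrr addr0 exprMn; apply: ler_wpM2r; first exact: ltW.
    by rewrite -natrX ler_nat -{1}(expn1 N) leq_pexp2l.
  have q0 : 0 < q by rewrite exprn_gt0.
  have q1 : q < 1 by rewrite exprn_ilt1 // ?ltW // -lt0n.
  have q1' : 0 < 1 - q by rewrite subr_gt0.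
  have L0 : 0 <= form_const + 10 / (1 - q) + (18 * p ^ 2)%:R.
    by rewrite !addr_ge0 // divr_ge0 // ltW.
  have [M M0 tail] := pow_tail q0 q1 L0 i0.
  have h1 := parity_total_bound M x0 (ltW x1) t0 t1 xt.
  rewrite -/N -/q parity_totalE // in h1.
  have h2 := @ideal_count_lambert_bound rat p pp p3 q M q0 q1.
  have eq1 : (1 - q) <= N%:R * k%:R^-1.
    apply: le_trans (bernoulli_sub N _) _; first by rewrite !ltW.
    rewrite ler_wpM2l // /x opprB addrCA subrr addr0 expr2 ler_piMl // ltW //.
  have y0 : 0 < q ^+ M by rewrite exprn_gt0.
  have tri : 3 * `|h - s| <= form_const * (tau + (M.+1 ^ 2)%:R * q ^+ M) +
     2 * ((5 * M%:R / (1 - q) + (9 * p ^ 2)%:R) * q ^+ M + (30 * p ^ 2)%:R * (1 - q)).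
    move: h1 h2; set Y := \sum_(1 <= m < M) _; move: Y => Y h1 h2.
    have -> : 3 * `|h - s| = `|(3 * h - 2 * Y) + 2 * (Y - 3 / 2 * s)|.
      transitivity `|3 * (h - s)|; first by rewrite normrM ger0_norm.
      congr `|_|.
      by move: (mean_char_sum _ _) (#|_|%:R) => a b; field.
    apply: le_trans (ler_normD _ _) _; apply: lerD => //.
    by rewrite normrM ger0_norm // ler_wpM2l.
  have M1 : M%:R <= (M.+1 ^ 2)%:R :> rat by rewrite ler_nat; clear; nia.
  have M2 : 1 <= (M.+1 ^ 2)%:R :> rat by rewrite ler1n expn_gt0.
  have f1 : form_const * ((M.+1 ^ 2)%:R * q ^+ M) + 2 * ((5 * M%:R / (1 - q) + (9 * p ^ 2)%:R) * q ^+ M)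
     <= k%:R^-1.
    apply: le_trans tail.
    have e1 : (18 * p ^ 2)%:R = 2 * (9 * p ^ 2)%:R :> rat by rewrite -natrM mulnA.
    rewrite e1.
    have g1 : 10 / (1 - q) * M%:R * q ^+ M <= 10 / (1 - q) * (M.+1 ^ 2)%:R * q ^+ M.
      by rewrite ler_wpM2r ?(ltW y0) // ler_wpM2l // divr_ge0 // ltW.
    have g2 : (9 * p ^ 2)%:R * q ^+ M <= (9 * p ^ 2)%:R * (M.+1 ^ 2)%:R * q ^+ M.
      by rewrite ler_wpM2r ?(ltW y0) // ler_peMr.
    move: g1 g2; move: (q ^+ M) ((9 * p ^ 2)%:R : rat) ((M.+1 ^ 2)%:R : rat) ((1 - q)^-1) (form_const) (M%:R : rat).
    move=> y P m2 v D m g1 g2; lra.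
  have f2 : (60 * p ^ 2)%:R * (1 - q) <= (60 * p ^ 2)%:R * (N%:R * k%:R^-1) :> rat by rewrite ler_wpM2l.
  have e2 : (60 * p ^ 2)%:R = 2 * (30 * p ^ 2)%:R :> rat by rewrite -natrM mulnA.
  have tot : 3 * `|h - s| <= K * k%:R^-1.
    rewrite /K; move: tri f1 f2; rewrite e2 /tau.
    move: (`|h - s|) (q ^+ M) ((M.+1 ^ 2)%:R : rat) (5 * M%:R / (1 - q)) ((9 * p ^ 2)%:R : rat)
      ((30 * p ^ 2)%:R : rat) (1 - q) form_const (N%:R : rat) (k%:R^-1).
    by move=> *; lra.
  by rewrite mulrC -ler_pdivlMr.
apply/eqP; rewrite -subr_eq0 -normr_eq0; apply/negPn/negP => hs.
have e0 : 0 < `|h - s| by rewrite lt_def hs normr_ge0.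
pose k := (Num.bound (K / `|h - s|)%R + (N + 2))%N.
have kb : K < k%:R * `|h - s|.
  rewrite -ltr_pdivrMr //; apply: lt_le_trans (archi_boundP _) _; first by rewrite divr_ge0.
  by rewrite ler_nat leq_addr.
have Nk : (N <= k)%N by rewrite /k; clear; lia.
have k1 : (1 < k)%N by rewrite /k; clear; lia.
have := le_lt_trans (key k Nk k1) kb; apply/negP; rewrite -leNgt.
by rewrite ler_wpM2l // ler_peMl.
Qed.

Lemma class_number_char_sum :
  (p * class_number (quadratic_field (- p%:Z)))%:Z = \sum_(k < p) \sum_(i < k.+1) chi p i.
Proof.
rewrite class_numberE //; apply/eqP; rewrite -(eqr_int rat) -pmulrn natrM card_reps_mean.
rewrite /mean_char_sum mulrC divfK ?pnatr_eq0 -?lt0n // rmorph_sum /=; apply/eqP.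
by apply: eq_bigr => k _; rewrite rmorph_sum.
Qed.

End ClassNumber.

(** * Conclusion *)

Lemma sum_fold (V : nmodType) (F : nat -> V) n :
  \sum_(k < n.*2.+1) F k = F 0%N + \sum_(i < n) (F i.+1 + F (n.*2.+1 - i.+1)%N).
Proof.
rewrite big_ord_recl; congr (_ + _).
rewrite -(big_mkord xpredT (fun i => F (bump 0 i))) -addnn big_mkord big_split_ord /= big_split /=; congr (_ + _).
rewrite (reindex_inj rev_ord_inj); apply: eq_bigr => i _ /=; congr F.
by rewrite /bump; move: (ltn_ord i); clear; lia.
Qed.

Lemma sum_even_odd (V : nmodType) (F : nat -> V) n :
  \sum_(k < n.*2.+1) F k = F 0%N + \sum_(i < n) (F i.+1.*2 + F (n.*2.+1 - i.+1.*2)%N).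
Proof.
rewrite big_split /= addrA [X in _ = _ + X](reindex_inj rev_ord_inj) /=.
have -> : \sum_(i < n) F (n.*2.+1 - (n - i.+1).+1.*2)%N = \sum_(i < n) F i.*2.+1.
  by apply: eq_bigr => i _; congr F; move: (ltn_ord i); clear; lia.
elim: n => [|n IH]; first by rewrite big_ord_recl !big_ord0 !addr0.
rewrite doubleS 2!big_ord_recr /= IH [X in _ = _ + X + _]big_ord_recr [X in _ = _ + X]big_ord_recr /=.
by rewrite !doubleS -!addrA; congr (_ + (_ + _)); rewrite [RHS]addrCA; congr (_ + _); rewrite addrC.
Qed.

Lemma sign_sum_prod (e : nat -> int) n : (forall k, (k < n)%N -> e k = 1 \/ e k = -1) ->
  exists N : nat, \sum_(k < n) e k = n%:Z - 2 * N%:Z /\ \prod_(k < n) e k = (-1) ^+ N.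
Proof.
elim: n => [|n IH] en; first by exists 0%N; rewrite !big_ord0.
have [k kn|N [S P]] := IH; first by apply: en; rewrite ltnW.
rewrite !big_ord_recr /= S P; case: (en n (ltnSn n)) => ->.
  by exists N; split; [clear; lia|rewrite mulr1].
by exists N.+1; split; [clear; lia|rewrite exprSr].
Qed.

Section Conclusion.
Variable p : nat.
Hypothesis (pp : prime p) (op : odd p) (p3 : p = 3 %[mod 4]) (pn3 : p <> 3%N).
Local Notation n := (p./2).
Local Notation h := (class_number (quadratic_field (- p%:Z))).

(** In the double sum chi(i) occurs p - i times, and the part with the constant p vanishes over a
    full period. *)
Lemma class_number_moment : \sum_(k < p) k%:Z * chi p k = - (p%:Z * h%:Z).
Proof.
rewrite -PoszM (class_number_char_sum pp p3 pn3).
have -> : \sum_(k < p) \sum_(i < k.+1) chi p i = \sum_(i < p) (p%:Z - i%:Z) * chi p i.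
  transitivity (\sum_(k < p) \sum_(i < p) (if (i <= k)%N then chi p i else 0)).
    by apply: eq_bigr => k _; rewrite (big_ord_widen p (fun i => chi p i) (ltn_ord k)) big_mkcond.
  rewrite exchange_big; apply: eq_bigr => i _ /=.
  rewrite -big_mkcond /= -(big_mkord (fun k => i <= k)%N (fun _ => chi p i)).
  rewrite -(big_nat_widenl i 0 p xpredT) // sumr_const_nat -mulr_natl.
  by rewrite natz subzn // ltnW.
under [in RHS]eq_bigr do rewrite mulrBl.
by rewrite sumrB -mulr_sumr sum_chi // mulr0 sub0r opprK.
Qed.

Lemma chi_reflect k : (k <= p)%N -> chi p (p - k) = - chi p k.
Proof.
move=> kp; rewrite /chi natrB // (_ : p%:R = 0 :> 'F_p) ?sub0r ?lgN_3mod4 //.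
by apply/eqP; rewrite natr_Fp_eq0.
Qed.

Lemma chi_double k : chi p k.*2 = chi p 2 * chi p k.
Proof. by rewrite /chi -mul2n natrM lgM. Qed.

Lemma class_number_half_sum :
  (2 - chi p 2) * h%:Z = \sum_(i < n) chi p i.+1.
Proof.
set H := \sum_(i < n) _; pose U := \sum_(i < n) i.+1%:Z * chi p i.+1.
have pE := odd_halfS op; have M := class_number_moment.
(* The pair i, p - i contributes (2 i - p) chi(i), because chi is odd. *)
have V1 : - (p%:Z * h%:Z) = 2 * U - p%:Z * H.
  have E := sum_fold (fun k => k%:Z * chi p k) n; rewrite -pE mul0r add0r M in E; rewrite {}E.
  rewrite /U /H !mulr_sumr -sumrB; apply: eq_bigr => i _.
  have ip : (i.+1 <= p)%N by move: (ltn_ord i) pE; clear; lia.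
  by rewrite chi_reflect // -subzn //; ring.
(* The pair 2 i, p - 2 i contributes (4 i - p) chi(2) chi(i); comparing with the previous evaluation
   eliminates [U]. *)
have V2 : - (p%:Z * h%:Z) = chi p 2 * (4 * U - p%:Z * H).
  have E := sum_even_odd (fun k => k%:Z * chi p k) n; rewrite -pE mul0r add0r M in E; rewrite {}E.
  rewrite /U /H !mulr_sumr -sumrB mulr_sumr; apply: eq_bigr => i _.
  have ip : (i.+1.*2 <= p)%N by move: (ltn_ord i) pE; clear; lia.
  rewrite chi_reflect // chi_double -subzn // -mul2n PoszM; ring.
have e2 : chi p 2 * chi p 2 = 1.
  by apply: lg_sqr => //; rewrite natr_Fp_eq0 // gtnNdvd // odd_prime_gt2.
have p0 : p%:Z != 0 by have := prime_gt0 pp; clear; lia.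
apply: (mulfI p0).
have V3 : chi p 2 * - (p%:Z * h%:Z) = 4 * U - p%:Z * H by rewrite V2 mulrA e2 mul1r.
transitivity (- (2 * (- (p%:Z * h%:Z)) - chi p 2 * - (p%:Z * h%:Z))); first by ring.
by rewrite V3 V1; ring.
Qed.

Lemma class_number_sign :
  (-1) ^+ ((h - 1) %/ 2) = - \prod_(1 <= k < n.+1) lg (k%:R : 'F_p).
Proof.
have pE := odd_halfS op.
have [k kn|N [S P]] := @sign_sum_prod (fun k => chi p k.+1) n.
  by apply: lg_cases; rewrite // natr_Fp_eq0 // gtnNdvd //; move: kn pE; clear; lia.
rewrite big_add1 /= big_mkord P.
have := class_number_half_sum; rewrite S {1}/chi lg2_3mod4 //.
have n4 : n = (2 * (p.+1 %/ 4) - 1)%N by move: p3 pE; clear; lia.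
have c1 : (0 < p.+1 %/ 4)%N by move: p3; clear; lia.
move: h n4 c1; move: n (p.+1 %/ 4)%N => n' c h n4 c1.
rewrite -signr_odd => hE.
(* With n = 2 c - 1 the relation is (2 - (-1)^c) h = 2 c - 1 - 2 N. For even c it gives h = -1 - 2 N
   modulo 4, and for odd c, where the factor is 3, h = 2 N - 1 modulo 4. In both cases h is odd and
   (h - 1)/2 has the parity opposite to that of N. *)
have -> : (-1) ^+ ((h - 1) %/ 2) = (-1) ^+ (~~ odd N) :> int.
  rewrite -signr_odd; congr (_ ^+ nat_of_bool _).
  by move: hE; rewrite n4; case: (boolP (odd c)) => oc; rewrite /= ?expr0 ?expr1; clear -oc c1; lia.
by rewrite -(signr_odd _ N); case: odd.
Qed.

End Conclusion.

(* In the second case p = 3 has to be excluded: \det (Mp 3) = -1, while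
   Q(sqrt(-3)) has class number 1. *)
Theorem theorem1p1 (p : nat) (p_prime : prime p) (p_odd : odd p) :
  (p = 1 %[mod 4] -> \det (Mp p) = (-1) ^+ ((p - 1) %/ 4)) /\
  (p = 3 %[mod 4] -> p <> 3%N ->
     \det (Mp p) =
       (-1) ^+ ((class_number (quadratic_field (- p%:Z)) - 1) %/ 2)).
Proof.
split=> [p1|p3 pn3]; first exact: det_Mp_1mod4.
by rewrite class_number_sign // det_Mp_3mod4.
Qed.
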